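(* Let $D\subset\mathbb{C}^n$ be a convex tube domain containing no complex affine lines and let $\varphi\in\mathcal{M}^n$ be a holomorphic map with boundary measure $\mu$. Consider the decomposition $$\mu = g\,d\mathcal{L}^{\mathbb{T}}+\varrho\,d\nu,$$ where $g=(g_1,\ldots,g_n):\mathbb{T}\to\mathbb{R}^n$ and $\varrho:\mathbb{T}\to\partial\mathbb{B}_n$ are Borel-measurable maps, $g_1,\ldots,g_n\in L^1(\mathbb{T},\mathcal{L}^{\mathbb{T}})$, and $\nu$ is a positive, finite Borel measure on $\mathbb{T}$ singular to $\mathcal{L}^{\mathbb{T}}$. Then $\varphi(\mathbb{D})\subset D$ and $\varphi$ is a complex geodesic for $D$ if and only if there exists a map $h\in\mathcal{H}^n$, $h\not\equiv 0$, such that the following conditions hold: (i) $g(\lambda)\in P_D(\bar\lambda h(\lambda))$ for $\mathcal{L}^{\mathbb{T}}$-a.e. $\lambda\in\mathbb{T}$, (ii) $\langle\bar\lambda h(\lambda),\varrho(\lambda)\rangle\geq 0$ for $\nu$-a.e. $\lambda\in\mathbb{T}$, (iii) $\varrho(\lambda)\in S_D$ for $\nu$-a.e. $\lambda\in\mathbb{T}$, (iv) $\mathrm{Re}\,\varphi(0)\in\mathrm{Re}\,D$. Moreover, if $\varphi(\mathbb{D})\subset D$, $\varphi$ is a complex geodesic for $D$ and $h\in\mathcal{H}^n$, $h\not\equiv 0$, is a map satisfying the conditions (i)-(iv), then there also hold: (v) $\varrho(\lambda)\in S_D\cap\{\bar\lambda h(\lambda)\}^{\perp}$ for $\nu$-a.e.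 $\lambda\in\mathbb{T}$, (vi) $\nu(\{\lambda\in\mathbb{T}:\bar\lambda h(\lambda)\in\mathrm{int}\,W_D\})=0$, (vii) $\bar\lambda h(\lambda)\in\overline{W_D}$ for every $\lambda\in\mathbb{T}$.
   Context: $\mathbb{D}$ and $\mathbb{T}$ are the unit disc and the unit circle in $\mathbb{C}$; $\mathcal{L}^{\mathbb{T}}$ is the Lebesgue (arc length) measure on $\mathbb{T}$, of total mass $2\pi$. $\langle\cdot,\cdot\rangle$ is the standard inner product on $\mathbb{R}^n$, $\mathbb{B}_n$ the open Euclidean unit ball in $\mathbb{R}^n$, $\partial\mathbb{B}_n$ the unit sphere; for $A\subset\mathbb{R}^n$, $A^{\perp}=\{v\in\mathbb{R}^n:\langle v,a\rangle=0\ \forall a\in A\}$. $\mathcal{O}(X,Y)$ denotes the holomorphic maps from $X$ to $Y$. A tube domain in $\mathbb{C}^n$ is a set $D=\Omega+i\mathbb{R}^n$ with $\Omega\subset\mathbb{R}^n$ a (non-empty) domain; $\Omega$ is called the base of $D$ and denoted $\mathrm{Re}\,D$. A holomorphic map $\varphi:\mathbb{D}\to D$ into a convex domain $D\subset\mathbb{C}^n$ is a complex geodesic for $D$ if there exists a holomorphic $f:D\to\mathbb{D}$ with $f\circ\varphi=\mathrm{id}_{\mathbb{D}}$. A real Borel measure is a finite signed Borel measure. The boundary measure of $\varphi=(\varphi_1,\dots,\varphi_n)\in\mathcal{O}(\mathbb{D},\mathbb{C}^n)$, if it exists, is the unique $n$-tuple $\mu=(\mu_1,\ldots,\mu_n)$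 of real Borel measures on $\mathbb{T}$ such that $\varphi(\lambda)=\frac{1}{2\pi}\int_{\mathbb{T}}\frac{\zeta+\lambda}{\zeta-\lambda}\,d\mu(\zeta)+i\,\mathrm{Im}\,\varphi(0)$ for all $\lambda\in\mathbb{D}$ (componentwise). $\mathcal{M}^n$ is the set of $\varphi\in\mathcal{O}(\mathbb{D},\mathbb{C}^n)$ admitting a boundary measure. Every $n$-tuple $\mu$ of real Borel measures on $\mathbb{T}$ has a decomposition $\mu=g\,d\mathcal{L}^{\mathbb{T}}+\varrho\,d\nu$ of the form described in the claim, with $\nu$ unique, $\varrho$ unique up to a $\nu$-null set, and $g$ unique up to an $\mathcal{L}^{\mathbb{T}}$-null set. $\mathcal{H}^n:=\{h\in\mathcal{O}(\mathbb{C},\mathbb{C}^n):\bar\lambda h(\lambda)\in\mathbb{R}^n\ \forall\lambda\in\mathbb{T}\}$. For a convex tube domain $D\subset\mathbb{C}^n$ and $v\in\mathbb{R}^n$: $W_D:=\{v\in\mathbb{R}^n:\sup_{x\in\mathrm{Re}\,D}\langle x,v\rangle<\infty\}$, $S_D:=\{y\in\mathbb{R}^n:\langle y,v\rangle\leq 0\ \forall v\in W_D\}$, $P_D(v):=\{p\in\overline{\mathrm{Re}\,D}:\langle x-p,v\rangle<0\text{ for all }x\in\mathrm{Re}\,D\}$. *)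

(* Defs.v *)
From HB Require Import structures.
From mathcomp Require Import all_boot all_order all_algebra.
From mathcomp Require Import complex.
From mathcomp Require Import all_classical all_reals all_analysis.

Set Implicit Arguments.
Unset Strict Implicit.
Unset Printing Implicit Defensive.

Import Order.TTheory GRing.Theory Num.Theory.
Import numFieldNormedType.Exports.

Local Open Scope classical_set_scope.
Local Open Scope ring_scope.

(* [R[i]] packaged as a [numClosedFieldType], so that the normed-module
   structure that every numFieldType has over itself is inferred for it. *)
Definition C (R : realType) : numClosedFieldType := R[i].

Definition mkC (R : realType) (x y : R) : C R := Complex x y.
Definition ReC (R : realType) (z : C R) : R := complex.Re z.
Definition ImC (R : realType) (z : C R) : R := complex.Im z.

Definition mkCn (R : realType) (n : nat) (x y : 'rV[R]_n) : 'rV[C R]_n :=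
  \row_i mkC (x 0 i) (y 0 i).
Definition ReCn (R : realType) (n : nat) (z : 'rV[C R]_n) : 'rV[R]_n :=
  \row_i ReC (z 0 i).

Definition unit_disc (R : realType) : set (C R) := [set z | `|z| < 1].
Definition unit_circle (R : realType) : set (C R) := [set z | `|z| = 1].

Lemma unit_circle1 (R : realType) : unit_circle (1 : C R).
Proof. by rewrite /unit_circle /= normr1. Qed.

HB.instance Definition _ (R : realType) :=
  isPointed.Build (set_type (@unit_circle R)) (SigSub (mem_set (unit_circle1 R))).

(* The unit circle with its Borel sigma-algebra; the open sets are those of the
   topology induced from C. *)
Definition circle (R : realType) :=
  g_sigma_algebraType (@open (set_type (@unit_circle R))).

Definition cval (R : realType) (l : circle R) : C R :=
  set_val (l : set_type (@unit_circle R)).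

Lemma norm_cis (R : realType) (t : R) : unit_circle (mkC (cos t) (sin t)).
Proof.
by rewrite /unit_circle /= normc_def cos2Dsin2 sqrtr1.
Qed.

Definition cis (R : realType) (t : R) : circle R :=
  SigSub (mem_set (norm_cis t)).

Lemma continuous_mkC0 (R : realType) : continuous (fun x : R => mkC x 0).
Proof.
move=> x; apply/cvgrPdist_lt => e e0.
have e1 : e = mkC (ReC e) 0.
  by case: e e0 => a b; rewrite /= ltcE /= => /andP[/eqP -> _].
have re0 : 0 < ReC e by move: e0; rewrite ltcE /= => /andP[].
have /cvgrPdist_lt/(_ _ re0) : y @[y --> x] --> x by exact: cvg_id.
apply: filterS => y xy; rewrite e1.
rewrite (_ : mkC x 0 - mkC y 0 = mkC (x - y) 0); last first.
  by rewrite /mkC; apply/eqP; rewrite eq_complex /= subr0 !eqxx.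
rewrite normc_def /= expr0n addr0 sqrtr_sqr.
by rewrite (ltcR `|x - y| (ReC e)).
Qed.

Lemma continuous_cis (R : realType) :
  continuous (fun t : R => mkC (cos t) (sin t)).
Proof.
have -> : (fun t : R => mkC (cos t) (sin t)) =
          (fun t : R => mkC (cos t) 0 + mkC 0 1 * mkC (sin t) 0).
  apply/funext => t; apply/eqP; rewrite eq_complex /=.
  by rewrite ?(mul0r, mul1r, mulr0, subr0, addr0, add0r) ?eqxx.
move=> t; apply: cvgD.
  apply: (@continuous_comp R R (C R) (@cos R) (fun x : R => mkC x 0)).
    exact: continuous_cos.
  exact: continuous_mkC0.
apply: cvgM; first exact: cvg_cst.
apply: (@continuous_comp R R (C R) (@sin R) (fun x : R => mkC x 0)).
  exact: continuous_sin.
exact: continuous_mkC0.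
Qed.

Lemma measurable_cis (R : realType) : measurable_fun [set: R] (@cis R).
Proof.
apply: (@measurability _ _ R (circle R) setT (@cis R)
  (@open (set_type (@unit_circle R)))) => //.
move=> _ [_ [W oW <-] <-]; rewrite setTI.
apply: measurable_realfun.open_measurable.
have /continuousP/(_ _ oW) := @continuous_cis R.
by rewrite /cis.
Qed.

Definition angles (R : realType) : set R := `[0, 2 * pi[%classic.

Lemma measurable_angles (R : realType) : measurable (@angles R).
Proof. exact: measurable_itv. Qed.

(* Arc length on the circle, of total mass 2 pi: the image of Lebesgue measure
   on [0, 2 pi[ under t |-> exp (i t). *)
Definition arclength (R : realType) : {measure set (circle R) -> \bar R}.
Proof.
refine (pushforward (mrestr (@lebesgue_measure R) (@measurable_angles R)) (@cis R)).
exact: measurable_cis.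
Defined.

(* The scalar field is C R, so [differentiable] is complex Frechet
   differentiability. *)
Definition holomorphic_on (R : realType) (V W : normedModType (C R))
    (U : set V) (f : V -> W) : Prop :=
  forall z, U z -> differentiable f z.

Section convex_geometry.
Context {R : realType} {n : nat}.
Implicit Types (u v : 'rV[R]_n) (A : set 'rV[R]_n) (D : set 'rV[C R]_n).

Definition inner u v : R := \sum_(i < n) u 0 i * v 0 i.

(* [`|v|] would be the sup norm. *)
Definition enorm v : R := Num.sqrt (inner v v).

Definition perp A : set 'rV[R]_n :=
  [set v | forall a, A a -> inner v a = 0].

Definition tube_domain D : Prop :=
  exists Omega : set 'rV[R]_n,
    [/\ Omega !=set0, open Omega, connected Omega &
        D = [set mkCn x y | x in Omega & y in [set: 'rV[R]_n]]].

(* The coefficients [{i01 C R}] in [convex_set] range over the z : C R with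
   0 <= z <= 1; such z are real, so this is ordinary (real) convexity. *)
Definition convex_tube_domain D : Prop := tube_domain D /\ convex_set D.

Definition contains_complex_line D : Prop :=
  exists a b : 'rV[C R]_n, b != 0 /\ forall z : C R, D (a + z *: b).

Definition base D : set 'rV[R]_n := @ReCn R n @` D.

Definition W_ D : set 'rV[R]_n :=
  [set v | (ereal_sup [set (inner x v)%:E | x in base D] < +oo)%E].

Definition S_ D : set 'rV[R]_n :=
  [set y | forall v, W_ D v -> inner y v <= 0].

Definition P_ D v : set 'rV[R]_n :=
  [set p | closure (base D) p /\ forall x, base D x -> inner (x - p) v < 0].

End convex_geometry.

Definition complex_geodesic (R : realType) (n : nat) (D : set 'rV[C R]_n)
    (phi : C R -> 'rV[C R]_n) : Prop :=
  [/\ holomorphic_on (@unit_disc R) phi,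
      phi @` @unit_disc R `<=` D &
      exists f : 'rV[C R]_n -> C R,
        [/\ holomorphic_on D f, f @` D `<=` @unit_disc R &
            forall z, unit_disc z -> f (phi z) = z]].

Section charge_integral.
Context {d : measure_display} {T : measurableType d} {R : realType}.
Variable mu : {charge set T -> \bar R}.

Let hahnP := cid (Hahn_decomposition mu).
Let hahnN := cid (projT2 hahnP).

(* The positive and negative parts do not depend on the chosen Hahn
   decomposition. *)
Definition charge_Rintegral (f : T -> R) : R :=
  \int[jordan_pos (projT2 hahnN)]_x f x - \int[jordan_neg (projT2 hahnN)]_x f x.

Definition charge_Cintegral (f : T -> C R) : C R :=
  mkC (charge_Rintegral (fun x => ReC (f x)))
      (charge_Rintegral (fun x => ImC (f x))).

End charge_integral.

Definition boundary_measure (R : realType) (n : nat)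
    (phi : C R -> 'rV[C R]_n)
    (mu : 'I_n -> {charge set (circle R) -> \bar R}) : Prop :=
  forall z, unit_disc z -> forall i,
    phi z 0 i =
      mkC (2 * pi)^-1 0 *
        charge_Cintegral (mu i) (fun l => (cval l + z) / (cval l - z))
      + mkC 0 (ImC (phi 0 0 i)).

Definition borel_map (R : realType) (n : nat) (f : circle R -> 'rV[R]_n) : Prop :=
  measurable_fun [set: circle R]
    (f : circle R -> g_sigma_algebraType (@open 'rV[R]_n)).

Definition mutually_singular (d : measure_display) (T : measurableType d)
    (R : realType) (m1 m2 : set T -> \bar R) : Prop :=
  exists A, [/\ measurable A, m1 A = 0%E & m2 (~` A) = 0%E].

(* mu = g dL + rho dnu, as an equality of R^n-valued set functions. *)
Definition boundary_decomposition (R : realType) (n : nat)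
    (mu : 'I_n -> {charge set (circle R) -> \bar R})
    (g rho : circle R -> 'rV[R]_n)
    (nu : {measure set (circle R) -> \bar R}) : Prop :=
  forall i A, measurable A ->
    mu i A = (\int[@arclength R]_(l in A) (g l 0 i)%:E
              + \int[nu]_(l in A) (rho l 0 i)%:E)%E.

Definition Hclass (R : realType) (n : nat) : set (C R -> 'rV[C R]_n) :=
  [set h | holomorphic_on setT h /\
     forall l : circle R, forall i, ImC (((cval l)^* *: h (cval l) : 'rV[C R]_n) 0 i) = 0].

(* The vector conj(l) h(l), which is real when h is in Hclass. *)
Definition twist (R : realType) (n : nat) (h : C R -> 'rV[C R]_n)
    (l : circle R) : 'rV[R]_n :=
  ReCn ((cval l)^* *: h (cval l)).

Definition geodesic_conditions (R : realType) (n : nat) (D : set 'rV[C R]_n)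
    (phi : C R -> 'rV[C R]_n) (g rho : circle R -> 'rV[R]_n)
    (nu : {measure set (circle R) -> \bar R})
    (h : C R -> 'rV[C R]_n) : Prop :=
  [/\ {ae @arclength R, forall l, P_ D (twist h l) (g l)},
      {ae nu, forall l, 0 <= inner (twist h l) (rho l)},
      {ae nu, forall l, S_ D (rho l)} &
      base D (ReCn (phi 0))].

(* Main.v *)
(* Let [f] be a left inverse of [phi] and [h_j(l)] the j-th partial derivative of
   [f] at [phi(l)].  Composing [f] with the segments from [phi(l)] to [z] and
   differentiating the two-point Schwarz-Pick inequality shows that a certain
   real-linear expression [pick_form] in the values of
   [Q_z(l) = sum_j h_j(l) (z_j - phi_j(l))] at two points is nonpositive.  Since
   [D] is a tube, [pick_form] vanishes on [i h_j]; this makes [h] a quadratic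
   polynomial in [Hclass].  On the other hand [pick_form] turns Herglotz kernels
   into products of Poisson kernels [P], so that on [Q_z] it is a positive factor
   times the integral of
   [P P (<H, Re z - g> dL - <H, rho> dnu)], where [H = twist h]; concentrating
   [P] at a point of the circle yields the conditions on [g] and [rho].
   Conversely, under these conditions [pick_form] is negative on [Q_z], so [Q_z]
   has at most one zero in the disc; the zero exists and depends holomorphically
   on [z], and it is the left inverse.  Its existence is proved first for
   [Q_z(l) - e l] with [e > 0], and the zeros stay away from the circle as [e]
   tends to 0 by the Schwarz-Pick inequality along a chain of discs in [D]. *)
Require Import Defs.
From HB Require Import structures.
From mathcomp Require Import all_boot all_order all_algebra.
From mathcomp Require Import complex.
From mathcomp Require Import all_classical all_reals all_analysis.
From mathcomp Require Import interval_inference measurable_realfun ring lra.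

Set Implicit Arguments.
Unset Strict Implicit.
Unset Printing Implicit Defensive.

Import Order.TTheory GRing.Theory Num.Theory.
Import numFieldNormedType.Exports.

Local Open Scope classical_set_scope.
Local Open Scope ring_scope.

(** Nonpositivity of [pick_form] at all pairs of points says that the flow of a vector field on the
    disc does not increase hyperbolic distance to first order. The fields on which it vanishes are
    those of the automorphism group, and they are quadratic polynomials. This is why [i h_j], along
    which a tube allows motion in both directions, has to be quadratic, and why one formula serves
    both implications: necessity reads the sign off a given [f], sufficiency reads it off the
    measures and recovers [f z] as the rest point of the field [Q_z]. For [z = phi l] this rest
    point is [l].

    The obstacle in sufficiency is that the strict negativity of the form on [Q_z] decays at the
    circle like the Harnack constants, so that the rest point might escape to the boundary. The
    field [- e l] points inwards and contributes a bound that survives there; the price is that all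
    later estimates must be uniform in [e].

    In necessity, condition (i) asks for strict inequalities at all points of the base at once,
    whereas the analysis gives weak ones at one point, outside a null set. Countable families of
    rational points and of half-spaces close this gap. *)

Lemma eq_ler (R : numDomainType) (x y : R) : x = y -> x <= y.
Proof. by move->. Qed.

(** * Cauchy's theorem on rectangles *)

Section intervals.
Context {R : realType}.
Notation leb := (@lebesgue_measure R).
Implicit Types (f : R -> R) (a b : R).

Lemma integrable_pointwise_continuous f a b :
  (forall x, a <= x <= b -> {for x, continuous f}) ->
  leb.-integrable `[a, b] (EFin \o f).
Proof.
move=> cf; apply: continuous_compact_integrable; first exact: segment_compact.
apply: continuous_in_subspaceT => x; rewrite inE /= => xab.
exact: cf.
Qed.

Lemma Rintegral_itv_split f a m b : a <= m <= b ->
  (forall x, a <= x <= b -> {for x, continuous f}) ->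
  \int[leb]_(x in `[a, b]) f x =
  \int[leb]_(x in `[a, m]) f x + \int[leb]_(x in `[m, b]) f x.
Proof.
move=> /andP[am mb] cf.
have intf : leb.-integrable `[a, b] (EFin \o f).
  exact: integrable_pointwise_continuous.
have E : `[a, b]%classic = `[a, m]%classic `|` `]m, b]%classic.
  rewrite -itv_bndbnd_setU ?bnd_simp//.
rewrite [in LHS]E Rintegral_setU//; last 2 first.
- by rewrite -E.
- rewrite disj_set2E; apply/eqP; apply/seteqP; split => // x [] /=.
  by rewrite !in_itv /= => /andP[_ xm] /andP[]; rewrite ltNge xm.
congr (_ + _); rewrite Rintegral_itv_obnd_cbnd//.
apply: integrableS intf => // x /=; rewrite !in_itv /= => /andP[mx ->].
by rewrite andbT (le_trans am (ltW mx)).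
Qed.

Lemma Rintegral_itv_near f a b (k M : R) : a <= b ->
  leb.-integrable `[a, b] (EFin \o f) ->
  (forall x, a <= x <= b -> `|f x - k| <= M) ->
  `|\int[leb]_(x in `[a, b]) f x - k * (b - a)| <= M * (b - a).
Proof.
move=> ab intf fk.
have cst (c : R) : leb.-integrable `[a, b] (EFin \o cst c).
  by apply: integrable_pointwise_continuous => x _; exact: cst_continuous.
have intc (c : R) : \int[leb]_(x in `[a, b]) c = c * (b - a).
  rewrite Rintegral_cst//; congr (_ * _).
  have := @lebesgue_measure_itv R `[a, b]; rewrite /= lte_fin => ->.
  case: ifPn; first by rewrite -EFinD.
  by rewrite -leNgt => ba; apply/eqP; rewrite eq_sym subr_eq0 eq_le ab ba.
rewrite -intc -RintegralB//; last exact: cst.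
rewrite -intc; apply: le_trans (le_normr_Rintegral _ _) _ => //.
  exact: (integrableB _ intf (cst k)).
apply: le_Rintegral => //.
- apply: (@integrable_abse _ _ _ leb `[a, b]%classic (fun x => (f x - k)%:E)).
  exact: (integrableB _ intf (cst k)).
- exact: cst.
Qed.

End intervals.

Section goursat.
Context {R : realType}.
Notation leb := (@lebesgue_measure R).

(** Real differentiability at one point, the Jacobian being that of multiplication by [p + i q]. No
    continuity of the derivative is asked for, and [u], [v] are functions of two real variables, so
    that logarithmic polar coordinates can be inserted. *)
Definition cauchy_riemann_at (u v : R -> R -> R) (x y : R) :=
  exists p q : R, forall e : R, 0 < e -> exists2 d : R, 0 < d &
    forall h k, `|h| <= d -> `|k| <= d ->
      `|u (x + h) (y + k) - u x y - (p * h - q * k)| <= e * (`|h| + `|k|) /\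
      `|v (x + h) (y + k) - v x y - (q * h + p * k)| <= e * (`|h| + `|k|).

(** Multiplication by [i] sends the pair [u], [v] to [- v], [u]; statements about [v] thus reduce to
    statements about a first component. *)
Lemma cauchy_riemann_atN u v x y : cauchy_riemann_at u v x y ->
  cauchy_riemann_at (fun x y => - v x y) u x y.
Proof.
move=> [p [q H]]; exists (- q), p => e /H[d d0 K]; exists d => // h k hd kd.
have [A B] := K _ _ hd kd; split; last by rewrite mulNr.
rewrite -normrN; apply: le_trans B; apply: eq_ler; congr (`|_|); ring.
Qed.

Lemma cauchy_riemann_at_continuousl u v x y : cauchy_riemann_at u v x y ->
  {for x, continuous (u ^~ y)}.
Proof.
move=> [p [q H]]; apply/cvgrPdist_le => e e0.
have [d d0 K] := H _ ltr01.
have M0 : 0 < 1 + `|p| by rewrite ltr_pwDl.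
have : \forall z \near x, `|x - z| <= Num.min d (e / (1 + `|p|)).
  apply: (@cvgr_dist_le _ _ R (nbhs x) _ id x) => //.
  by rewrite lt_min d0 divr_gt0.
apply: filterS => z; rewrite le_min => /andP[zd ze].
rewrite distrC in zd; have [] := K (z - x) 0 zd; first by rewrite normr0 ltW.
rewrite addr0 normr0 addr0 mulr0 subr0 subrKC mul1r => A _.
rewrite distrC; have -> : u z y - u x y = (u z y - u x y - p * (z - x)) + p * (z - x).
  by ring.
apply: le_trans (ler_normD _ _) _; rewrite normrM.
apply: (@le_trans _ _ ((1 + `|p|) * `|z - x|)); first by rewrite mulrDl mul1r lerD2r.
by rewrite mulrC -ler_pdivlMr// distrC.
Qed.

Lemma cauchy_riemann_at_continuousl' u v x y : cauchy_riemann_at u v x y ->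
  {for x, continuous (v ^~ y)}.
Proof.
have -> : v ^~ y = (fun z => - (- v z y)) by apply/funext => z; rewrite opprK.
by move=> /cauchy_riemann_atN/cauchy_riemann_at_continuousl; apply: cvgN.
Qed.

Lemma cauchy_riemann_at_continuousr u v x y : cauchy_riemann_at u v x y ->
  {for y, continuous (u x)}.
Proof.
move=> [p [q H]].
(* Reflection in the diagonal followed by conjugation of the values preserves holomorphy. *)
apply: (@cauchy_riemann_at_continuousl (fun y x => u x y) (fun y x => - v x y)).
exists (- q), (- p) => e /H[d d0 K]; exists d => // h k hd kd.
have [A B] := K _ _ kd hd; split.
  rewrite addrC (addrC `|h|); apply: le_trans A.
  by apply: eq_ler; congr (`|_|); ring.
rewrite -normrN (addrC `|h|); apply: le_trans B; apply: eq_ler; congr (`|_|); ring.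
Qed.

(** The imaginary part of the integral of [(u + i v) dz] along the boundary of the rectangle,
    traversed counterclockwise. In logarithmic polar coordinates its vertical sides carry circular
    means of [u]. *)
Definition rect_int (u v : R -> R -> R) (a b c d : R) : R :=
  \int[leb]_(x in `[a, b]) (v x c - v x d) +
  \int[leb]_(y in `[c, d]) (u b y - u a y).

Context (u v : R -> R -> R).

Definition cauchy_riemann_on (a b c d : R) := forall x y,
  a <= x <= b -> c <= y <= d -> cauchy_riemann_at u v x y.

Lemma cauchy_riemann_on_cvl a b c d y z : cauchy_riemann_on a b c d ->
  c <= y <= d -> c <= z <= d ->
  forall x, a <= x <= b -> {for x, continuous (fun x => v x y - v x z)}.
Proof.
move=> H yc zc x xa; apply: cvgB.
  exact: cauchy_riemann_at_continuousl' (H x y xa yc).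
exact: cauchy_riemann_at_continuousl' (H x z xa zc).
Qed.

Lemma cauchy_riemann_on_cur a b c d x z : cauchy_riemann_on a b c d ->
  a <= x <= b -> a <= z <= b ->
  forall y, c <= y <= d -> {for y, continuous (fun y => u x y - u z y)}.
Proof.
move=> H xa za y yc; apply: cvgB.
  exact: cauchy_riemann_at_continuousr (H x y xa yc).
exact: cauchy_riemann_at_continuousr (H z y za yc).
Qed.

Lemma rect_int_splitl a m b c d : a <= m <= b -> c <= d ->
  cauchy_riemann_on a b c d ->
  rect_int u v a b c d = rect_int u v a m c d + rect_int u v m b c d.
Proof.
move=> /[dup] amb /andP[am mb] cd H; rewrite /rect_int (@Rintegral_itv_split _ _ a m)//.
  rewrite [RHS]addrACA; congr (_ + _); rewrite -RintegralD//.
  - by apply: eq_Rintegral => y _; ring.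
  - apply: integrable_pointwise_continuous; apply: cauchy_riemann_on_cur H _ _ => //.
    by rewrite lexx (le_trans am mb).
  - apply: integrable_pointwise_continuous; apply: cauchy_riemann_on_cur H _ _ => //.
    by rewrite lexx (le_trans am mb).
by apply: cauchy_riemann_on_cvl H _ _; rewrite ?lexx ?cd.
Qed.

Lemma rect_int_splitr a b c m d : a <= b -> c <= m <= d ->
  cauchy_riemann_on a b c d ->
  rect_int u v a b c d = rect_int u v a b c m + rect_int u v a b m d.
Proof.
move=> ab /[dup] amb /andP[am mb] H.
rewrite /rect_int (@Rintegral_itv_split _ (fun y => _) c m)//.
  rewrite [RHS]addrACA; congr (_ + _); rewrite -RintegralD//.
  - by apply: eq_Rintegral => y _; ring.
  - apply: integrable_pointwise_continuous; apply: cauchy_riemann_on_cvl H _ _ => //.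
    by rewrite lexx (le_trans am mb).
  - apply: integrable_pointwise_continuous; apply: cauchy_riemann_on_cvl H _ _ => //.
    by rewrite lexx (le_trans am mb).
by apply: cauchy_riemann_on_cur H _ _; rewrite ?lexx ?ab.
Qed.

(** The affine part of [u + i v] at the point contributes [p * (c - d) * (b - a)] and
    [p * (b - a) * (d - c)], which cancel; on each side the remainder is at most [e / 2] times the
    half-perimeter. *)
Lemma rect_int_small x0 y0 (e : R) : cauchy_riemann_at u v x0 y0 -> 0 < e ->
  exists2 r, 0 < r & forall a b c d, a <= x0 <= b -> c <= y0 <= d ->
    cauchy_riemann_on a b c d -> b - a <= r -> d - c <= r ->
    `|rect_int u v a b c d| <= e * ((b - a) + (d - c)) ^+ 2.
Proof.
move=> [p [q H]] e0; have [|r r0 K] := H (e / 2); first by rewrite divr_gt0.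
exists r => // a b c d /andP[ax xb] /andP[cy yd] CR bar dcr.
have ab := le_trans ax xb; have cd := le_trans cy yd.
set s := (b - a) + (d - c).
have near x y : a <= x <= b -> c <= y <= d ->
   `|u x y - u x0 y0 - (p * (x - x0) - q * (y - y0))| <= (e / 2) * s /\
   `|v x y - v x0 y0 - (q * (x - x0) + p * (y - y0))| <= (e / 2) * s.
  move=> /andP[ax' xb'] /andP[cy' yd'].
  have hx : `|x - x0| <= b - a by rewrite ler_norml; apply/andP; split; lra.
  have hy : `|y - y0| <= d - c by rewrite ler_norml; apply/andP; split; lra.
  have [] := K (x - x0) (y - y0) (le_trans hx bar) (le_trans hy dcr).
  rewrite !subrKC => A B.
  have S : (e / 2) * (`|x - x0| + `|y - y0|) <= (e / 2) * s.
    by rewrite ler_wpM2l ?lerD// divr_ge0// ltW.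
  by split; apply: le_trans S.
have I1 : `|\int[leb]_(x in `[a, b]) (v x c - v x d) - (p * (c - d)) * (b - a)|
   <= (e * s) * (b - a).
  apply: Rintegral_itv_near => //.
    apply: integrable_pointwise_continuous; apply: cauchy_riemann_on_cvl CR _ _ => //;
    by rewrite lexx cd.
  have cc : c <= c <= d by rewrite lexx cd.
  have dd : c <= d <= d by rewrite lexx cd.
  move=> x xab; have [_ A] := near x c xab cc; have [_ B] := near x d xab dd.
  set X := v x c - _ - _ in A; set Y := v x d - _ - _ in B.
  have -> : v x c - v x d - p * (c - d) = X - Y by rewrite /X /Y; ring.
  apply: le_trans (ler_normB _ _) _; apply: le_trans (lerD A B) _.
  by apply: eq_ler; field.
have I2 : `|\int[leb]_(y in `[c, d]) (u b y - u a y) - (p * (b - a)) * (d - c)|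
   <= (e * s) * (d - c).
  apply: Rintegral_itv_near => //.
    apply: integrable_pointwise_continuous; apply: cauchy_riemann_on_cur CR _ _ => //;
    by rewrite lexx ab.
  have aa : a <= a <= b by rewrite lexx ab.
  have bb : a <= b <= b by rewrite lexx ab.
  move=> y ycd; have [B _] := near b y bb ycd; have [A _] := near a y aa ycd.
  set X := u a y - _ - _ in A; set Y := u b y - _ - _ in B.
  have -> : u b y - u a y - p * (b - a) = Y - X by rewrite /X /Y; ring.
  apply: le_trans (ler_normB _ _) _; apply: le_trans (lerD B A) _.
  by apply: eq_ler; field.
rewrite /rect_int; set J1 := Rintegral _ _ _ in I1 *.
set J2 := Rintegral _ _ _ in I2 *.
have -> : J1 + J2 = (J1 - p * (c - d) * (b - a)) + (J2 - p * (b - a) * (d - c)).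
  by ring.
apply: le_trans (ler_normD _ _) _; apply: le_trans (lerD I1 I2) _.
by apply: eq_ler; rewrite /s; ring.
Qed.

Lemma cauchy_riemann_on_sub a b c d a' b' c' d' : cauchy_riemann_on a b c d ->
  a <= a' -> b' <= b -> c <= c' -> d' <= d -> cauchy_riemann_on a' b' c' d'.
Proof.
move=> H aa bb cc dd x y /andP[ax xb] /andP[cy yd]; apply: H.
  by rewrite (le_trans aa ax) (le_trans xb bb).
by rewrite (le_trans cc cy) (le_trans yd dd).
Qed.

Lemma rect_int_quarter (W H a c : R) : 0 <= W -> 0 <= H ->
  cauchy_riemann_on a (a + W) c (c + H) ->
  exists a' c', [/\ a <= a' <= a + W / 2, c <= c' <= c + H / 2 &
    `|rect_int u v a (a + W) c (c + H)| <=
    4 * `|rect_int u v a' (a' + W / 2) c' (c' + H / 2)| ].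
Proof.
move=> W0 H0 CR; set w := W / 2; set h := H / 2.
have w0 : 0 <= w by rewrite divr_ge0.
have h0 : 0 <= h by rewrite divr_ge0.
have EW : a + W = a + w + w by rewrite /w; field.
have EH : c + H = c + h + h by rewrite /h; field.
have -> : rect_int u v a (a + W) c (c + H) =
  (rect_int u v a (a + w) c (c + h) + rect_int u v a (a + w) (c + h) (c + h + h)) +
  (rect_int u v (a + w) (a + w + w) c (c + h) +
   rect_int u v (a + w) (a + w + w) (c + h) (c + h + h)).
  rewrite EW EH in CR *.
  rewrite (@rect_int_splitl a (a + w)); [|lra|lra|by []].
  rewrite (@rect_int_splitr a (a + w) c (c + h)); [|lra|lra|].
    rewrite (@rect_int_splitr (a + w) (a + w + w) c (c + h)); [by []|lra|lra|].
    by apply: cauchy_riemann_on_sub CR _ _ _ _; lra.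
  by apply: cauchy_riemann_on_sub CR _ _ _ _; lra.
set I1 := rect_int u v a _ c _; set I2 := rect_int u v a _ (c + h) _.
set I3 := rect_int u v (a + w) _ c _; set I4 := rect_int u v (a + w) _ (c + h) _.
have tri : `|I1 + I2 + (I3 + I4)| <= `|I1| + `|I2| + (`|I3| + `|I4|).
  by apply: le_trans (ler_normD _ _) _; rewrite lerD// ler_normD.
have [h1|h1] := leP `|I1 + I2 + (I3 + I4)| (4 * `|I1|).
  by exists a, c; split; rewrite ?lexx ?lerDl ?w0 ?h0.
have [h2|h2] := leP `|I1 + I2 + (I3 + I4)| (4 * `|I2|).
  by exists a, (c + h); split; rewrite ?lexx ?lerDl ?w0 ?h0.
have [h3|h3] := leP `|I1 + I2 + (I3 + I4)| (4 * `|I3|).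
  by exists (a + w), c; split; rewrite ?lexx ?lerDl ?w0 ?h0.
exists (a + w), (c + h); split; rewrite ?lexx ?lerDl ?w0 ?h0//.
by clear -tri h1 h2 h3; lra.
Qed.

Theorem goursat a b c d : a <= b -> c <= d -> cauchy_riemann_on a b c d ->
  rect_int u v a b c d = 0.
Proof.
move=> ab cd CR; apply/eqP/negPn/negP; rewrite -normr_gt0 => I0.
pose W k : R := (b - a) / 2 ^+ k; pose H k : R := (d - c) / 2 ^+ k.
have W0 k : 0 <= W k by rewrite divr_ge0// ?exprn_ge0// subr_ge0.
have H0 k : 0 <= H k by rewrite divr_ge0// ?exprn_ge0// subr_ge0.
have WS k : W k.+1 = W k / 2 by rewrite /W exprSr invfM mulrA.
have HS k : H k.+1 = H k / 2 by rewrite /H exprSr invfM mulrA.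
pose good k (p : R * R) := [/\ a <= p.1, p.1 + W k <= b, c <= p.2, p.2 + H k <= d &
  `|rect_int u v a b c d| <= 4 ^+ k *
     `|rect_int u v p.1 (p.1 + W k) p.2 (p.2 + H k)| ].
have step k p : good k p -> exists q, good k.+1 q /\
    (p.1 <= q.1 <= p.1 + W k.+1 /\ p.2 <= q.2 <= p.2 + H k.+1).
  move=> [ap pb cp pd Ip].
  have CRp : cauchy_riemann_on p.1 (p.1 + W k) p.2 (p.2 + H k).
    exact: cauchy_riemann_on_sub CR _ _ _ _.
  have [a' [c' [ha hc le4]]] := rect_int_quarter (W0 k) (H0 k) CRp.
  exists (a', c'); rewrite /good /= WS HS; split=> //; split; [lra|lra|lra|lra|].
  apply: le_trans Ip _; rewrite exprSr -mulrA ler_wpM2l// exprn_ge0//.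
have good0 : good 0%N (a, c).
  by rewrite /good /= /W /H expr0 !divr1 expr0 mul1r !subrKC.
(* Outside [good] the value is a mere default: every [Q k] is good. *)
pose nxt k p : R * R := if pselect (good k p) is left g then projT1 (cid (step k p g)) else p.
pose Q := fix Q k : R * R := if k is k'.+1 then nxt k' (Q k') else (a, c).
have goodQ k : good k (Q k).
  elim: k => [//|k IH] /=; rewrite /nxt; case: pselect => // g.
  by case: (cid _) => q [].
have Qstep k : (Q k).1 <= (Q k.+1).1 <= (Q k).1 + W k.+1 /\
               (Q k).2 <= (Q k.+1).2 <= (Q k).2 + H k.+1.
  rewrite /= /nxt; case: pselect => [g|]; last by case: (goodQ k).
  by case: (cid _) => q [].
pose x0 := limn (fun k => (Q k).1); pose y0 := limn (fun k => (Q k).2).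
have lim1 (f D : nat -> R) : (forall k, f k <= f k.+1 <= f k + D k.+1) ->
    (forall k, 0 <= D k) -> (forall k, D k.+1 = D k / 2) -> forall k,
    f k <= limn f <= f k + D k.
  move=> fs D0 DS k.
  have nd : nondecreasing_seq f.
    by apply/nondecreasing_seqP => j; case/andP: (fs j).
  (* As [D] halves, the step [D j.+1] equals [D j - D j.+1], and the upper bounds telescope. *)
  have up j : (k <= j)%N -> f j <= f k + D k - D j.
    elim: j => [|j IH]; first by rewrite leqn0 => /eqP ->; rewrite addrK.
    rewrite leq_eqVlt => /predU1P[->|]; first by rewrite addrK.
    rewrite ltnS => /IH; have := fs j; rewrite !DS; lra.
  have cf : cvgn f.
    apply: nondecreasing_is_cvgn => //; exists (f k + D k) => _ [j _ <-].
    have [kj|/ltnW jk] := leqP k j.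
      by have := up _ kj; have := D0 j; lra.
    by have := nd _ _ jk; have := D0 k; lra.
  apply/andP; split; first exact: nondecreasing_cvgn_le.
  apply: limr_le => //; exists k => // j /= kj.
  by have := up _ kj; have := D0 j; lra.
have x0Q := lim1 (fun k => (Q k).1) W (fun k => (Qstep k).1) W0 WS.
have y0Q := lim1 (fun k => (Q k).2) H (fun k => (Qstep k).2) H0 HS.
have CR0 : cauchy_riemann_at u v x0 y0.
  apply: CR; first by have := x0Q 0%N; rewrite /W expr0 divr1 subrKC.
  by have := y0Q 0%N; rewrite /H expr0 divr1 subrKC.
set s := (b - a) + (d - c); have s0 : 0 <= s by rewrite /s addr_ge0// subr_ge0.
set m := `|rect_int u v a b c d| in I0 *.
(* The factor [4 ^+ k] cancels against [(s / 2 ^+ k) ^+ 2], which leaves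
   [m <= m * (s ^+ 2 / (s ^+ 2 + 1) / 2)], absurd for [m > 0]; the [+ 1] covers a rectangle reduced
   to a point. *)
have e0 : 0 < m / (s ^+ 2 + 1) / 2 by rewrite !divr_gt0// ltr_wpDl// exprn_ge0.
have [r r0 small] := rect_int_small CR0 e0.
have [k kr] : exists k, s / 2 ^+ k <= r.
  exists (Num.truncn (s / r)); set k := Num.truncn _.
  have kk : s / r < k.+1%:R by rewrite truncnS_gt.
  have k2 : k.+1%:R <= 2 ^+ k :> R by rewrite -natrX ler_nat ltn_expl.
  rewrite ler_pdivrMr ?exprn_gt0// mulrC -ler_pdivrMr//.
  exact: le_trans (ltW kk) k2.
have [aQ Qb cQ Qd mQ] := goodQ k.
have Wk : (Q k).1 + W k - (Q k).1 = W k by rewrite addrC addKr.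
have Hk : (Q k).2 + H k - (Q k).2 = H k by rewrite addrC addKr.
have WH : W k + H k = s / 2 ^+ k by rewrite /W /H /s -mulrDl.
have := small _ _ _ _ (x0Q k) (y0Q k) (cauchy_riemann_on_sub CR aQ Qb cQ Qd).
rewrite Wk Hk WH => small0.
have Wr : W k <= r by apply: le_trans kr; rewrite -WH lerDl.
have Hr : H k <= r by apply: le_trans kr; rewrite -WH lerDr.
have small' := small0 Wr Hr.
 have : m <= 4 ^+ k * (m / (s ^+ 2 + 1) / 2 * (s / 2 ^+ k) ^+ 2).
  by apply: le_trans mQ _; rewrite ler_wpM2l// exprn_ge0.
have -> : 4 ^+ k * (m / (s ^+ 2 + 1) / 2 * (s / 2 ^+ k) ^+ 2) =
  m * (s ^+ 2 / (s ^+ 2 + 1) / 2).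
  have -> : (4 : R) ^+ k = (2 ^+ k) ^+ 2 by rewrite -exprM mulnC exprM; congr (_ ^+ k); ring.
  have p2 : (2 : R) ^+ k != 0 by rewrite expf_neq0.
  have ps : s ^+ 2 + 1 != 0 by rewrite gt_eqF// ltr_wpDl// exprn_ge0.
  by field; rewrite p2 ps.
rewrite -subr_ge0 -{2}(mulr1 m) -mulrBr pmulr_rge0// subr_ge0.
rewrite ler_pdivlMr// mul1r ler_pdivlMr ?ltr_wpDl ?exprn_ge0//.
by have := exprn_ge0 2 s0; lra.
Qed.

End goursat.

(** * Complex moduli, derivatives and the mean value property *)

Section complex_basics.
Context {R : realType}.
Implicit Types (z w : C R) (x y : R).

Lemma Ceq z w : ReC z = ReC w -> ImC z = ImC w -> z = w.
Proof. by case: z w => [a b] [c d]; rewrite /ReC /ImC /= => -> ->. Qed.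

Lemma ReC_mk x y : ReC (mkC x y) = x. Proof. by []. Qed.
Lemma ImC_mk x y : ImC (mkC x y) = y. Proof. by []. Qed.
Lemma mkC_ReIm z : mkC (ReC z) (ImC z) = z. Proof. by case: z. Qed.
Lemma ReC0 : ReC (0 : C R) = 0. Proof. by []. Qed.
Lemma ImC0 : ImC (0 : C R) = 0. Proof. by []. Qed.
Lemma ReC1 : ReC (1 : C R) = 1. Proof. by []. Qed.
Lemma ImC1 : ImC (1 : C R) = 0. Proof. by []. Qed.
Lemma ReCD z w : ReC (z + w) = ReC z + ReC w. Proof. by case: z w => [a b] [c d]. Qed.
Lemma ImCD z w : ImC (z + w) = ImC z + ImC w. Proof. by case: z w => [a b] [c d]. Qed.
Lemma ReCN z : ReC (- z) = - ReC z. Proof. by case: z. Qed.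
Lemma ImCN z : ImC (- z) = - ImC z. Proof. by case: z. Qed.
Lemma ReCM z w : ReC (z * w) = ReC z * ReC w - ImC z * ImC w.
Proof. by case: z w => [a b] [c d]. Qed.
Lemma ImCM z w : ImC (z * w) = ReC z * ImC w + ImC z * ReC w.
Proof. by case: z w => [a b] [c d]. Qed.
Lemma ReCJ z : ReC (z^*) = ReC z. Proof. by case: z. Qed.
Lemma ImCJ z : ImC (z^*) = - ImC z. Proof. by case: z. Qed.

Definition ReImE := (ReC_mk, ImC_mk, ReCM, ImCM, ReCD, ImCD, ReCN, ImCN, ReCJ, ImCJ,
  ReC0, ImC0, ReC1, ImC1).

(** The norm of [z] lies in [C R], which is only partially ordered; as a real number it is open to
    [lra] and to the order lemmas of [R]. *)
Definition cmod z : R := ReC `|z|.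

Lemma normCE z : `|z| = mkC (cmod z) 0.
Proof. by rewrite /cmod normc_def. Qed.
Lemma cmod_ge0 z : 0 <= cmod z.
Proof. by rewrite /cmod normc_def /= sqrtr_ge0. Qed.
Lemma cmod_sqr z : cmod z ^+ 2 = ReC z ^+ 2 + ImC z ^+ 2.
Proof. by rewrite /cmod normc_def /= sqr_sqrtr// addr_ge0// sqr_ge0. Qed.
Lemma cmod0 : cmod (0 : C R) = 0. Proof. by rewrite /cmod normr0. Qed.
Lemma cmod1 : cmod (1 : C R) = 1. Proof. by rewrite /cmod normr1. Qed.
Lemma cmodN z : cmod (- z) = cmod z. Proof. by rewrite /cmod normrN. Qed.
Lemma cmodB z w : cmod (z - w) = cmod (w - z). Proof. by rewrite /cmod distrC. Qed.
Lemma cmodM z w : cmod (z * w) = cmod z * cmod w.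
Proof. by rewrite /cmod normrM !normCE !ReImE mul0r subr0. Qed.
Lemma cmodX z n : cmod (z ^+ n) = cmod z ^+ n.
Proof. by elim: n => [|n IH]; rewrite ?expr0 ?cmod1// !exprS cmodM IH. Qed.
Lemma cmodD z w : cmod (z + w) <= cmod z + cmod w.
Proof.
have := ler_normD z w; rewrite !normCE.
by rewrite lecE /= => /andP[_].
Qed.
Lemma cmodB_le z w : cmod (z - w) <= cmod z + cmod w.
Proof. by rewrite -(cmodN w) cmodD. Qed.
Lemma cmodJ z : cmod (z^*) = cmod z.
Proof.
apply/eqP; rewrite -(@eqrXn2 _ 2) ?cmod_ge0//.
by rewrite !cmod_sqr ReCJ ImCJ sqrrN.
Qed.
Lemma cmod_eq0 z : (cmod z == 0) = (z == 0).
Proof.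
apply/eqP/eqP => [z0|->]; last exact: cmod0.
by apply/eqP; rewrite -normr_eq0 normCE z0; apply/eqP/Ceq.
Qed.
Lemma cmod_gt0 z : (0 < cmod z) = (z != 0).
Proof. by rewrite lt_def cmod_eq0 cmod_ge0 andbT. Qed.
Lemma cmodV z : cmod z^-1 = (cmod z)^-1.
Proof.
have [->|z0] := eqVneq z 0; first by rewrite invr0 cmod0 invr0.
have c0 : cmod z != 0 by rewrite cmod_eq0.
by apply: (mulfI c0); rewrite -cmodM !mulfV// cmod1.
Qed.
Lemma normr_ReC z : `|ReC z| <= cmod z.
Proof.
rewrite -(@ler_sqr _ `|ReC z|) ?nnegrE ?cmod_ge0//.
by rewrite cmod_sqr real_normK ?num_real// lerDl sqr_ge0.
Qed.
Lemma normr_ImC z : `|ImC z| <= cmod z.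
Proof.
rewrite -(@ler_sqr _ `|ImC z|) ?nnegrE ?cmod_ge0//.
by rewrite cmod_sqr real_normK ?num_real// lerDr sqr_ge0.
Qed.
Lemma ReC_le z : ReC z <= cmod z.
Proof. exact: le_trans (ler_norm _) (normr_ReC z). Qed.
Lemma cmod_le_ReIm z : cmod z <= `|ReC z| + `|ImC z|.
Proof.
rewrite -(@ler_sqr _ (cmod z)) ?nnegrE ?cmod_ge0 ?addr_ge0//.
rewrite cmod_sqr sqrrD !real_normK ?num_real//.
by rewrite -addrA lerD2l lerDr mulrn_wge0// mulr_ge0.
Qed.
Lemma cmod_mk0 x : cmod (mkC x 0) = `|x|.
Proof. by rewrite /cmod normc_def /= expr0n addr0 sqrtr_sqr. Qed.

Lemma mkC_gt0 x : (0 < mkC x 0 :> C R) = (0 < x).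
Proof. by rewrite ltcE /= eqxx. Qed.

Lemma C_gt0P (e : C R) : 0 < e -> exists2 x, 0 < x & e = mkC x 0.
Proof.
case: e => a b; rewrite ltcE /= => /andP[/eqP b0 a0].
by exists a => //; apply: Ceq.
Qed.

Lemma le_normC_mk z x : (`|z| <= mkC x 0) = (cmod z <= x).
Proof. by rewrite normCE (lecR (cmod z)). Qed.
Lemma lt_normC_mk z x : (`|z| < mkC x 0) = (cmod z < x).
Proof. by rewrite normCE (ltcR (cmod z)). Qed.

Lemma unit_discE z : unit_disc z <-> cmod z < 1.
Proof. by rewrite -lt_normC_mk. Qed.
Lemma unit_circleE z : unit_circle z <-> cmod z = 1.
Proof.
rewrite /unit_circle /= normCE; split=> [/(congr1 (@ReC R))//|->].
exact: Ceq.
Qed.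

End complex_basics.

Section complex_derivative.
Context {R : realType}.

Lemma differentiable_near (V W : normedModType (C R)) (f : V -> W) z (e : R) :
  differentiable f z -> 0 < e -> exists2 d : R, 0 < d & forall w,
    `|w| <= mkC d 0 -> `|f (z + w) - f z - 'd f z w| <= mkC e 0 * `|w|.
Proof.
move=> /diff_locally /eqaddoP H e0.
have /H : 0 < mkC e 0 :> C R by rewrite mkC_gt0.
move=> /nbhs_normP[d0 /= /C_gt0P[d d0' ->] K]; exists (d / 2); first by rewrite divr_gt0.
move=> w wd; have := K w; rewrite /= sub0r normrN => /(_ _) K'.
have {}K' : `|(f \o shift z - (cst (f z) + 'd f z)) w| <= mkC e 0 * `|w|.
  apply: K'; apply: le_lt_trans wd _; rewrite (ltcR (d / 2)); lra.
apply: le_trans K'; apply: eq_ler; congr (`|_|).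
by rewrite -[RHS]/(f (w + z) - (f z + 'd f z w)) opprD addrA (addrC w).
Qed.

Lemma differentiable_intro (V W : normedModType (C R)) (f : V -> W) z
  (L : {linear V -> W}) : continuous L ->
  (forall e : R, 0 < e -> exists2 d : R, 0 < d & forall w,
    `|w| <= mkC d 0 -> `|f (z + w) - f z - L w| <= mkC e 0 * `|w|) ->
  differentiable f z /\ 'd f z = L :> (V -> W).
Proof.
move=> cL H.
have E : f \o shift z = cst (f z) + L +o_ 0 id.
  apply/eqaddoP => e /C_gt0P[e' e0 ->]; have [d d0 K] := H _ e0.
  apply/nbhs_normP; exists (mkC d 0); first by rewrite /= mkC_gt0.
  move=> w; rewrite /= sub0r normrN => /ltW/K; apply: le_trans.
  apply: eq_ler; congr (`|_|).
  by rewrite -[LHS]/(f (w + z) - (f z + L w)) opprD addrA (addrC w).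
have D := diff_unique cL E; split => //.
by apply/diff_locallyP; rewrite D.
Qed.

Definition cderiv (F : C R -> C R) z : C R := 'd F z 1.

Lemma diff_cderiv (F : C R -> C R) z w : 'd F z w = cderiv F z * w.
Proof.
rewrite /cderiv -{1}(mulr1 w) -[w * 1]/(w *: (1 : (C R)^o)) linearZ /=.
by rewrite mulrC.
Qed.

Lemma cdifferentiable_near (F : C R -> C R) z (e : R) : differentiable F z -> 0 < e ->
  exists2 d : R, 0 < d & forall w, cmod w <= d ->
    cmod (F (z + w) - F z - cderiv F z * w) <= e * cmod w.
Proof.
move=> dF e0; have [d d0 H] := differentiable_near dF e0; exists d => // w wd.
have := H w; rewrite le_normC_mk => /(_ wd); rewrite diff_cderiv.
by rewrite -le_normC_mk => /le_trans; apply; rewrite normCE; apply: eq_ler;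
  apply: Ceq; rewrite !ReImE ?(mul0r, mulr0, subr0, addr0).
Qed.

Lemma cdifferentiable_intro (F : C R -> C R) z D :
  (forall e : R, 0 < e -> exists2 d : R, 0 < d & forall w, cmod w <= d ->
    cmod (F (z + w) - F z - D * w) <= e * cmod w) ->
  differentiable F z /\ cderiv F z = D.
Proof.
move=> H; pose L : {linear C R -> C R} := *:%R D.
have cL : continuous L by exact: scaler_continuous.
have [] := @differentiable_intro _ _ F z L cL.
  move=> e /H[d d0 K]; exists d => // w; rewrite le_normC_mk => /K.
  rewrite normCE => h; rewrite normCE lecE /= !mulr0 mul0r addr0 eqxx /=.
  by rewrite subr0.
move=> dF E; split => //.
rewrite /cderiv (congr1 (fun f : C R -> C R => f 1) E); exact: mulr1.
Qed.

(* The polar parametrisation: its derivative at [0] is computed first, other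
   points are reached by the addition formulas. *)
Definition cexp (s t : R) : C R := mkC (expR s * cos t) (expR s * sin t).

Lemma cexpD s t h k : cexp (s + h) (t + k) = cexp s t * cexp h k.
Proof.
rewrite /cexp expRD cosD sinD; apply: Ceq; rewrite !ReImE; ring.
Qed.

Lemma cmod_cexp s t : cmod (cexp s t) = expR s.
Proof.
apply/eqP; rewrite -(@eqrXn2 _ 2) ?cmod_ge0 ?expR_ge0// cmod_sqr /cexp !ReImE.
by rewrite !exprMn -mulrDr cos2Dsin2 mulr1.
Qed.

Lemma is_derive_near (f : R -> R) x (df : R) : is_derive x (1 : R) f df ->
  forall e : R, 0 < e -> exists2 d : R, 0 < d & forall h, `|h| <= d ->
    `|f (x + h) - f x - df * h| <= e * `|h|.
Proof.
move=> [dfx vf] e e0; have := derivable_nbhs dfx => /eqaddoP/(_ _ e0).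
move=> /nbhs_normP[d0 /= d0' K]; exists (d0 / 2); first by rewrite divr_gt0.
move=> h hd; have := K h; rewrite /= sub0r normrN => /(_ _) K'.
have {}K' : `|((fun h => (f \o shift x) (h *: 1)) - (cst (f x) + (fun h => h *: 'D_1 f x))) h|
   <= e * `|h|.
  by apply: K'; apply: le_lt_trans hd _; lra.
apply: le_trans K'; apply: eq_ler; congr (`|_|).
rewrite -[RHS]/(f (h *: 1 + x) - (f x + h *: 'D_1 f x)) opprD addrA vf.
by rewrite -[h *: (1 : R)]/(h * 1) mulr1 (addrC h) -[h *: (df : R)]/(h * df) (mulrC h).
Qed.

Lemma cexp_near (e : R) : 0 < e -> exists2 d : R, 0 < d & forall h k : R,
  `|h| <= d -> `|k| <= d ->
  cmod (cexp h k - 1 - mkC h k) <= e * (`|h| + `|k|).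
Proof.
move=> e0; have e1 : 0 < Num.min 1 e / 8 by rewrite divr_gt0// lt_min ltr01 e0.
have [d1 d10 H1] := is_derive_near (is_derive_expR 0) e1.
have [d2 d20 H2] := is_derive_near (is_derive_cos 0) e1.
have [d3 d30 H3] := is_derive_near (is_derive_sin 0) e1.
exists (Num.min (Num.min d1 d2) (Num.min d3 (Num.min 1 e / 8))).
  by rewrite !lt_min d10 d20 d30 e1.
move=> h k; rewrite !le_min => /andP[/andP[h1 _] /andP[_ he]].
move=> /andP[/andP[_ k2] /andP[k3 ke]].
have {H1 h1} := H1 _ h1; have {H2 k2} := H2 _ k2; have {H3 k3} := H3 _ k3.
rewrite !add0r expR0 cos0 sin0 !subr0 !mul1r oppr0 mul0r subr0 => Hs Hc He.
set m := Num.min 1 e / 8 in e1 he ke Hs Hc He.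
have m1 : m <= 1 / 8 by rewrite ler_pdivrMr// mulfVK// ge_min lexx.
have m2 : m <= e / 8 by rewrite ler_pM2r// ge_min lexx orbT.
have E2 : `|expR h - 1| <= 2 * `|h|.
  have -> : expR h - 1 = (expR h - 1 - h) + h by ring.
  apply: le_trans (ler_normD _ _) _; apply: le_trans (lerD He (lexx _)) _.
  by rewrite -{2}(mul1r `|h|) -mulrDl ler_wpM2r//; lra.
have E3 : `|expR h| <= 2.
  have -> : expR h = (expR h - 1) + 1 by ring.
  by apply: le_trans (ler_normD _ _) _; rewrite normr1; lra.
apply: le_trans (cmod_le_ReIm _) _; rewrite /cexp !ReImE.
have -> : expR h * cos k - 1 - h = (expR h - 1 - h) + expR h * (cos k - 1) by ring.
have -> : expR h * sin k - 0 - k = expR h * (sin k - k) + (expR h - 1) * k by ring.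
have A1 : `|expR h * (cos k - 1)| <= 2 * (m * `|k|) by rewrite normrM ler_pM.
have A2 : `|expR h * (sin k - k)| <= 2 * (m * `|k|) by rewrite normrM ler_pM.
have A3 : `|(expR h - 1) * k| <= 2 * m * `|k|.
  by rewrite normrM ler_pM// (le_trans E2)// ler_wpM2l.
have A4 := ler_normD (expR h - 1 - h) (expR h * (cos k - 1)).
have A5 := ler_normD (expR h * (sin k - k)) ((expR h - 1) * k).
have A6 : m * `|h| <= e / 8 * `|h| by rewrite ler_wpM2r.
have A7 : m * `|k| <= e / 8 * `|k| by rewrite ler_wpM2r.
have := normr_ge0 h; have := normr_ge0 k; move: A1 A2 A3 A4 A5 A6 A7 He.
have e8 : 0 <= e by apply: ltW.
move=> A1 A2 A3 A4 A5 A6 A7 He k0 h0.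
have := mulr_ge0 e8 h0; have := mulr_ge0 e8 k0; lra.
Qed.

Lemma cauchy_riemann_cexp (F : C R -> C R) s t : differentiable F (cexp s t) ->
  cauchy_riemann_at (fun s t => ReC (F (cexp s t))) (fun s t => ImC (F (cexp s t))) s t.
Proof.
set z := cexp s t => dF.
(* The derivative of [F] composed with the exponential. *)
set D := cderiv F z * z; exists (ReC D), (ImC D) => e e0.
set M := cmod z * 3 + cmod D + 1.
have M0 : 0 < M by rewrite /M; have := cmod_ge0 z; have := cmod_ge0 D; lra.
have eM : 0 < e / (2 * M) by rewrite divr_gt0// mulr_gt0.
have e2 : 0 < Num.min 1 (e / (2 * M)) by rewrite lt_min ltr01 eM.
have [d1 d10 H1] := cdifferentiable_near dF eM.
have [d2 d20 H2] := cexp_near e2.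
exists (Num.min (d1 / (2 * M)) d2).
  by rewrite lt_min d20 divr_gt0// mulr_gt0.
move=> h k; rewrite !le_min => /andP[h1 h2] /andP[k1 k2].
set rho := cexp h k - 1 - mkC h k.
have Hrho : cmod rho <= Num.min 1 (e / (2 * M)) * (`|h| + `|k|) by exact: H2.
have hk0 : 0 <= `|h| + `|k| by rewrite addr_ge0.
have rho1 : cmod rho <= `|h| + `|k|.
  by apply: le_trans Hrho _; rewrite -{2}(mul1r (_ + _)) ler_wpM2r// ge_min lexx.
have rho2 : cmod rho <= e / (2 * M) * (`|h| + `|k|).
  by apply: le_trans Hrho _; rewrite ler_wpM2r// ge_min lexx orbT.
set w := z * (mkC h k + rho).
have Ez : cexp (s + h) (t + k) = z + w.
  by rewrite cexpD -/z /w /rho; ring.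
have wle : cmod w <= M * (`|h| + `|k|).
  rewrite /w cmodM; apply: (@le_trans _ _ (cmod z * 3 * (`|h| + `|k|))).
    rewrite -mulrA ler_wpM2l ?cmod_ge0//.
    have := cmodD (mkC h k) rho; have := cmod_le_ReIm (mkC h k); rewrite !ReImE; lra.
  by rewrite ler_wpM2r// /M; have := cmod_ge0 D; lra.
have wd : cmod w <= d1.
  apply: le_trans wle _; rewrite mulrC -ler_pdivlMr//.
  have -> : d1 / M = d1 / (2 * M) + d1 / (2 * M) by field; rewrite gt_eqF.
  exact: lerD.
have key : cmod (F (cexp (s + h) (t + k)) - F z - D * mkC h k) <= e * (`|h| + `|k|).
  rewrite Ez; have -> : F (z + w) - F z - D * mkC h k =
      (F (z + w) - F z - cderiv F z * w) + D * rho by rewrite /w /D; ring.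
  apply: le_trans (cmodD _ _) _.
  apply: (@le_trans _ _ (e / (2 * M) * (M * (`|h| + `|k|)) + M * (e / (2 * M) * (`|h| + `|k|)))).
    apply: lerD.
      by apply: le_trans (H1 _ wd) _; rewrite ler_wpM2l// ltW.
    rewrite cmodM ler_pM ?cmod_ge0// /M; have := cmod_ge0 z; lra.
  by apply: eq_ler; field; rewrite gt_eqF.
split.
- apply: le_trans (le_trans (normr_ReC _) key); rewrite !ReImE.
  by apply: eq_ler; congr (`|_|); ring.
- apply: le_trans (le_trans (normr_ImC _) key); rewrite !ReImE.
  by apply: eq_ler; congr (`|_|); ring.
Qed.

Lemma differentiable_cts (F : C R -> C R) z (e : R) : differentiable F z -> 0 < e ->
  exists2 d : R, 0 < d & forall w, cmod (w - z) <= d -> cmod (F w - F z) <= e.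
Proof.
move=> dF e0; have [d d0 H] := cdifferentiable_near dF ltr01.
have M0 : 0 < 1 + cmod (cderiv F z) by rewrite ltr_pwDl// cmod_ge0.
exists (Num.min d (e / (1 + cmod (cderiv F z)))).
  by rewrite lt_min d0 divr_gt0.
move=> w; rewrite le_min => /andP[/H + we]; rewrite subrKC => K.
have -> : F w - F z = (F w - F z - cderiv F z * (w - z)) + cderiv F z * (w - z) by ring.
apply: le_trans (cmodD _ _) _; rewrite cmodM.
apply: le_trans (lerD K (lexx _)) _; rewrite -mulrDl.
by rewrite mulrC -ler_pdivlMr.
Qed.

(** In the coordinates of [cexp] the circle of radius [r] and a small circle are the vertical sides
    of a rectangle, whose horizontal sides [t = 0] and [t = 2 * pi] cancel by periodicity. So the
    mean equals that over a small circle, which is close to [F 0] by continuity. *)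
Lemma mean_value_itv (F : C R -> C R) (r : R) : 0 < r ->
  (forall z, cmod z <= r -> differentiable F z) ->
  \int[@lebesgue_measure R]_(t in `[0, 2 * pi]) ReC (F (mkC (r * cos t) (r * sin t))) =
  2 * pi * ReC (F 0).
Proof.
move=> r0 dF.
have pi0 : 0 <= 2 * pi :> R by rewrite mulr_ge0// pi_ge0.
pose u s t : R := ReC (F (cexp s t)); pose v s t : R := ImC (F (cexp s t)).
have CR s : s <= ln r -> forall t, cauchy_riemann_at u v s t.
  move=> sr t; apply: cauchy_riemann_cexp; apply: dF.
  by rewrite cmod_cexp -[leRHS]lnK ?posrE// ler_expR.
have cu s : s <= ln r -> forall t, 0 <= t <= 2 * pi -> {for t, continuous (u s)}.
  by move=> sr t _; apply: cauchy_riemann_at_continuousr (CR s sr t).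
have iu s : s <= ln r -> (@lebesgue_measure R).-integrable `[0, 2 * pi] (EFin \o u s).
  by move=> sr; apply: integrable_pointwise_continuous; apply: cu.
have E0 : (fun t => ReC (F (mkC (r * cos t) (r * sin t)))) = u (ln r).
  by apply/funext => t; rewrite /u /cexp lnK.
rewrite E0; apply/eqP; rewrite -subr_eq0 -normr_le0; apply/ler_addgt0Pl => e e0.
rewrite addr0.
have e1 : 0 < e / (2 * pi) by rewrite divr_gt0// mulr_gt0// pi_gt0.
have dF0 : differentiable F 0 by apply: dF; rewrite cmod0 ltW.
have [d d0 H] := differentiable_cts dF0 e1.
set s := Num.min (ln r) (ln d).
have sr : s <= ln r by rewrite ge_min lexx.
have G : rect_int u v s (ln r) 0 (2 * pi) = 0.
  by apply: goursat => // x y /andP[_ xr] _; apply: CR.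
have {}G : \int[@lebesgue_measure R]_(t in `[0, 2 * pi]) u (ln r) t =
  \int[@lebesgue_measure R]_(t in `[0, 2 * pi]) u s t.
  apply/eqP; rewrite -subr_eq0 -RintegralB//; [|exact: iu|exact: iu].
  have Z : \int[@lebesgue_measure R]_(x in `[s, ln r]) (v x 0 - v x (2 * pi)) = 0.
    under eq_Rintegral.
      move=> x _; rewrite /v /cexp cos0 sin0 mulr_natl cos2pi sin2pi subrr; over.
    by rewrite Rintegral_cst// mul0r.
  by move: G; rewrite /rect_int Z add0r => ->.
have near0 : `|\int[@lebesgue_measure R]_(t in `[0, 2 * pi]) u s t -
    ReC (F 0) * (2 * pi - 0)| <= e / (2 * pi) * (2 * pi - 0).
  apply: Rintegral_itv_near; [by rewrite mulr_ge0// pi_ge0|exact: iu|].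
  move=> t _; rewrite /u -ReCN -ReCD; apply: le_trans (normr_ReC _) _.
  apply: H; rewrite subr0 cmod_cexp -[leRHS]lnK ?posrE// ler_expR.
  by rewrite ge_min lexx orbT.
have pi2 : 2 * pi != 0 :> R := lt0r_neq0 (mulr_gt0 (ltr0Sn R 1) (pi_gt0 R)).
have E1 : e / (2 * pi) * (2 * pi) = e := mulfVK pi2 e.
by rewrite G (mulrC (2 * pi)); move: near0; rewrite !subr0 E1.
Qed.

End complex_derivative.

(** * Integration over the circle *)

Section finite_measures.
Context d (T : measurableType d) (R : realType).
Implicit Types (mu : {measure set T -> \bar R}) (f K : T -> R).

Lemma bounded_integrable mu f (M : R) : (mu setT < +oo)%E ->
  measurable_fun setT f -> (forall x, `|f x| <= M) ->
  mu.-integrable setT (EFin \o f).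
Proof.
move=> muT mf fM; apply: measurable_bounded_integrable => //.
by exists M; split; [exact: num_real|move=> y My x _; exact: le_trans (fM x) (ltW My)].
Qed.

Lemma integrable_bounded_mul mu f K (M : R) :
  mu.-integrable setT (EFin \o f) -> measurable_fun setT K ->
  (forall x, `|K x| <= M) -> mu.-integrable setT (EFin \o (fun x => K x * f x)).
Proof.
move=> intf mK KM.
apply: (@le_integrable _ _ _ mu setT measurableT _ (EFin \o (fun x => M * `|f x|))).
- apply/measurable_EFinP; apply: measurable_funM => //.
  by case/integrableP: intf => /measurable_EFinP.
- move=> x _ /=; rewrite lee_fin normrM (@ger0_norm _ (M * _)).
    by rewrite ler_wpM2r.
  by rewrite mulr_ge0// (le_trans _ (KM x)).
- rewrite (_ : (EFin \o _) = fun x => (M%:E * (EFin \o (Num.norm \o f)) x)%E).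
    by apply: integrableZl => //; exact: integrable_norm.
  by apply/funext => x /=; rewrite EFinM.
Qed.

End finite_measures.

Section arclength.
Context {R : realType}.
Notation leb := (@lebesgue_measure R).

Lemma continuous_cval : continuous (fun l : set_type (@unit_circle R) => set_val l : C R).
Proof. exact: initial_continuous. Qed.

Lemma circle_open_measurable (A : set (circle R)) :
  open (A : set (set_type (@unit_circle R))) -> measurable A.
Proof. by move=> oA; apply: sub_sigma_algebra. Qed.

Lemma circle_measurable (f : circle R -> R) :
  continuous (f : set_type (@unit_circle R) -> R) -> measurable_fun setT f.
Proof.
move=> cf; apply: (measurability _ (RGenOInfty.measurableE R)).
move=> _ [_ [x ->] <-]; rewrite setTI; apply: circle_open_measurable.
by move/continuousP: cf; apply; exact: interval_open.
Qed.

Lemma continuous_ReC : continuous (@ReC R).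
Proof.
move=> z; apply/(@cvgrPdist_lt R R _ (nbhs z) (nbhs_filter z)) => e e0.
apply/nbhs_normP; exists (mkC e 0); first by rewrite /= mkC_gt0.
move=> w; rewrite /= lt_normC_mk; apply: le_lt_trans.
by rewrite -ReCN -ReCD normr_ReC.
Qed.

Lemma continuous_ImC : continuous (@ImC R).
Proof.
move=> z; apply/(@cvgrPdist_lt R R _ (nbhs z) (nbhs_filter z)) => e e0.
apply/nbhs_normP; exists (mkC e 0); first by rewrite /= mkC_gt0.
move=> w; rewrite /= lt_normC_mk; apply: le_lt_trans.
by rewrite -ImCN -ImCD normr_ImC.
Qed.

Lemma measurable_ReC_cval : measurable_fun setT (fun l : circle R => ReC (cval l)).
Proof.
apply: circle_measurable => l.
apply: (@continuous_comp (set_type (@unit_circle R)) (C R) R _ (@ReC R)).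
  exact: continuous_cval.
exact: continuous_ReC.
Qed.

Lemma measurable_ImC_cval : measurable_fun setT (fun l : circle R => ImC (cval l)).
Proof.
apply: circle_measurable => l.
apply: (@continuous_comp (set_type (@unit_circle R)) (C R) R _ (@ImC R)).
  exact: continuous_cval.
exact: continuous_ImC.
Qed.

Lemma cmod_cval (l : circle R) : cmod (cval l) = 1.
Proof. by apply/unit_circleE; exact: set_valP. Qed.

Lemma arclengthE A : @arclength R A = leb (@cis R @^-1` A `&` @angles R).
Proof. by []. Qed.

Lemma arclength_setT : @arclength R setT = (2 * pi)%:E.
Proof.
rewrite arclengthE preimage_setT setTI /angles.
rewrite lebesgue_measure_itv /= lte_fin mulr_gt0// ?pi_gt0//.
by rewrite -EFinD subr0.
Qed.

Lemma arclength_lty : (@arclength R setT < +oo)%E.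
Proof. by rewrite arclength_setT ltry. Qed.

Lemma arclength_Rintegral (f : circle R -> R) (M : R) : measurable_fun setT f ->
  (forall l, `|f l| <= M) ->
  \int[@arclength R]_l f l = \int[leb]_(t in `[0, 2 * pi]) f (cis t).
Proof.
move=> mf fM; pose m := mrestr (@lebesgue_measure R) (@measurable_angles R).
have mfc : measurable_fun setT (f \o @cis R).
  by apply: measurableT_comp => //; exact: measurable_cis.
have mT : (m setT < +oo)%E.
  by have := arclength_lty; rewrite arclengthE preimage_setT.
have intm : m.-integrable setT (EFin \o (f \o @cis R)).
  by apply: (@bounded_integrable _ _ _ m _ M) => // x; exact: fM.
rewrite -Rintegral_itv_bndo_bndc; last first.
  apply: measurable_bounded_integrable => //.
  - rewrite [ltLHS]lebesgue_measure_itv /= lte_fin mulr_gt0// ?pi_gt0//.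
    by rewrite -EFinD ltry.
  - exact: measurable_funTS.
  - exists M; split; [exact: num_real|move=> y My x _].
    exact: le_trans (fM _) (ltW My).
congr fine; rewrite integral_pushforward//; last 2 first.
- exact: measurable_cis.
- exact/measurable_EFinP.
have Z : (\int[m]_(x in ~` @angles R) (EFin \o (f \o @cis R)) x = 0)%E.
  apply: null_set_integral.
  - by apply: measurableC; exact: measurable_angles.
  - by apply/measurable_EFinP; exact: measurable_funTS.
  - by rewrite -[LHS]/(leb (~` @angles R `&` @angles R)) setICl measure0.
rewrite preimage_setT -(setUv (@angles R)) integral_setU; last 4 first.
- exact: measurable_angles.
- by apply: measurableC; exact: measurable_angles.
- by apply/measurable_EFinP; rewrite setUv.
- by rewrite disj_set2E setICr.
rewrite [X in (_ + X)%E]Z adde0; apply: eq_measure_integral => A mA AD.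
by rewrite -[LHS]/(leb (A `&` @angles R)); congr (leb _); exact/setIidl.
Qed.

Lemma cis_surj (l : circle R) : exists2 t : R, 0 <= t < 2 * pi & cis t = l.
Proof.
have inj (l1 l2 : circle R) : cval l1 = cval l2 -> l1 = l2 by move=> /val_inj.
set x := ReC (cval l); set y := ImC (cval l).
have xy : x ^+ 2 + y ^+ 2 = 1 by rewrite -cmod_sqr cmod_cval expr1n.
have x1 : -1 <= x <= 1.
  by rewrite -ler_norml -(cmod_cval l) normr_ReC.
have sx : Num.sqrt (1 - x ^+ 2) = `|y| by rewrite -xy addrC addKr sqrtr_sqr.
have pi0 := pi_gt0 R; have a0 := acos_ge0 x1; have api := acos_lepi x1.
have [y0|y0] := leP 0 y.
  exists (acos x); first by apply/andP; split => //; lra.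
  apply: inj; apply: Ceq; first by rewrite [LHS]/= acosK.
  by rewrite [LHS]/= sin_acos// sx ger0_norm.
have an0 : acos x != 0.
  apply/eqP => ax; have := sin_acos x1; rewrite ax sin0 sx => /eqP.
  by rewrite eq_sym normr_eq0 lt_eqF.
have {a0} a0 : 0 < acos x by rewrite lt_def an0.
exists (- acos x + 2 * pi); first by apply/andP; split => //; lra.
apply: inj; apply: Ceq; rewrite [LHS]/= mulr_natl.
  by rewrite cosD2pi cosN acosK.
by rewrite sinD2pi sinN sin_acos// sx ltr0_norm// opprK.
Qed.

Lemma cis_continuous : continuous (@cis R : R -> set_type (@unit_circle R)).
Proof.
apply/continuousP => _ [W oW <-].
by have /continuousP/(_ _ oW) := @continuous_cis R.
Qed.

Lemma circle_bounded (f : circle R -> R) :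
  continuous (f : set_type (@unit_circle R) -> R) -> exists M, forall l, `|f l| <= M.
Proof.
move=> cf.
have cg : {within `[0, 2 * pi], continuous (fun t => `|f (cis t)|)}.
  apply: continuous_subspaceT => t; apply: cvg_norm.
  apply: (@continuous_comp R (set_type (@unit_circle R)) R (@cis R) f).
    exact: cis_continuous.
  exact: cf.
have pi0 := pi_gt0 R.
have [|c _ Hc] := EVT_max _ cg; first by lra.
exists `|f (cis c)| => l; have [t /andP[t0 t1] <-] := cis_surj l.
by apply: Hc; rewrite in_itv /= t0 ltW.
Qed.

Lemma mean_value (F : C R -> C R) :
  (forall z, cmod z <= 1 -> differentiable F z) ->
  \int[@arclength R]_l ReC (F (cval l)) = 2 * pi * ReC (F 0).
Proof.
move=> dF.
have cF : continuous ((fun l => ReC (F (cval l))) : set_type (@unit_circle R) -> R).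
  move=> l; apply: (@continuous_comp (set_type (@unit_circle R)) (C R) R _ (@ReC R)).
    apply: (@continuous_comp (set_type (@unit_circle R)) (C R) (C R) _ F).
      exact: continuous_cval.
    by apply: differentiable_continuous; apply: dF; rewrite cmod_cval.
  exact: continuous_ReC.
have [M FM] := circle_bounded cF.
rewrite (arclength_Rintegral (circle_measurable cF) FM).
rewrite -(mean_value_itv ltr01 dF); apply: eq_Rintegral => t _.
by rewrite !mul1r.
Qed.

End arclength.

(** * The Schwarz-Pick inequality *)

Section schwarz_pick.
Context {R : realType}.
Implicit Types (a z w : C R).

(** The factor [(F 0)^*] makes the value at the centre real and nonnegative, so that the mean value
    property, known for real parts, bounds the modulus. *)
Lemma mean_value_le (F : C R -> C R) (r M : R) : 0 < r ->
  (forall z, cmod z <= r -> differentiable F z) ->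
  (forall z, cmod z = r -> cmod (F z) <= M) -> cmod (F 0) <= M.
Proof.
move=> r0 dF FM; have [F0|F0] := eqVneq (F 0) 0.
  rewrite F0 cmod0; have := FM (mkC r 0); rewrite cmod_mk0 gtr0_norm// => /(_ erefl).
  exact: le_trans (cmod_ge0 _).
pose G z := (F 0)^* * F z.
have dG z : cmod z <= r -> differentiable G z.
  by move=> zr; apply: differentiableM => //; exact: dF.
have G0 : ReC (G 0) = cmod (F 0) ^+ 2 by rewrite /G cmod_sqr !ReImE; ring.
have pi0 := pi_gt0 R.
have cc t : cmod (mkC (r * cos t) (r * sin t)) = r.
  have -> : mkC (r * cos t) (r * sin t) = cexp (ln r) t by rewrite /cexp lnK.
  by rewrite cmod_cexp lnK.
have : 2 * pi * ReC (G 0) <= 2 * pi * (cmod (F 0) * M).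
  rewrite -(mean_value_itv r0 dG).
  have -> : 2 * pi * (cmod (F 0) * M) =
     \int[@lebesgue_measure R]_(t in `[0, 2 * pi]) (cmod (F 0) * M).
    rewrite Rintegral_cst// mulrC; congr (_ * _).
    rewrite [X in fine X]lebesgue_measure_itv /= lte_fin mulr_gt0//.
    by rewrite -EFinD subr0.
  apply: le_Rintegral => //.
  - have cu t : {for t, continuous (fun t => ReC (G (mkC (r * cos t) (r * sin t))))}.
      have -> : (fun t => ReC (G (mkC (r * cos t) (r * sin t)))) =
         (fun t => ReC (G (cexp (ln r) t))) by apply/funext => s; rewrite /cexp lnK.
      apply: (@cauchy_riemann_at_continuousr _ (fun s t => ReC (G (cexp s t)))).
      by apply: cauchy_riemann_cexp; apply: dG; rewrite cmod_cexp lnK.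
    by apply: integrable_pointwise_continuous.
  - by apply: integrable_pointwise_continuous => t _; exact: cst_continuous.
  - move=> t _; apply: le_trans (ReC_le _) _; rewrite cmodM cmodJ.
    by rewrite ler_wpM2l ?cmod_ge0// FM.
rewrite ler_pM2l ?mulr_gt0// G0 expr2 ler_pM2l// cmod_gt0//.
Qed.

(** With [a - z] in the numerator, and not [z - a], the automorphism is its own inverse and
    exchanges [0] and [a]. *)
Definition blaschke a z := (a - z) / (1 - a^* * z).

Lemma blaschke_identity a z :
  cmod (1 - a^* * z) ^+ 2 = cmod (a - z) ^+ 2 + (1 - cmod a ^+ 2) * (1 - cmod z ^+ 2).
Proof. rewrite !cmod_sqr !ReImE; ring. Qed.

Lemma blaschke_den_ge a z : 1 - cmod a * cmod z <= cmod (1 - a^* * z).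
Proof.
have := cmodD (1 - a^* * z) (a^* * z); rewrite subrK cmod1 cmodM cmodJ; lra.
Qed.

Lemma blaschke_den_neq0 a z : cmod a < 1 -> cmod z <= 1 -> 1 - a^* * z != 0.
Proof.
move=> a1 z1; rewrite -cmod_gt0; apply: lt_le_trans (blaschke_den_ge a z).
rewrite subr_gt0; apply: le_lt_trans a1.
by rewrite ler_piMr ?cmod_ge0.
Qed.

Lemma cmod_blaschke a z : cmod a < 1 -> cmod z <= 1 ->
  cmod (blaschke a z) ^+ 2 =
  1 - (1 - cmod a ^+ 2) * (1 - cmod z ^+ 2) / cmod (1 - a^* * z) ^+ 2.
Proof.
move=> a1 z1; have d0 := blaschke_den_neq0 a1 z1.
rewrite /blaschke cmodM cmodV exprMn exprVn.
have -> : cmod (a - z) ^+ 2 = cmod (1 - a^* * z) ^+ 2 - (1 - cmod a ^+ 2) * (1 - cmod z ^+ 2).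
  by rewrite blaschke_identity addrK.
by rewrite mulrBl mulfV// expf_neq0// cmod_eq0.
Qed.

Lemma blaschke_lt1 a z : cmod a < 1 -> cmod z < 1 -> cmod (blaschke a z) < 1.
Proof.
move=> a1 z1; rewrite -(@ltr_pXn2r _ 2) ?nnegrE ?cmod_ge0// expr1n.
rewrite cmod_blaschke ?(ltW z1)// ltrBlDr ltrDl divr_gt0//.
  by rewrite mulr_gt0// subr_gt0 expr_lt1// cmod_ge0.
by rewrite exprn_gt0// cmod_gt0 blaschke_den_neq0// ltW.
Qed.

Lemma blaschkeK a z : cmod a < 1 -> cmod z < 1 -> blaschke a (blaschke a z) = z.
Proof.
move=> a1 z1; have d0 := blaschke_den_neq0 a1 (ltW z1).
have d1 : 1 - a^* * a != 0 by rewrite blaschke_den_neq0// ltW.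
have d2 := blaschke_den_neq0 a1 (ltW (blaschke_lt1 a1 z1)).
rewrite {1}/blaschke; apply: (mulIf d2); rewrite mulfVK//.
rewrite /blaschke; field; exact: d0.
Qed.

Lemma blaschke0 a : blaschke a 0 = a.
Proof. by rewrite /blaschke mulr0 !subr0 divr1. Qed.

Lemma differentiable_blaschke a z : cmod a < 1 -> cmod z < 1 ->
  differentiable (blaschke a) z.
Proof.
move=> a1 z1; apply: differentiableM.
  by apply: differentiableB.
apply: differentiableV; last by rewrite blaschke_den_neq0// ltW.
by apply: differentiableB => //; apply: differentiableM.
Qed.

Lemma differentiable_pow (G : C R -> C R) n z : differentiable G z ->
  differentiable (fun w => G w ^+ n) z.
Proof.
move=> dG; elim: n => [|n IH]; first exact: differentiable_cst.
have -> : (fun w => G w ^+ n.+1) = (fun w => G w * G w ^+ n).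
  by apply/funext => w; rewrite exprS.
exact: differentiableM.
Qed.

(** A constant factor disappears in the limit of [k]-th roots. *)
Lemma expr_le_imp (a b c : R) : 0 <= a -> 0 <= b -> 0 < c ->
  (forall k, c * a ^+ k <= b ^+ k) -> a <= b.
Proof.
move=> a0 b0 c0 H; rewrite leNgt; apply/negP => ba.
have a1 : 0 < a by apply: le_lt_trans ba.
have ba1 : `|b / a| < 1 by rewrite ger0_norm ?divr_ge0// ltr_pdivrMr// mul1r.
have /cvgrPdist_lt/(_ _ c0)[k _ /(_ k (leqnn k))] := cvg_expr ba1.
rewrite sub0r normrN ger0_norm ?exprn_ge0 ?divr_ge0// exprMn exprVn.
rewrite ltr_pdivrMr ?exprn_gt0// => h.
by have := H k; rewrite leNgt h.
Qed.

Lemma schwarz (G : C R -> C R) : (forall z, cmod z < 1 -> differentiable G z) ->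
  (forall z, cmod z < 1 -> cmod (G z) <= 1) -> G 0 = 0 ->
  forall z, cmod z < 1 -> cmod (G z) <= cmod z.
Proof.
move=> dG G1 G0 z z1.
(* [G ^ (k + 3) / w ^ (k + 1)] is differentiable at [0] for a trivial reason, so
   that the removable singularity theorem is not needed. *)
pose K0 k w := G w ^+ k.+3 / w ^+ k.+1.
have dK0 k w : cmod w < 1 -> differentiable (K0 k) w.
  move=> w1; have [->|w0] := eqVneq w 0; last first.
    apply: differentiableM; first by apply: differentiable_pow; exact: dG.
    by apply: differentiableV; rewrite ?expf_neq0//; exact: differentiable_pow.
  apply: (proj1 (@cdifferentiable_intro _ (K0 k) 0 0 _)) => e e0.
  have dG0 : differentiable G 0 by apply: dG; rewrite cmod0.
  have [d d0 Hd] := cdifferentiable_near dG0 ltr01.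
  set A := 1 + cmod (cderiv G 0).
  have A0 : 0 < A by rewrite ltr_pwDl// cmod_ge0.
  exists (Num.min d (e / A ^+ k.+3)); first by rewrite lt_min d0 divr_gt0// exprn_gt0.
  move=> h; rewrite le_min => /andP[/Hd]; rewrite add0r G0 subr0 mul1r => hd he.
  rewrite mul0r subr0 /K0 G0 expr0n mul0r subr0.
  have [->|h0] := eqVneq h 0; first by rewrite G0 expr0n mul0r cmod0 mulr0.
  have Gh : cmod (G h) <= A * cmod h.
    have := cmodD (G h - cderiv G 0 * h) (cderiv G 0 * h).
    by rewrite subrK cmodM /A; lra.
  rewrite cmodM cmodV !cmodX ler_pdivrMr ?exprn_gt0 ?cmod_gt0//.
  apply: (@le_trans _ _ ((A * cmod h) ^+ k.+3)).
    by rewrite lerXn2r// nnegrE ?cmod_ge0// mulr_ge0 ?cmod_ge0 ?ltW.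
  have -> : (A * cmod h) ^+ k.+3 = (A ^+ k.+3 * cmod h) * cmod h ^+ k.+2.
    by rewrite exprMn (exprS (cmod h) k.+2) mulrA.
  have -> : e * cmod h * cmod h ^+ k.+1 = e * cmod h ^+ k.+2 by rewrite -mulrA -exprS.
  by rewrite ler_wpM2r ?exprn_ge0 ?cmod_ge0// mulrC -ler_pdivlMr ?exprn_gt0.
have [->|z0] := eqVneq z 0; first by rewrite G0 cmod0.
have [Gz0|Gz0] := eqVneq (G z) 0; first by rewrite Gz0 cmod0 cmod_ge0.
(* A factor [b < 1] leaves room for a circle that stays inside the disc; it is removed by letting
   [b] tend to [1]. *)
suff H b : 0 < b < 1 -> b * cmod (G z) <= cmod z.
  apply/ler_addgt0Pl => e e0; have [b1 b2] : exists2 b, 0 < b < 1 & cmod (G z) <= e + b * cmod (G z).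
    exists (Num.max (1 / 2) (1 - e)); last first.
      have : 1 - e <= Num.max (1 / 2) (1 - e) by rewrite le_max lexx orbT.
      have := cmod_ge0 (G z); have := G1 _ z1; set m := Num.max _ _; nra.
    by rewrite lt_max gt_max; apply/andP; split; [apply/orP; left; lra|apply/andP; split; lra].
  by move=> /le_trans; apply; rewrite lerD2l H.
move=> /andP[b0 b1].
(* With this constant the claim for [k] is [cmod (G z) ^+ k.+3 * b ^+ k.+1 <= cmod z ^+ k], which
   follows from a bound for [K0 k z]. The maximum principle, available at the centre of a disc only,
   gives that bound once a Blaschke map has moved [z] there. *)
apply: (@expr_le_imp _ _ (cmod (G z) ^+ 2 * (b * cmod (G z)))).
- by rewrite mulr_ge0 ?cmod_ge0 ?ltW.
- exact: cmod_ge0.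
- by rewrite !mulr_gt0 ?exprn_gt0 ?cmod_gt0.
move=> k; set Z := cmod (G z).
have Z0 : 0 < Z by rewrite cmod_gt0.
have zp : 0 < cmod z by rewrite cmod_gt0.
have b2 : 0 < 1 - b ^+ 2 by rewrite subr_gt0 expr_lt1// ltW.
(* Chosen so that [blaschke z] sends the circle of radius [Num.sqrt (1 - x)] outside the disc of
   radius [b]: in [cmod_blaschke], since [1 - cmod z] bounds the denominator from below, the
   subtracted term is at most [1 - b ^+ 2]. *)
set x := (1 - b ^+ 2) * (1 - cmod z) ^+ 2.
have x0 : 0 < x by rewrite mulr_gt0// exprn_gt0// subr_gt0.
have x1 : x < 1.
  rewrite /x; apply: mulr_ilt1; rewrite ?(ltW b2) ?sqr_ge0//.
    by rewrite gtrBl exprn_gt0.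
  by rewrite expr_lt1 ?subr_ge0 ?(ltW z1)// gtrBl.
pose s := Num.sqrt (1 - x).
have s2 : s ^+ 2 = 1 - x by rewrite sqr_sqrtr// subr_ge0 ltW.
have s0 : 0 < s by rewrite sqrtr_gt0 subr_gt0.
have s1 : s < 1 by rewrite -(@ltr_pXn2r _ 2) ?nnegrE ?(ltW s0)// expr1n s2 gtrBl.
have KM : cmod (K0 k z) <= (b ^+ k.+1)^-1.
  pose F := K0 k \o blaschke z.
  have -> : K0 k z = F 0 by rewrite /F /= blaschke0.
  apply: (mean_value_le (F := F) s0) => w ws.
    have w1 : cmod w < 1 by apply: le_lt_trans ws s1.
    apply: differentiable_comp; first exact: differentiable_blaschke.
    by apply: dK0; exact: blaschke_lt1.
  have w1 : cmod w < 1 by rewrite ws.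
  have B1 := blaschke_lt1 z1 w1.
  have Bb : b <= cmod (blaschke z w).
    rewrite -(@ler_pXn2r _ 2) ?nnegrE ?cmod_ge0 ?(ltW b0)//.
    rewrite cmod_blaschke ?(ltW w1)// ws s2 lerBrDr -lerBrDl.
    rewrite ler_pdivrMr ?exprn_gt0 ?cmod_gt0 ?blaschke_den_neq0 ?(ltW w1)//.
    have -> : 1 - (1 - x) = x by ring.
    rewrite /x mulrC -mulrA ler_wpM2l ?(ltW b2)//.
    apply: (@le_trans _ _ ((1 - cmod z) ^+ 2)).
      by rewrite ler_piMr ?sqr_ge0// lerBlDr lerDl sqr_ge0.
    rewrite ler_pXn2r ?nnegrE ?cmod_ge0 ?subr_ge0 ?(ltW z1)//.
    apply: le_trans (blaschke_den_ge z w); rewrite lerD2l lerN2.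
    by rewrite ler_piMr ?cmod_ge0 ?(ltW w1).
  have Bp : 0 < cmod (blaschke z w) by apply: lt_le_trans Bb.
  rewrite /F /K0 /= cmodM cmodV !cmodX.
  rewrite ler_pdivrMr ?exprn_gt0// mulrC ler_pdivlMr ?exprn_gt0//.
  apply: (@le_trans _ _ (1 * b ^+ k.+1)).
    by rewrite ler_wpM2r ?exprn_ge0 ?(ltW b0)// exprn_ile1 ?cmod_ge0// G1.
  by rewrite mul1r lerXn2r// nnegrE ?cmod_ge0 ?ltW.
move: KM; rewrite /K0 cmodM cmodV !cmodX -/Z ler_pdivrMr ?exprn_gt0// mulrC.
rewrite ler_pdivlMr ?exprn_gt0// => KM.
apply: (@le_trans _ _ (cmod z ^+ k.+1)).
  by apply: le_trans KM; apply: eq_ler; rewrite !exprMn !exprS; ring.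
by rewrite exprS ler_piMl ?exprn_ge0 ?cmod_ge0 ?(ltW z1).
Qed.

Theorem schwarz_pick (F : C R -> C R) : (forall z, cmod z < 1 -> differentiable F z) ->
  (forall z, cmod z < 1 -> cmod (F z) < 1) ->
  forall l t, cmod l < 1 -> cmod t < 1 ->
  cmod (F l - F t) * cmod (1 - t^* * l) <=
  cmod (l - t) * cmod (1 - (F t)^* * F l).
Proof.
move=> dF F1 l t l1 t1; pose G := blaschke (F t) \o F \o blaschke t.
have dG z : cmod z < 1 -> differentiable G z.
  move=> z1; have B1 := blaschke_lt1 t1 z1.
  apply: differentiable_comp; first exact: differentiable_blaschke.
  apply: differentiable_comp; first exact: dF.
  by apply: differentiable_blaschke; exact: F1.
have G1 z : cmod z < 1 -> cmod (G z) <= 1.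
  move=> z1; have B1 := blaschke_lt1 t1 z1.
  by apply: ltW; apply: blaschke_lt1; exact: F1.
have G0 : G 0 = 0 by rewrite /G /= blaschke0 /blaschke subrr mul0r.
have := schwarz dG G1 G0 (blaschke_lt1 t1 l1).
rewrite /G /= blaschkeK// /blaschke !cmodM !cmodV (cmodB t) (cmodB (F t)).
rewrite ler_pdivrMr; last by rewrite cmod_gt0 blaschke_den_neq0 ?F1// ltW ?F1.
rewrite mulrAC ler_pdivlMr//.
by rewrite cmod_gt0 blaschke_den_neq0// ltW.
Qed.

End schwarz_pick.

(** * The infinitesimal Schwarz-Pick form *)

Section pick_form.
Context {R : realType}.
Implicit Types (l t A B a z : C R) (b c r : R).

(* The derivative at [s = 0] of the defect in the Schwarz-Pick inequality at the
   points [l, t] along a curve of self-maps [f_s] of the disc with [f_0 = id] and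
   velocities [A, B] at [l, t]; denominators are cleared. *)
Definition pick_form l t A B : R :=
  ReC ((l - t)^* * (A - B)) * cmod (1 - t^* * l) ^+ 2 +
  cmod (l - t) ^+ 2 * ReC ((1 - t^* * l)^* * (B^* * l + t^* * A)).

(** [pick_form] with every conjugate replaced by an independent variable, so that identities between
    conjugates become polynomial or rational ones, within reach of [ring] and [field]. *)
Definition pickC l lb t tb A Ab B Bb : C R :=
  ((lb - tb) * (A - B) + (l - t) * (Ab - Bb)) / 2%:R * ((1 - tb * l) * (1 - t * lb)) +
  (l - t) * (lb - tb) *
    (((1 - t * lb) * (Bb * l + tb * A) + (1 - tb * l) * (B * lb + t * Ab)) / 2%:R).

Lemma cjD z A : (z + A)^* = z^* + A^*. Proof. exact: rmorphD. Qed.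
Lemma cjN z : (- z)^* = - z^*. Proof. exact: rmorphN. Qed.
Lemma cjM z A : (z * A)^* = z^* * A^*. Proof. exact: rmorphM. Qed.
Lemma cjX z n : (z ^+ n)^* = z^* ^+ n. Proof. exact: rmorphXn. Qed.
Lemma cjV z : (z^-1)^* = (z^*)^-1. Proof. exact: fmorphV. Qed.
Lemma cj1 : (1 : C R)^* = 1. Proof. exact: rmorph1. Qed.
Lemma cj0 : (0 : C R)^* = 0. Proof. exact: rmorph0. Qed.
Lemma cj_mk r c : (mkC r c : C R)^* = mkC r (- c).
Proof. by []. Qed.
Lemma cjK z : (z^*)^* = z. Proof. exact: conjCK. Qed.
Definition cjE := (cjD, cjN, cjM, cjX, cjV, cj1, cj0, cj_mk, cjK).

Lemma mkCM r c : mkC (r * c) 0 = mkC r 0 * mkC c 0 :> C R.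
Proof. by apply: Ceq; rewrite !ReImE; ring. Qed.
Lemma mkCD r c : mkC (r + c) 0 = mkC r 0 + mkC c 0 :> C R.
Proof. by apply: Ceq; rewrite !ReImE; ring. Qed.

Lemma mkC_ReC z : mkC (ReC z) 0 = (z + z^*) / 2%:R.
Proof.
have n2 : (2%:R : C R) != 0 by rewrite pnatr_eq0.
apply: (mulIf n2); rewrite mulfVK//; apply: Ceq; rewrite mulr_natr mulr2n !ReImE; ring.
Qed.

Lemma mkC_cmod z : mkC (cmod z ^+ 2) 0 = z * z^*.
Proof. by apply: Ceq; rewrite ?cmod_sqr !ReImE; ring. Qed.

Lemma mkC0_inj : injective (fun x : R => mkC x 0 : C R).
Proof. by move=> x y /(congr1 (@ReC R)). Qed.

Lemma pick_formE l t A B :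
  mkC (pick_form l t A B) 0 = pickC l l^* t t^* A A^* B B^*.
Proof.
rewrite /pick_form mkCD (mkCM _ (cmod _ ^+ 2)) (mkCM (cmod _ ^+ 2) (ReC _)).
by rewrite !mkC_ReC !mkC_cmod /pickC !cjE.
Qed.

Lemma pick_formD l t A B A' B' :
  pick_form l t (A + A') (B + B') = pick_form l t A B + pick_form l t A' B'.
Proof.
rewrite /pick_form; set x := (l - t)^*; set y := (1 - t^* * l)^*; rewrite cjD.
have -> : x * (A + A' - (B + B')) = x * (A - B) + x * (A' - B') by ring.
have -> : y * ((B^* + B'^*) * l + t^* * (A + A')) =
    y * (B^* * l + t^* * A) + y * (B'^* * l + t^* * A') by ring.
by rewrite (ReCD (x * (A - B))) (ReCD (y * (B^* * l + t^* * A))); ring.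
Qed.

Lemma pick_formZ l t r A B :
  pick_form l t (mkC r 0 * A) (mkC r 0 * B) = r * pick_form l t A B.
Proof.
rewrite /pick_form; set x := (l - t)^*; set y := (1 - t^* * l)^*; rewrite cjM cj_mk oppr0.
have rE z : ReC (mkC r 0 * z) = r * ReC z by rewrite ReCM ReC_mk ImC_mk mul0r subr0.
have -> : x * (mkC r 0 * A - mkC r 0 * B) = mkC r 0 * (x * (A - B)) by ring.
have -> : y * (mkC r 0 * B^* * l + t^* * (mkC r 0 * A)) =
    mkC r 0 * (y * (B^* * l + t^* * A)) by ring.
by rewrite !rE; ring.
Qed.

Lemma pick_formN l t A B : pick_form l t (- A) (- B) = - pick_form l t A B.
Proof.
by apply/eqP; rewrite -addr_eq0 -pick_formD !addNr -(mulr0 (mkC 0 0)) pick_formZ mul0r.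
Qed.

Lemma pick_form_sum I (s : seq I) l t (A B : I -> C R) :
  pick_form l t (\sum_(i <- s) A i) (\sum_(i <- s) B i) =
  \sum_(i <- s) pick_form l t (A i) (B i).
Proof.
elim: s => [|i s IH]; last by rewrite !big_cons pick_formD IH.
by rewrite !big_nil -(mulr0 (mkC 0 0)) pick_formZ mul0r.
Qed.

(* The fields are the complete holomorphic vector fields of the disc. *)
Lemma pick_form_complete l t a b :
  pick_form l t (a - a^* * l ^+ 2 + mkC 0 b * l) (a - a^* * t ^+ 2 + mkC 0 b * t) = 0.
Proof.
apply: mkC0_inj; rewrite /= pick_formE !cjE.
have -> : (mkC 0 (- b) : C R) = - mkC 0 b by apply: Ceq; rewrite !ReImE ?oppr0.
by rewrite /pickC -[RHS]/(0 : C R); ring.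
Qed.

(** For a field that vanishes at [t] the form tells whether the velocity at [l] points away from [t]
    or towards it. *)
Lemma pick_form0 l t A :
  pick_form l t A 0 = (1 - cmod t ^+ 2) * ReC (A * ((l - t) * (1 - t^* * l))^*).
Proof.
apply: mkC0_inj; rewrite /= pick_formE (mkCM _ (ReC _)) mkC_ReC.
have -> : mkC (1 - cmod t ^+ 2) 0 = 1 - t * t^*.
  by rewrite -mkC_cmod; apply: Ceq; rewrite !ReImE ?oppr0 ?addr0.
rewrite !cjE /pickC; ring.
Qed.

Definition herglotz (z : C R) l : C R := (z + l) / (z - l).
Definition poisson (z : C R) l : R := ReC (herglotz z l).

Lemma circle_conj z : cmod z = 1 -> z^* = z^-1.
Proof.
move=> z1; have z0 : z != 0 by rewrite -cmod_gt0 z1.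
apply: (mulfI z0); rewrite mulfV// -mkC_cmod z1 expr1n //.
Qed.

Lemma circleB_neq0 z l : cmod z = 1 -> cmod l < 1 -> z - l != 0.
Proof.
by move=> z1 l1; rewrite subr_eq0; apply/eqP => E; move: l1; rewrite -E z1 ltxx.
Qed.

(** Since [z^*] is [z^-1] on the circle, this is a rational identity in [z], [l], [t] and the
    conjugates of [l] and [t]. What matters is the sign: each boundary point enters with a positive
    weight. *)
Lemma pick_form_herglotz z l t : cmod z = 1 -> cmod l < 1 -> cmod t < 1 ->
  pick_form l t (l * herglotz z l) (t * herglotz z t) =
  cmod (l - t) ^+ 2 * cmod (1 - t^* * l) ^+ 2 * (poisson z l * poisson z t).
Proof.
move=> z1 l1 t1; apply: mkC0_inj; rewrite /= pick_formE (mkCM _ (_ * _)).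
rewrite (mkCM (cmod _ ^+ 2)) (mkCM (poisson _ _)) !mkC_cmod !mkC_ReC.
rewrite /herglotz !cjE (circle_conj z1).
have z0 : z != 0 by rewrite -cmod_gt0 z1.
have d1 := circleB_neq0 z1 l1; have d2 := circleB_neq0 z1 t1.
have d3 : 1 - l^* * z != 0 by rewrite blaschke_den_neq0 // z1.
have d4 : 1 - t^* * z != 0 by rewrite blaschke_den_neq0 // z1.
rewrite /pickC; set lb := l^* in d3 *; set tb := t^* in d4 *.
field.
by rewrite !mulNr z0 d2 d1 /= andbT; apply/andP; split; [exact: d4|exact: d3].
Qed.

(** [mkC 0 1 * hpoly a b l] is the general complete field [c - c^* * l ^+ 2 + mkC 0 b * l], with
    [c = mkC 0 1 * a^*]. *)
Definition hpoly a b l : C R := a^* + mkC b 0 * l + a * l ^+ 2.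
Definition hreal a b z : R := b + 2 * ReC (a * z).

Lemma hpoly_twist a b z : cmod z = 1 -> z^* * hpoly a b z = mkC (hreal a b z) 0.
Proof.
move=> z1; have zz : z * z^* = 1 by rewrite -mkC_cmod z1 expr1n.
have -> : z^* * hpoly a b z = mkC b 0 * (z * z^*) + a * z * (z * z^*) + (a * z)^*.
  by rewrite cjM /hpoly; ring.
by rewrite zz !mulr1; apply: Ceq; rewrite /hreal !ReImE; ring.
Qed.

(** At [l = z] the polynomial [hpoly a b l] agrees with [hreal a b z * l], so exchanging one for the
    other removes the pole of the kernel. The difference is not only a polynomial but a complete
    field, hence invisible to [pick_form]. *)
Lemma hpoly_herglotz a b z l : cmod z = 1 -> cmod l < 1 ->
  hpoly a b l * herglotz z l = mkC (hreal a b z) 0 * (l * herglotz z l) +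
    (a^* - a^*^* * l ^+ 2 + mkC 0 (- (2 * ImC (a * z))) * l).
Proof.
move=> z1 l1; rewrite -hpoly_twist// cjK.
have -> : mkC 0 (- (2 * ImC (a * z))) = a^* * z^* - a * z :> C R.
  by rewrite -cjM; apply: Ceq; rewrite !ReImE; ring.
have z0 : z != 0 by rewrite -cmod_gt0 z1.
rewrite (circle_conj z1) /hpoly /herglotz; field.
by rewrite z0 (circleB_neq0 z1 l1).
Qed.

Lemma pick_form_hpoly_herglotz a b z l t : cmod z = 1 -> cmod l < 1 -> cmod t < 1 ->
  pick_form l t (hpoly a b l * herglotz z l) (hpoly a b t * herglotz z t) =
  cmod (l - t) ^+ 2 * cmod (1 - t^* * l) ^+ 2 *
    (hreal a b z * (poisson z l * poisson z t)).
Proof.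
move=> z1 l1 t1; rewrite !hpoly_herglotz// pick_formD pick_form_complete addr0.
rewrite pick_formZ pick_form_herglotz//; ring.
Qed.

(** Imaginary constants, such as those left undetermined by a boundary measure, have no influence on
    the form. *)
Lemma pick_form_hpoly_imag a b c l t :
  pick_form l t (hpoly a b l * mkC 0 c) (hpoly a b t * mkC 0 c) = 0.
Proof.
have E w : hpoly a b w * mkC 0 c =
   (a^* * mkC 0 c) - (a^* * mkC 0 c)^* * w ^+ 2 + mkC 0 (b * c) * w.
  have -> : mkC 0 (b * c) = mkC b 0 * mkC 0 c :> C R by apply: Ceq; rewrite !ReImE; ring.
  rewrite !cjE.
  have -> : mkC 0 (- c) = - mkC 0 c :> C R by apply: Ceq; rewrite !ReImE ?oppr0.
  rewrite /hpoly; ring.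
by rewrite !E pick_form_complete.
Qed.

(** A real linear combination of real and imaginary parts is the shape in which the form commutes
    with a functional defined on real kernels. *)
Lemma pick_form_coords l t p q : exists c1 c2 c3 c4, forall A B,
  pick_form l t (p * A) (q * B) = c1 * ReC A + c2 * ImC A + (c3 * ReC B + c4 * ImC B).
Proof.
exists (pick_form l t p 0), (pick_form l t (p * mkC 0 1) 0).
exists (pick_form l t 0 q), (pick_form l t 0 (q * mkC 0 1)) => A B.
have E z w : w * z = mkC (ReC z) 0 * w + mkC (ImC z) 0 * (w * mkC 0 1).
  by apply: Ceq; rewrite !ReImE; ring.
have D (u v : C R) : pick_form l t u v = pick_form l t u 0 + pick_form l t 0 v.
  by rewrite -pick_formD addr0 add0r.
have Zl r u : pick_form l t (mkC r 0 * u) 0 = r * pick_form l t u 0.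
  by rewrite -pick_formZ mulr0.
have Zr r u : pick_form l t 0 (mkC r 0 * u) = r * pick_form l t 0 u.
  by rewrite -pick_formZ mulr0.
have Dl u v : pick_form l t (u + v) 0 = pick_form l t u 0 + pick_form l t v 0.
  by rewrite -pick_formD addr0.
have Dr u v : pick_form l t 0 (u + v) = pick_form l t 0 u + pick_form l t 0 v.
  by rewrite -pick_formD addr0.
rewrite D (E A) (E B) Dl Dr !Zl !Zr; ring.
Qed.

End pick_form.

Section herglotz_functional.
Context {R : realType}.
Implicit Types (a : C R) (K : circle R -> R).

Definition ccont K : Prop := continuous (K : set_type (@unit_circle R) -> R).

Lemma ccont_cst (c : R) : ccont (fun=> c).
Proof. exact: (@cst_continuous (set_type (@unit_circle R)) R c). Qed.
Lemma ccontD K1 K2 : ccont K1 -> ccont K2 -> ccont (fun z => K1 z + K2 z).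
Proof.
move=> c1 c2 x.
exact: (@continuousD R R^o (set_type (@unit_circle R)) _ _ x (c1 x) (c2 x)).
Qed.
Lemma ccontM K1 K2 : ccont K1 -> ccont K2 -> ccont (fun z => K1 z * K2 z).
Proof.
move=> c1 c2 x.
exact: (@continuousM R (set_type (@unit_circle R)) _ _ x (c1 x) (c2 x)).
Qed.
Lemma ccontZ (c : R) K : ccont K -> ccont (fun z => c * K z).
Proof. by apply: ccontM; exact: ccont_cst. Qed.

Lemma ccont_ReC (F : C R -> C R) : (forall z, cmod z = 1 -> differentiable F z) ->
  ccont (fun l => ReC (F (cval l))).
Proof.
move=> dF l; apply: (@continuous_comp (set_type (@unit_circle R)) (C R) R _ (@ReC R)).
  apply: (@continuous_comp (set_type (@unit_circle R)) (C R) (C R) _ F).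
    exact: continuous_cval.
  by apply: differentiable_continuous; apply: dF; rewrite cmod_cval.
exact: continuous_ReC.
Qed.

Lemma ccont_ImC (F : C R -> C R) : (forall z, cmod z = 1 -> differentiable F z) ->
  ccont (fun l => ImC (F (cval l))).
Proof.
move=> dF l; apply: (@continuous_comp (set_type (@unit_circle R)) (C R) R _ (@ImC R)).
  apply: (@continuous_comp (set_type (@unit_circle R)) (C R) (C R) _ F).
    exact: continuous_cval.
  by apply: differentiable_continuous; apply: dF; rewrite cmod_cval.
exact: continuous_ImC.
Qed.

Lemma differentiable_herglotz (l z : C R) : cmod z = 1 -> cmod l < 1 ->
  differentiable (fun z => herglotz z l) z.
Proof.
move=> z1 l1; apply: differentiableM.
  by apply: differentiableD.
apply: differentiableV; last exact: circleB_neq0.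
by apply: differentiableB.
Qed.

Lemma ccont_Re_herglotz (l : C R) : cmod l < 1 -> ccont (fun z => ReC (herglotz (cval z) l)).
Proof.
move=> l1; apply: (@ccont_ReC (fun z => herglotz z l)) => z z1.
exact: differentiable_herglotz.
Qed.

Lemma ccont_Im_herglotz (l : C R) : cmod l < 1 -> ccont (fun z => ImC (herglotz (cval z) l)).
Proof.
move=> l1; apply: (@ccont_ImC (fun z => herglotz z l)) => z z1.
exact: differentiable_herglotz.
Qed.

Lemma ccont_poisson (l : C R) : cmod l < 1 -> ccont (fun z => poisson (cval z) l).
Proof. exact: ccont_Re_herglotz. Qed.

Lemma ccont_hreal a b : ccont (fun z => hreal a b (cval z)).
Proof.
apply: ccontD; first exact: ccont_cst.
apply: ccontZ; apply: (@ccont_ReC (fun z => a * z)) => z _.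
exact: differentiableM.
Qed.

Definition clinear (T : (circle R -> R) -> R) := forall K1 K2 (a b : R),
  ccont K1 -> ccont K2 -> T (fun z => a * K1 z + b * K2 z) = a * T K1 + b * T K2.

Definition herglotz_transform (T : (circle R -> R) -> R) (c : R) (l : C R) : C R :=
  mkC ((2 * pi)^-1 * T (fun z => ReC (herglotz (cval z) l)))
      ((2 * pi)^-1 * T (fun z => ImC (herglotz (cval z) l)) + c).

Lemma pick_form_herglotz_transform (T : (circle R -> R) -> R) (c : R) a b (l t : C R) :
  clinear T -> cmod l < 1 -> cmod t < 1 ->
  pick_form l t (hpoly a b l * herglotz_transform T c l)
                (hpoly a b t * herglotz_transform T c t) =
  cmod (l - t) ^+ 2 * cmod (1 - t^* * l) ^+ 2 * ((2 * pi)^-1 *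
    T (fun z => hreal a b (cval z) * (poisson (cval z) l * poisson (cval z) t))).
Proof.
move=> linT l1 t1.
have E w : hpoly a b w * herglotz_transform T c w =
   hpoly a b w * herglotz_transform T 0 w + hpoly a b w * mkC 0 c.
  rewrite -mulrDr; congr (_ * _).
  by apply: Ceq; rewrite /herglotz_transform !ReImE ?addr0.
rewrite !E pick_formD pick_form_hpoly_imag addr0.
have [c1 [c2 [c3 [c4 H]]]] := pick_form_coords l t (hpoly a b l) (hpoly a b t).
set k := cmod (l - t) ^+ 2 * _.
have cRl := ccont_Re_herglotz l1; have cIl := ccont_Im_herglotz l1.
have cRt := ccont_Re_herglotz t1; have cIt := ccont_Im_herglotz t1.
set Rl := fun z : circle R => ReC (herglotz (cval z) l) in cRl.
set Il := fun z : circle R => ImC (herglotz (cval z) l) in cIl.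
set Rt := fun z : circle R => ReC (herglotz (cval z) t) in cRt.
set It := fun z : circle R => ImC (herglotz (cval z) t) in cIt.
set K := fun z : circle R => hreal _ _ _ * _.
have cK : ccont K.
  by apply: ccontM; [exact: ccont_hreal|apply: ccontM; exact: ccont_poisson].
(* The summand [0 * K z] and the factors [1] merely produce the two-term shape on which [clinear] is
   stated. *)
have EK : (fun z => k * K z + 0 * K z) =
  (fun z => 1 * (c1 * Rl z + c2 * Il z) + 1 * (c3 * Rt z + c4 * It z)).
  apply/funext => z; rewrite !mul1r mul0r addr0 -H.
  by rewrite pick_form_hpoly_herglotz// cmod_cval.
have TK : k * T K = c1 * T Rl + c2 * T Il + (c3 * T Rt + c4 * T It).
  transitivity (T (fun z => k * K z + 0 * K z)); first by rewrite linT// mul0r addr0.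
  rewrite EK linT; [|by apply: ccontD; apply: ccontZ..].
  by rewrite !mul1r !linT.
rewrite (mulrCA k) TK H /herglotz_transform !ReImE !addr0 -/Rl -/Il -/Rt -/It; ring.
Qed.

End herglotz_functional.

(** * Integration against signed measures *)

Section bounded_functionals.
Context d (T : measurableType d) (R : realType).
Implicit Types (K : T -> R).

Definition bmeas K := measurable_fun setT K /\ exists M : R, forall x, `|K x| <= M.

Lemma bmeas_comb K1 K2 (a b : R) : bmeas K1 -> bmeas K2 ->
  bmeas (fun x => a * K1 x + b * K2 x).
Proof.
move=> [m1 [M1 H1]] [m2 [M2 H2]]; split.
  by apply: measurable_funD; apply: measurable_funM.
exists (`|a| * M1 + `|b| * M2) => x; apply: le_trans (ler_normD _ _) _.
by rewrite !normrM lerD// ler_wpM2l.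
Qed.

Lemma bmeas_indic (A : set T) : measurable A -> bmeas (\1_A).
Proof.
move=> mA; split; first exact: measurable_indic.
by exists 1 => x; rewrite indicE ger0_norm// lern1 leq_b1.
Qed.

(** The sum counts the thresholds [1, ..., n] that [y] has reached, so it is the integer part of [y]
    up to [n]. It serves as a staircase approximation. *)
Lemma count_le_bounds (y : R) n : 0 <= y ->
  (n%:R <= y -> \sum_(i < n) (i.+1%:R <= y)%R%:R = n%:R :> R) /\
  (y <= n%:R -> y - 1 <= \sum_(i < n) (i.+1%:R <= y)%R%:R <= y).
Proof.
move=> y0; elim: n => [|n [IH1 IH2]].
  by rewrite big_ord0; split => // ?; rewrite y0 andbT; lra.
rewrite big_ord_recr /=; split.
  move=> ny; have ny' : n%:R <= y by apply: le_trans ny; rewrite ler_nat.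
  by rewrite IH1// ny -natr1.
rewrite le_eqVlt => /predU1P[yn|yn].
  have ny' : n%:R <= y by rewrite yn ler_nat.
  have -> : (n.+1%:R <= y)%R = true by rewrite yn lexx.
  by rewrite IH1// natr1 -yn lexx andbT; lra.
rewrite (leNgt _ y) yn addr0.
have [ny|/ltW/IH2//] := leP n%:R y.
by rewrite IH1// ny andbT; move: yn; rewrite -natr1; lra.
Qed.

(** Staircases of level sets approximate a bounded measurable function uniformly, and the functional
    is continuous for uniform convergence. After an affine rescaling the function may be assumed to
    take values in [[0, 1]]. *)
Lemma functional_eq0 (Phi : (T -> R) -> R) (c : R) :
  (forall K1 K2 (a b : R), bmeas K1 -> bmeas K2 ->
     Phi (fun x => a * K1 x + b * K2 x) = a * Phi K1 + b * Phi K2) ->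
  (forall K (M : R), bmeas K -> (forall x, `|K x| <= M) -> `|Phi K| <= c * M) ->
  (forall A, measurable A -> Phi (\1_A) = 0) ->
  forall K, bmeas K -> Phi K = 0.
Proof.
move=> lin bnd ind.
have b1 : bmeas (fun=> 1).
  have -> : (fun=> 1) = \1_[set: T] :> (T -> R) by apply/funext => x; rewrite indicT.
  exact: bmeas_indic.
have P1 : Phi (fun=> 1) = 0 by rewrite -(ind setT)// indicT.
have b01 K : bmeas K -> (forall x, 0 <= K x <= 1) -> Phi K = 0.
  move=> bK K01; have [mK _] := bK.
  pose A n i := [set x | i.+1%:R <= n.+1%:R * K x].
  have mA n i : measurable (A n i).
    rewrite /A -[X in measurable X]setTI.
    apply: (measurable_fun_le (f := fun=> i.+1%:R) (g := fun x => n.+1%:R * K x)) => //.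
    exact: measurable_funM.
  pose S n m x : R := \sum_(i < m) \1_(A n i) x.
  have bS n m : bmeas (S n m) /\ Phi (S n m) = 0.
    elim: m => [|m [IH1 IH2]].
      have E : S n 0%N = (fun x => 0 * 1 + 0 * 1 : R).
        by apply/funext => x; rewrite /S big_ord0 !mul0r addr0.
      by rewrite E; split; [exact: bmeas_comb|rewrite lin// !mul0r addr0].
    have E : S n m.+1 = (fun x => 1 * S n m x + 1 * \1_(A n m) x).
      by apply/funext => x; rewrite /S big_ord_recr /= !mul1r.
    rewrite E; split; first by apply: bmeas_comb => //; exact: bmeas_indic.
    by rewrite lin ?IH2 ?ind ?mulr0 ?addr0//; exact: bmeas_indic.
  apply/eqP; rewrite -normr_le0; apply/ler_addgt0Pl => e e0; rewrite addr0.
  have c0 : 0 <= `|c| by [].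
  set n := Num.truncn (`|c| / e).
  have nE : `|c| / e < n.+1%:R by rewrite truncnS_gt.
  have n0 : 0 < n.+1%:R :> R by rewrite ltr0n.
  have bD : bmeas (fun x => 1 * K x + (- n.+1%:R^-1) * S n n.+1 x).
    by apply: bmeas_comb => //; case: (bS n n.+1).
  have -> : Phi K = Phi (fun x => 1 * K x + (- n.+1%:R^-1) * S n n.+1 x).
    by rewrite lin//; case: (bS n n.+1) => // _ ->; rewrite mulr0 addr0 mul1r.
  apply: le_trans (bnd _ n.+1%:R^-1 bD _) _.
    move=> x; have /andP[K0 K1] := K01 x.
    have y0 : 0 <= n.+1%:R * K x by rewrite mulr_ge0.
    have [_] := count_le_bounds n.+1 y0.
    have -> : \sum_(i < n.+1) (i.+1%:R <= n.+1%:R * K x)%R%:R = S n n.+1 x.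
      apply: eq_bigr => i _; rewrite indicE; congr (nat_of_bool _)%:R.
      by apply/idP/idP; rewrite inE.
    rewrite -{2}(mulr1 n.+1%:R) ler_pM2l// => /(_ K1) /andP[S1 S2].
    have E : 1 * K x + - n.+1%:R^-1 * S n n.+1 x = n.+1%:R^-1 * (n.+1%:R * K x - S n n.+1 x).
      by rewrite mulrBr mulKf ?gt_eqF// mul1r mulNr.
    rewrite E normrM ger0_norm ?invr_ge0//.
    rewrite -[leRHS]mulr1 ler_wpM2l ?invr_ge0// ger0_norm; lra.
  apply: (@le_trans _ _ (`|c| * n.+1%:R^-1)).
    by rewrite ler_wpM2r ?invr_ge0// ler_norm.
  by rewrite ler_pdivrMr// mulrC -ler_pdivrMr// ltW.
move=> K bK; have [mK [M KM]] := bK.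
pose N := `|M| + 1.
have N0 : 0 < N by rewrite ltr_wpDl.
have KN x : `|K x| <= N.
  by apply: le_trans (KM x) _; rewrite /N (le_trans (ler_norm _))// lerDl.
pose K' x : R := (2 * N)^-1 * K x + 2^-1 * 1.
have bK' : bmeas K' by exact: bmeas_comb.
have : Phi K' = 0.
  apply: b01 => // x; have := KN x; rewrite ler_norml => /andP[k1 k2].
  rewrite /K' mulr1; have -> : (2 * N)^-1 * K x + 2^-1 = (K x + N) / (2 * N).
    by field; rewrite gt_eqF.
  apply/andP; split; first by rewrite divr_ge0 ?mulr_ge0 ?(ltW N0)//; lra.
  by rewrite ler_pdivrMr ?mulr_gt0//; lra.
rewrite lin// P1 mulr0 addr0 => /eqP; rewrite mulf_eq0 invr_eq0 gt_eqF ?mulr_gt0//=.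
by move/eqP.
Qed.

End bounded_functionals.

Section charge_integral_density.
Context d (T : measurableType d) (R : realType).
Implicit Types (m : {measure set T -> \bar R}) (K f : T -> R).

Lemma bmeas_integrable_mul m K f : bmeas K -> m.-integrable setT (EFin \o f) ->
  m.-integrable setT (EFin \o (fun x => K x * f x)).
Proof. by move=> [mK [M KM]] intf; apply: integrable_bounded_mul KM. Qed.

Lemma integrableRZl m f (a : R) : m.-integrable setT (EFin \o f) ->
  m.-integrable setT (EFin \o (fun x => a * f x)).
Proof.
move=> intf; rewrite (_ : EFin \o _ = fun x => (a%:E * (EFin \o f) x)%E).
  exact: integrableZl.
by apply/funext => x /=; rewrite EFinM.
Qed.

Lemma Rintegral_comb_mul m f K1 K2 (a b : R) : m.-integrable setT (EFin \o f) ->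
  bmeas K1 -> bmeas K2 ->
  \int[m]_x ((a * K1 x + b * K2 x) * f x) =
  a * \int[m]_x (K1 x * f x) + b * \int[m]_x (K2 x * f x).
Proof.
move=> intf b1 b2; have i1 := bmeas_integrable_mul b1 intf.
have i2 := bmeas_integrable_mul b2 intf.
rewrite -RintegralZl// -RintegralZl// -RintegralD//.
- by apply: eq_Rintegral => x _; rewrite mulrDl !mulrA.
- exact: integrableRZl i1.
- exact: integrableRZl i2.
Qed.

Lemma Rintegral_mul_bound m f K (M : R) : m.-integrable setT (EFin \o f) ->
  bmeas K -> (forall x, `|K x| <= M) ->
  `|\int[m]_x (K x * f x)| <= (\int[m]_x `|f x|) * M.
Proof.
move=> intf bK KM; have i1 := bmeas_integrable_mul bK intf.
have nf : m.-integrable setT (EFin \o (Num.norm \o f)) by exact: integrable_norm.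
apply: le_trans (le_normr_Rintegral _ _) _ => //.
rewrite mulrC -RintegralZl//; apply: le_Rintegral => //.
- exact: (integrable_norm i1).
- exact: integrableRZl nf.
- by move=> x _; rewrite normrM ler_wpM2r.
Qed.

Lemma Rintegral_indic_mul m f A : measurable A ->
  \int[m]_x (\1_A x * f x) = \int[m]_(x in A) f x.
Proof.
move=> mA; rewrite [RHS]Rintegral_mkcond; apply: eq_Rintegral => x _.
by rewrite patchE indicE; case: ifP => xA; rewrite ?mul1r ?mul0r.
Qed.

Lemma integrable_cst1 m : (m setT < +oo)%E -> m.-integrable setT (EFin \o (fun=> 1)).
Proof.
by move=> mT; apply: (bounded_integrable (M := 1)) => // x; rewrite normr1.
Qed.

(** Both sides are bounded linear functionals of the kernel and agree on indicators, by the Jordan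
    decomposition; [functional_eq0] is applied to their difference. *)
Lemma charge_Rintegral_density (mu : {charge set T -> \bar R}) m1 m2 f1 f2 :
  m1.-integrable setT (EFin \o f1) -> m2.-integrable setT (EFin \o f2) ->
  (forall A, measurable A ->
     mu A = (\int[m1]_(x in A) (f1 x)%:E + \int[m2]_(x in A) (f2 x)%:E)%E) ->
  forall K, bmeas K -> charge_Rintegral mu K =
    \int[m1]_x (K x * f1 x) + \int[m2]_x (K x * f2 x).
Proof.
move=> i1 i2 muE K bK; apply/eqP; rewrite -subr_eq0; apply/eqP.
rewrite /charge_Rintegral; set h0 := projT2 _; set h := projT2 (cid h0).
set p := jordan_pos h; set q := jordan_neg h.
have pT : (p setT < +oo)%E by rewrite ltey_eq fin_num_measure.
have qT : (q setT < +oo)%E by rewrite ltey_eq fin_num_measure.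
have ip := integrable_cst1 pT; have iq := integrable_cst1 qT.
pose Phi (K : T -> R) := \int[p]_x (K x * 1) - \int[q]_x (K x * 1) -
  (\int[m1]_x (K x * f1 x) + \int[m2]_x (K x * f2 x)).
have -> : \int[p]_x K x - \int[q]_x K x -
  (\int[m1]_x (K x * f1 x) + \int[m2]_x (K x * f2 x)) = Phi K.
  by congr (_ - _ - _); apply: eq_Rintegral => x _; rewrite mulr1.
apply: (@functional_eq0 _ _ _ Phi (\int[p]_x `|1| + \int[q]_x `|1| +
   (\int[m1]_x `|f1 x| + \int[m2]_x `|f2 x|))) => //.
- move=> K1 K2 a b b1 b2; rewrite /Phi.
  by rewrite (Rintegral_comb_mul _ _ ip)// (Rintegral_comb_mul _ _ iq)//
    (Rintegral_comb_mul _ _ i1)// (Rintegral_comb_mul _ _ i2)//; ring.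
- move=> K' M b' KM; rewrite /Phi.
  have := Rintegral_mul_bound ip b' KM; have := Rintegral_mul_bound iq b' KM.
  have := Rintegral_mul_bound i1 b' KM; have := Rintegral_mul_bound i2 b' KM.
  rewrite !mulrDl; move: (\int[p]_x (K' x * 1)) (\int[q]_x (K' x * 1))
    (\int[m1]_x (K' x * f1 x)) (\int[m2]_x (K' x * f2 x)) => a1 a2 a3 a4 h4 h3 h2 h1.
  apply: le_trans (ler_normB _ _) _; apply: lerD.
    by apply: le_trans (ler_normB _ _) _; apply: lerD.
  by apply: le_trans (ler_normD _ _) _; apply: lerD.
- move=> A mA; rewrite /Phi !Rintegral_indic_mul//.
  have pA : p A \is a fin_num by exact: fin_num_measure.
  have qA : q A \is a fin_num by exact: fin_num_measure.
  rewrite !Rintegral_cst// !mul1r; apply/eqP; rewrite subr_eq0; apply/eqP.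
  rewrite -fineB// /Rintegral -fineD; last 2 first.
  + by apply: integrable_fin_num => //; apply: integrableS i1.
  + by apply: integrable_fin_num => //; apply: integrableS i2.
  by rewrite -muE// (jordan_decomp h mA) /cadd /= cscaleN1.
Qed.

End charge_integral_density.

(** * Poisson integrals and their boundary values *)

Section poisson_kernel.
Context {R : realType}.
Implicit Types (z l w : C R).

Lemma poissonE z l : cmod z = 1 ->
  poisson z l = (1 - cmod l ^+ 2) / cmod (z - l) ^+ 2.
Proof.
move=> z1; have [E|E] := eqVneq (z - l) 0.
  by rewrite /poisson /herglotz E invr0 mulr0 cmod0 expr0n invr0 mulr0.
have E' : cmod (z - l) ^+ 2 != 0 by rewrite expf_neq0// cmod_eq0.
have EC : mkC (cmod (z - l) ^+ 2) 0 != 0 :> C R.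
  by apply: contraNneq E' => /(congr1 (@ReC R)) /eqP.
rewrite /poisson; have -> : herglotz z l = mkC (cmod (z - l) ^+ 2)^-1 0 * ((z + l) * (z - l)^*).
  apply: (mulfI EC); rewrite [RHS]mulrA -(mkCM (cmod (z - l) ^+ 2)) (mulfV E').
  have -> : mkC 1 0 = 1 :> C R by [].
  rewrite mkC_cmod /herglotz.
  by set b := (z - l)^*; set a := z - l in E *; field.
rewrite mulrC; rewrite -(expr1n _ 2) -z1 !cmod_sqr !ReImE.
rewrite mulr0 subr0; congr (_ / _); ring.
Qed.

Lemma poisson_ge0 z l : cmod z = 1 -> cmod l < 1 -> 0 <= poisson z l.
Proof.
move=> z1 l1; rewrite poissonE// divr_ge0 ?sqr_ge0// subr_ge0.
by rewrite expr_le1 ?cmod_ge0 ?ltW.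
Qed.

Lemma poisson_bounds z l (r : R) : cmod z = 1 -> cmod l <= r -> r < 1 ->
  (1 - r) / (1 + r) <= poisson z l <= (1 + r) / (1 - r).
Proof.
move=> z1 lr r1; have l0 := cmod_ge0 l; rewrite poissonE//.
set x := cmod l in lr l0 *.
have D1 : 1 - x <= cmod (z - l).
  by have := cmodD (z - l) l; rewrite subrK z1 -/x; lra.
have D2 : cmod (z - l) <= 1 + x by rewrite -z1; exact: cmodB_le.
have D0 : 0 < cmod (z - l) by lra.
apply/andP; split.
  rewrite ler_pdivlMr ?exprn_gt0// mulrAC ler_pdivrMr; last by lra.
  apply: (@le_trans _ _ ((1 - r) * (1 + x) ^+ 2)).
    have D2' : cmod (z - l) ^+ 2 <= (1 + x) ^+ 2.
      by rewrite lerXn2r ?nnegrE ?cmod_ge0// addr_ge0.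
    by rewrite ler_wpM2l//; lra.
  have -> : (1 - r) * (1 + x) ^+ 2 = ((1 - r) * (1 + x)) * (1 + x) by ring.
  have -> : (1 - x ^+ 2) * (1 + r) = ((1 - x) * (1 + r)) * (1 + x) by ring.
  by rewrite ler_wpM2r; [|lra|nra].
rewrite ler_pdivrMr ?exprn_gt0// mulrAC ler_pdivlMr; last by lra.
apply: (@le_trans _ _ ((1 + r) * (1 - x) ^+ 2)); last first.
  have D1' : (1 - x) ^+ 2 <= cmod (z - l) ^+ 2.
    by rewrite lerXn2r ?nnegrE ?cmod_ge0//; lra.
  by rewrite ler_wpM2l//; lra.
have -> : (1 + r) * (1 - x) ^+ 2 = ((1 + r) * (1 - x)) * (1 - x) by ring.
have -> : (1 - x ^+ 2) * (1 - r) = ((1 + x) * (1 - r)) * (1 - x) by ring.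
by rewrite ler_wpM2r; [|lra|nra].
Qed.

Lemma ccont_bmeas K : ccont K -> @bmeas _ (circle R) R K.
Proof.
by move=> cK; split; [exact: circle_measurable|exact: circle_bounded].
Qed.

Lemma Rintegral_herglotz l : cmod l < 1 ->
  \int[@arclength R]_z ReC (herglotz (cval z) l) = 2 * pi /\
  \int[@arclength R]_z ImC (herglotz (cval z) l) = 0.
Proof.
(* As a function of the boundary point the Herglotz kernel has a pole at [l]. On the circle its
   conjugate coincides with [F], which is holomorphic on the closed disc. *)
move=> l1; pose F w : C R := (1 + l^* * w) / (1 - l^* * w).
have dF w : cmod w <= 1 -> differentiable F w.
  move=> w1; apply: differentiableM.
    by apply: differentiableD => //; apply: differentiableM.
  apply: differentiableV; last by rewrite blaschke_den_neq0.
  by apply: differentiableB => //; apply: differentiableM.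
have FE (z : circle R) : F (cval z) = (herglotz (cval z) l)^*.
  have z1 := cmod_cval z; have z0 : cval z != 0 by rewrite -cmod_gt0 z1.
  have z0' : (cval z)^* != 0 by rewrite -cmod_gt0 cmodJ z1.
  have zz : cval z * (cval z)^* = 1 by rewrite -mkC_cmod z1 expr1n.
  rewrite /herglotz !cjE /F.
  have -> : (cval z)^* + l^* = (cval z)^* * (1 + l^* * cval z).
    by rewrite mulrDr mulr1 mulrCA [_^* * cval z]mulrC zz mulr1.
  have -> : (cval z)^* + - l^* = (cval z)^* * (1 - l^* * cval z).
    by rewrite mulrBr mulr1 mulrCA [_^* * cval z]mulrC zz mulr1.
  by rewrite invfM mulrACA mulfV// mul1r.
have F0 : F 0 = 1 by rewrite /F mulr0 addr0 subr0 divr1.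
split.
  have := @mean_value R F dF; rewrite F0 mulr1 => <-.
  by apply: eq_Rintegral => z _; rewrite FE ReCJ.
have := @mean_value R (fun w => mkC 0 1 * F w) _.
rewrite F0 mulr1 ReC_mk mulr0 => <-.
  by apply: eq_Rintegral => z _; rewrite FE !ReImE; ring.
by move=> w /dF ?; apply: differentiableM.
Qed.

(** Mass and second moment about [z]; the second moment tends to [0] as [r] tends to [1], which
    measures the concentration of the kernel at [z]. *)
Lemma Rintegral_poisson_approx z (r : R) : cmod z = 1 -> 0 <= r < 1 ->
  \int[@arclength R]_y poisson z (mkC r 0 * cval y) = 2 * pi /\
  \int[@arclength R]_y (poisson z (mkC r 0 * cval y) * cmod (cval y - z) ^+ 2) =
    2 * pi * (2 - 2 * r).
Proof.
move=> z1 /andP[r0 r1].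
have z0 : z != 0 by rewrite -cmod_gt0 z1.
have den w : cmod w <= 1 -> z - mkC r 0 * w != 0.
  move=> w1; rewrite circleB_neq0// cmodM cmod_mk0 ger0_norm//.
  by apply: le_lt_trans r1; rewrite ler_piMr.
pose F w : C R := herglotz z (mkC r 0 * w).
have dF w : cmod w <= 1 -> differentiable F w.
  move=> w1; apply: differentiableM.
    by apply: differentiableD => //; apply: differentiableM.
  apply: differentiableV; last exact: den.
  by apply: differentiableB => //; apply: differentiableM.
have F0 : F 0 = 1 by rewrite /F /herglotz mulr0 addr0 subr0 divff.
have I1 : \int[@arclength R]_y poisson z (mkC r 0 * cval y) = 2 * pi.
  by have := @mean_value R F dF; rewrite F0 mulr1 => <-.
split => //.
(* [P |y - z|^2 = 2 P - Re G] on the circle, with [G] holomorphic *)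
pose G w : C R := F w * (w / z) + mkC (2 * r) 0 * (z / (z - mkC r 0 * w)) + w / z.
have dG w : cmod w <= 1 -> differentiable G w.
  move=> w1; apply: differentiableD; last first.
    by apply: differentiableM.
  apply: differentiableD.
    by apply: differentiableM; [exact: dF|exact: differentiableM].
  apply: differentiableM; first exact: differentiable_cst.
  apply: differentiableM; first exact: differentiable_cst.
  apply: differentiableV; last exact: den.
  by apply: differentiableB => //; apply: differentiableM.
have G0 : ReC (G 0) = 2 * r.
  by rewrite /G mulr0 !subr0 mul0r mulr0 add0r addr0 divff// mulr1.
have E (y : circle R) : poisson z (mkC r 0 * cval y) * cmod (cval y - z) ^+ 2 =
    2 * poisson z (mkC r 0 * cval y) + (-1) * ReC (G (cval y)).
  have y1 := cmod_cval y; have y0 : cval y != 0 by rewrite -cmod_gt0 y1.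
  have dy := den _ (eq_ler y1).
  have GE : G (cval y) = F (cval y) * (cval y / z + (cval y / z)^*) +
     (cval y / z - (cval y / z)^*).
    rewrite !cjE (circle_conj y1) (circle_conj z1) invrK /G /F /herglotz.
    have -> : mkC (2 * r) 0 = mkC r 0 + mkC r 0 :> C R.
      by rewrite -mkCD; congr mkC; ring.
    by field; rewrite y0 z0 dy.
  rewrite GE cmod_sqr /poisson -/(F (cval y)).
  have -> : ReC (cval y - z) ^+ 2 + ImC (cval y - z) ^+ 2 = 2 - 2 * ReC (cval y / z).
    have -> : ReC (cval y / z) = ReC (cval y) * ReC z + ImC (cval y) * ImC z.
      by rewrite -(circle_conj z1) !ReImE; ring.
    have e1 : ReC z ^+ 2 + ImC z ^+ 2 = 1 by rewrite -cmod_sqr z1 expr1n.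
    have e2 : ReC (cval y) ^+ 2 + ImC (cval y) ^+ 2 = 1 by rewrite -cmod_sqr y1 expr1n.
    transitivity ((ReC z ^+ 2 + ImC z ^+ 2) + (ReC (cval y) ^+ 2 + ImC (cval y) ^+ 2) -
      2 * (ReC (cval y) * ReC z + ImC (cval y) * ImC z)); first by rewrite !ReImE; ring.
    by rewrite e1 e2; ring.
  rewrite !ReImE; ring.
have iP : (@arclength R).-integrable setT
    (EFin \o (fun y => poisson z (mkC r 0 * cval y))).
  have [mP [M PM]] : @bmeas _ (circle R) R (fun y => ReC (F (cval y))).
    by apply: ccont_bmeas; apply: ccont_ReC => w w1; apply: dF; rewrite w1.
  exact: (bounded_integrable arclength_lty mP PM).
have iG : (@arclength R).-integrable setT (EFin \o (fun y => ReC (G (cval y)))).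
  have [mP [M PM]] : @bmeas _ (circle R) R (fun y => ReC (G (cval y))).
    by apply: ccont_bmeas; apply: ccont_ReC => w w1; apply: dG; rewrite w1.
  exact: (bounded_integrable arclength_lty mP PM).
under eq_Rintegral do rewrite E.
rewrite RintegralD//; [|exact: integrableRZl|exact: integrableRZl].
rewrite !RintegralZl// I1 (mean_value dG) G0; ring.
Qed.

(** For a Lipschitz function the error is controlled by the first moment of the kernel, and
    [x <= d + x ^+ 2 / d] reduces that to the mass and the second moment. The rate is explicit and
    uniform in [z]. *)
Lemma poisson_approx (psi : circle R -> R) (z : circle R) (L r d : R) :
  ccont psi -> (forall y, `|psi y - psi z| <= L * cmod (cval y - cval z)) ->
  0 <= r < 1 -> 0 < d ->
  `|\int[@arclength R]_y (poisson (cval z) (mkC r 0 * cval y) * psi y) - 2 * pi * psi z|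
   <= 2 * pi * (L * (d + (2 - 2 * r) / d)).
Proof.
move=> cpsi Hpsi r01 d0; have z1 := cmod_cval z.
have [I1 I2] := Rintegral_poisson_approx z1 r01.
have /andP[r0 r1] := r01.
set P := fun y : circle R => poisson (cval z) (mkC r 0 * cval y).
have cP : ccont P.
  apply: (@ccont_ReC R (fun w => herglotz (cval z) (mkC r 0 * w))) => w w1.
  have dn : cval z - mkC r 0 * w != 0.
    by rewrite circleB_neq0// cmodM cmod_mk0 ger0_norm// w1 mulr1.
  apply: differentiableM.
    by apply: differentiableD => //; apply: differentiableM.
  apply: differentiableV; last exact: dn.
  by apply: differentiableB => //; apply: differentiableM.
have cN : ccont (fun y : circle R => cmod (cval y - cval z) ^+ 2).
  have -> : (fun y : circle R => cmod (cval y - cval z) ^+ 2) =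
     (fun y => ReC (cval y - cval z) * ReC (cval y - cval z) +
               ImC (cval y - cval z) * ImC (cval y - cval z)).
    by apply/funext => y; rewrite cmod_sqr !expr2.
  have c1 : ccont (fun y : circle R => ReC (cval y - cval z)).
    by apply: (@ccont_ReC R (fun w => w - cval z)) => w _; apply: differentiableB.
  have c2 : ccont (fun y : circle R => ImC (cval y - cval z)).
    by apply: (@ccont_ImC R (fun w => w - cval z)) => w _; apply: differentiableB.
  by apply: ccontD; apply: ccontM.
have int K : ccont K -> (@arclength R).-integrable setT (EFin \o K).
  by move=> /ccont_bmeas[mK [M KM]]; exact: (bounded_integrable arclength_lty mK KM).
have P0 y : 0 <= P y.
  by apply: poisson_ge0 => //; rewrite cmodM cmod_mk0 cmod_cval mulr1 ger0_norm.
have L0 : 0 <= L.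
  have [y yz] : exists y : circle R, 0 < cmod (cval y - cval z).
    have [|ny] := pselect (exists y : circle R, cval y != cval z).
      by move=> [y yz]; exists y; rewrite cmod_gt0 subr_eq0.
    have e t : cval (cis t) = cval z by apply/eqP/negPn/negP => h; apply: ny; exists (cis t).
    have := etrans (e 0) (esym (e pi)) => /(congr1 (@ReC R)).
    by rewrite /= cos0 cospi => /eqP; rewrite -subr_eq0 opprK gt_eqF.
  by have := le_trans (normr_ge0 _) (Hpsi y); rewrite pmulr_lge0.
have -> : \int[@arclength R]_y (P y * psi y) - 2 * pi * psi z =
   \int[@arclength R]_y (P y * (psi y - psi z)).
  rewrite -I1 -RintegralZr//; last by apply: int.
  rewrite -RintegralB//; last 2 first.
  - by apply: int; apply: ccontM.
  - by apply: int; apply: ccontM => //; exact: ccont_cst.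
  by apply: eq_Rintegral => y _; rewrite mulrBr.
have iPp : (@arclength R).-integrable setT (EFin \o (fun y => P y * (psi y - psi z))).
  apply: int; apply: ccontM => //.
  by apply: (ccontD cpsi); exact: ccont_cst.
apply: le_trans (le_normr_Rintegral _ _) _ => //.
have -> : 2 * pi * (L * (d + (2 - 2 * r) / d)) = \int[@arclength R]_y
   (L * d * P y + L / d * (P y * cmod (cval y - cval z) ^+ 2)).
  rewrite RintegralD//; last 2 first.
  - by apply: int; apply: ccontZ.
  - by apply: int; apply: ccontZ; apply: ccontM.
  rewrite !RintegralZl//; [|by apply: int; apply: ccontM|by apply: int].
  by rewrite I1 I2; field; rewrite gt_eqF.
apply: le_Rintegral => //.
- exact: (integrable_norm iPp).
- by apply: int; apply: ccontD; apply: ccontZ => //; apply: ccontM.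
- move=> y _; rewrite normrM (ger0_norm (P0 y)).
  have := Hpsi y; set x := cmod _ => Hy.
  have x0 : 0 <= x by exact: cmod_ge0.
  have xd : x <= d + x ^+ 2 / d.
    rewrite -(@ler_pM2r _ d)// mulrDl mulfVK ?gt_eqF//.
    by have := sqr_ge0 (d - x); have := mulr_ge0 x0 (ltW d0); nra.
  apply: (@le_trans _ _ (P y * (L * (d + x ^+ 2 / d)))).
    by rewrite ler_wpM2l// (le_trans Hy)// ler_wpM2l.
  by apply: eq_ler; field; rewrite gt_eqF.
Qed.

End poisson_kernel.

Section fubini.
Context d1 d2 (T1 : measurableType d1) (T2 : measurableType d2) (R : realType).
Context (m1 : {finite_measure set T1 -> \bar R}) (m2 : {finite_measure set T2 -> \bar R}).

Lemma product_integrable_bounded (k : T1 * T2 -> R) (f : T1 -> R) (M : R) :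
  measurable_fun setT k -> (forall x, `|k x| <= M) ->
  m1.-integrable setT (EFin \o f) ->
  (m1 \x m2)%E.-integrable setT (fun x => (k x * f x.1)%:E).
Proof.
move=> mk kM0 intf.
have kM x : `|k x| <= `|M| by apply: le_trans (kM0 x) (ler_norm _).
have mf : measurable_fun setT f by case/integrableP: intf => /measurable_EFinP.
have mk1 x : measurable_fun setT (fun y => k (x, y)) by exact: measurableT_comp.
have mk2 y : measurable_fun setT (fun x => k (x, y)) by exact: measurableT_comp.
pose F (x : T1 * T2) := (k x * f x.1)%:E.
have mF : measurable_fun setT F.
  apply/measurable_EFinP; apply: measurable_funM => //.
  by apply: measurableT_comp => //; exact: measurable_fst.
have m1T : (m1 setT < +oo)%E by rewrite ltey_eq fin_num_measure.
have m2T : (m2 setT < +oo)%E by rewrite ltey_eq fin_num_measure.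
have ik x : m2.-integrable setT (EFin \o (fun y => k (x, y))).
  by apply: (bounded_integrable (M := M)) => //; exact: measurableT_comp.
apply/(integrable12ltyP _ _ mF) => /=.
  apply: (@le_lt_trans _ _ (\int[m1]_x ((`|M| * fine (m2 setT)) * `|f x|)%:E)%E).
    apply: ge0_le_integral => //=.
    - by move=> x _; apply: integral_ge0.
    - apply: (measurable_fun_fubini_tonelli_F (abse \o F)).
        exact: measurableT_comp.
      by move=> x; exact: abse_ge0.
    - by apply/measurable_EFinP; apply: measurable_funM => //; exact: measurableT_comp.
    - move=> x _.
      apply: (@le_trans _ _ (\int[m2]_y (`|M| * `|f x|)%:E)%E).
        apply: ge0_le_integral => //=.
        + apply/measurable_EFinP; apply: measurableT_comp => //.
          by apply: measurable_funM => //; exact: mk1.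
        + by move=> y _; rewrite lee_fin normrM ler_wpM2r.
      rewrite integral_cst//= -(@fineK _ (m2 setT)) ?fin_num_measure// -EFinM lee_fin.
      by apply: eq_ler; rewrite mulrAC.
  have /integrableP[_] := integrableRZl (`|M| * fine (m2 setT)) (integrable_norm intf).
  apply: le_lt_trans; rewrite le_eqVlt; apply/orP; left; apply/eqP.
  apply: eq_integral => x _ /=.
  by congr EFin; rewrite [RHS]ger0_norm// !mulr_ge0// fine_ge0.
Qed.

Lemma Rintegral_Fubini_bounded (k : T1 * T2 -> R) (f : T1 -> R) (M : R) :
  measurable_fun setT k -> (forall x, `|k x| <= M) ->
  m1.-integrable setT (EFin \o f) ->
  \int[m1]_x ((\int[m2]_y k (x, y)) * f x) = \int[m2]_y (\int[m1]_x (k (x, y) * f x)).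
Proof.
move=> mk kM intf; have intF := product_integrable_bounded mk kM intf.
have mk1 x : measurable_fun setT (fun y => k (x, y)) by exact: measurableT_comp.
have mk2 y : measurable_fun setT (fun x => k (x, y)) by exact: measurableT_comp.
have m2T : (m2 setT < +oo)%E by rewrite ltey_eq fin_num_measure.
have ik x : m2.-integrable setT (EFin \o (fun y => k (x, y))).
  by apply: (bounded_integrable (M := M)).
have E := Fubini intF.
rewrite /Rintegral; congr fine.
transitivity (\int[m1]_x \int[m2]_y (k (x, y) * f x)%:E)%E.
  apply: eq_integral => x _.
  transitivity ((\int[m2]_y (k (x, y) * f x))%:E).
    by rewrite RintegralZr.
  rewrite /Rintegral fineK//; apply: integrable_fin_num => //.
  apply: (eq_integrable measurableT (EFin \o (fun y => f x * k (x, y)))).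
    by move=> y _ /=; rewrite mulrC.
  exact: integrableRZl (ik x).
rewrite [LHS]E; apply: eq_integral => y _.
rewrite /Rintegral fineK//; apply: integrable_fin_num => //.
by apply: (integrable_bounded_mul (M := M)).
Qed.

Lemma measurable_Rintegral (k : T1 * T2 -> R) (M : R) :
  measurable_fun setT k -> (forall x, `|k x| <= M) ->
  measurable_fun setT (fun x => \int[m2]_y k (x, y)).
Proof.
move=> mk kM; have m1T : (m1 setT < +oo)%E by rewrite ltey_eq fin_num_measure.
have := measurable_fubini_F (product_integrable_bounded mk kM (integrable_cst1 m1T)).
move=> /(measurableT_comp (@fine_measurable R _ measurableT)).
apply: eq_measurable_fun => x _ /=; rewrite /fubini_F /Rintegral; congr fine.
by apply: eq_integral => y _; rewrite mulr1.
Qed.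

Lemma integrable_Rintegral (k : T1 * T2 -> R) (f : T1 -> R) (M : R) :
  measurable_fun setT k -> (forall x, `|k x| <= M) ->
  m1.-integrable setT (EFin \o f) ->
  m2.-integrable setT (EFin \o (fun y => \int[m1]_x (k (x, y) * f x))).
Proof.
move=> mk kM intf; have intF := product_integrable_bounded mk kM intf.
have mk2 y : measurable_fun setT (fun x => k (x, y)) by exact: measurableT_comp.
have mf : measurable_fun setT f by case/integrableP: intf => /measurable_EFinP.
have ikf y : m1.-integrable setT (EFin \o (fun x => k (x, y) * f x)).
  by apply: (integrable_bounded_mul (M := M)).
have mG : measurable_fun setT (fun y => \int[m1]_x (k (x, y) * f x)).
  apply/measurable_EFinP.
  have := measurable_fubini_G intF; apply: eq_measurable_fun => y _ /=.
  by rewrite /fubini_G /Rintegral fineK//; exact: integrable_fin_num (ikf y).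
apply/integrableP; split; first exact/measurable_EFinP.
have mkf : measurable_fun setT (fun x => (k x * f x.1)%:E).
  by case/integrableP: intF.
apply: le_lt_trans ((integrable21ltyP _ _ mkf).1 intF).
apply: ge0_le_integral => //=.
- by apply/measurable_EFinP; exact: measurableT_comp.
- apply: (measurable_fun_fubini_tonelli_G (abse \o (fun x => (k x * f x.1)%:E))).
    exact: measurableT_comp.
  by move=> x; exact: abse_ge0.
- move=> y _; rewrite -[X in (X <= _)%E]/(`|\int[m1]_x (k (x, y) * f x)|%:E).
  rewrite EFin_normr_Rintegral//; apply: le_abse_integral => //.
  by apply/measurable_EFinP; apply: measurable_funM.
Qed.

End fubini.

Section arclength_finite.
Context {R : realType}.

(* [arclength] with a finite-measure structure, as required by Fubini. *)
Definition farclength (A : set (circle R)) : \bar R := @arclength R A.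

Let farclength0 : farclength set0 = 0%E.
Proof. exact: measure0. Qed.
Let farclength_ge0 A : (0 <= farclength A)%E.
Proof. exact: measure_ge0. Qed.
Let farclength_sigma_additive : semi_sigma_additive farclength.
Proof. exact: measure_semi_sigma_additive. Qed.

HB.instance Definition _ := isMeasure.Build _ _ _ farclength
  farclength0 farclength_ge0 farclength_sigma_additive.

Let farclength_fin : fin_num_fun farclength.
Proof. exact/lty_fin_num_fun/arclength_lty. Qed.

HB.instance Definition _ := Measure_isFinite.Build _ _ _ farclength farclength_fin.

Lemma Rintegral_farclength (D : set (circle R)) (f : circle R -> R) :
  \int[farclength]_(x in D) f x = \int[@arclength R]_(x in D) f x.
Proof. by congr fine; exact: eq_measure_integral. Qed.

Lemma integrable_farclength (D : set (circle R)) (f : circle R -> \bar R) :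
  (@arclength R).-integrable D f -> farclength.-integrable D f.
Proof.
by move=> /integrableP[mf foo]; apply/integrableP.
Qed.

End arclength_finite.

Section poisson_positivity.
Context {R : realType}.
Notation L := (@farclength R).

Lemma measurable_poisson2 (r : R) : 0 <= r < 1 ->
  measurable_fun setT
    (fun x : circle R * circle R => poisson (cval x.1) (mkC r 0 * cval x.2)).
Proof.
move=> /andP[r0 r1].
pose D (x : circle R * circle R) : R := 1 + r ^+ 2 -
  2 * r * (ReC (cval x.1) * ReC (cval x.2) + ImC (cval x.1) * ImC (cval x.2)).
have rc (y : circle R) : cmod (mkC r 0 * cval y) = r.
  by rewrite cmodM cmod_mk0 cmod_cval mulr1 ger0_norm.
have DE x : cmod (cval x.1 - mkC r 0 * cval x.2) ^+ 2 = D x.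
  have e1 := cmod_sqr (cval x.1); have e2 := cmod_sqr (cval x.2).
  rewrite cmod_cval expr1n in e1; rewrite cmod_cval expr1n in e2.
  have -> : D x = (ReC (cval x.1) ^+ 2 + ImC (cval x.1) ^+ 2) +
    r ^+ 2 * (ReC (cval x.2) ^+ 2 + ImC (cval x.2) ^+ 2) -
    2 * r * (ReC (cval x.1) * ReC (cval x.2) + ImC (cval x.1) * ImC (cval x.2)).
    by rewrite -e1 -e2 mulr1.
  by rewrite cmod_sqr !ReImE; ring.
have D0 x : 0 < D x.
  by rewrite -DE exprn_gt0// cmod_gt0 circleB_neq0 ?cmod_cval// rc.
(* The squared distance is a positive polynomial in the coordinates; writing its inverse as
   [expR (- ln _)] makes measurability a matter of composition. *)
have -> : (fun x : circle R * circle R => poisson (cval x.1) (mkC r 0 * cval x.2)) =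
   (fun x => (1 - r ^+ 2) * expR (- ln (D x))).
  apply/funext => x; rewrite poissonE ?cmod_cval// rc DE expRN lnK//.
  by rewrite posrE.
have m1 : measurable_fun setT (fun x : circle R * circle R => ReC (cval x.1)).
  by apply: (measurableT_comp (@measurable_ReC_cval R)); exact: measurable_fst.
have m2 : measurable_fun setT (fun x : circle R * circle R => ReC (cval x.2)).
  by apply: (measurableT_comp (@measurable_ReC_cval R)); exact: measurable_snd.
have m3 : measurable_fun setT (fun x : circle R * circle R => ImC (cval x.1)).
  by apply: (measurableT_comp (@measurable_ImC_cval R)); exact: measurable_fst.
have m4 : measurable_fun setT (fun x : circle R * circle R => ImC (cval x.2)).
  by apply: (measurableT_comp (@measurable_ImC_cval R)); exact: measurable_snd.
apply: measurable_funM => //; apply: measurableT_comp => //.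
apply: measurable_funN; apply: measurableT_comp; first exact: measurable_ln.
apply: measurable_funB => //; apply: measurable_funM => //.
by apply: measurable_funD; apply: measurable_funM.
Qed.

Context (nu : {finite_measure set (circle R) -> \bar R}).
Context (u w : circle R -> R).
Context (iu : (@arclength R).-integrable setT (EFin \o u)).
Context (iw : nu.-integrable setT (EFin \o w)).
Context (neg : forall l, 0 < cmod l -> cmod l < 1 ->
  \int[@arclength R]_z (poisson (cval z) l * u z) +
  \int[nu]_z (poisson (cval z) l * w z) <= 0).

Lemma poisson_average_integrable (m : {finite_measure set (circle R) -> \bar R}) f psi (r : R) :
  m.-integrable setT (EFin \o f) -> ccont psi -> 0 <= r < 1 ->
  (@arclength R).-integrable setT (EFin \o (fun y =>
     psi y * \int[m]_z (poisson (cval z) (mkC r 0 * cval y) * f z))).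
Proof.
move=> intf cpsi r01; have /andP[r0 r1] := r01.
have [mpsi [M psiM]] := ccont_bmeas cpsi.
apply: (integrable_bounded_mul (M := M)) => //.
have rc (y : circle R) : cmod (mkC r 0 * cval y) = r.
  by rewrite cmodM cmod_mk0 cmod_cval mulr1 ger0_norm.
apply: (@integrable_Rintegral _ _ _ _ R m L _ f ((1 + r) / (1 - r)) (measurable_poisson2 r01)) => //.
move=> x; rewrite ger0_norm ?poisson_ge0 ?cmod_cval ?rc//.
by have := poisson_bounds (cmod_cval x.1) (eq_ler (rc x.2)) r1 => /andP[].
Qed.

(** Fubini lets the Poisson kernel act either on the test function or on the measure. In the second
    reading it is evaluated at points of modulus [r], where the hypothesis [neg] can be used. *)
Lemma poisson_average (m : {finite_measure set (circle R) -> \bar R}) f psi (r : R) :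
  m.-integrable setT (EFin \o f) -> ccont psi -> 0 <= r < 1 ->
  \int[m]_z ((\int[@arclength R]_y (poisson (cval z) (mkC r 0 * cval y) * psi y)) * f z)
  = \int[@arclength R]_y
     (psi y * \int[m]_z (poisson (cval z) (mkC r 0 * cval y) * f z)).
Proof.
move=> intf cpsi r01; have /andP[r0 r1] := r01.
have [mpsi [M psiM]] := ccont_bmeas cpsi.
pose k (x : circle R * circle R) := poisson (cval x.1) (mkC r 0 * cval x.2) * psi x.2.
have mk : measurable_fun setT k.
  apply: measurable_funM; first exact: measurable_poisson2.
  by apply: measurableT_comp => //; exact: measurable_snd.
have rc (y : circle R) : cmod (mkC r 0 * cval y) = r.
  by rewrite cmodM cmod_mk0 cmod_cval mulr1 ger0_norm.
have Pb (z y : circle R) : 0 <= poisson (cval z) (mkC r 0 * cval y) <= (1 + r) / (1 - r).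
  rewrite poisson_ge0 ?cmod_cval ?rc//=.
  by have := poisson_bounds (cmod_cval z) (eq_ler (rc y)) r1 => /andP[].
have kM x : `|k x| <= (1 + r) / (1 - r) * M.
  rewrite /k normrM; have /andP[p0 p1] := Pb x.1 x.2.
  by rewrite (ger0_norm p0) ler_pM.
have := @Rintegral_Fubini_bounded _ _ _ _ R m L k f _ mk kM intf.
rewrite (Rintegral_farclength setT (fun y => \int[m]_x (k (x, y) * f x))) => E.
transitivity (\int[m]_x (\int[L]_y k (x, y) * f x)).
  by apply: eq_Rintegral => z _; rewrite Rintegral_farclength.
rewrite E; apply: eq_Rintegral => y _; rewrite -RintegralZl//.
  by apply: eq_Rintegral => z _; rewrite /k /= mulrA [psi y * _]mulrC.
apply: (integrable_bounded_mul (M := (1 + r) / (1 - r)) intf).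
  have y1 : cmod (mkC r 0 * cval y) < 1 by rewrite rc.
  by have [] := ccont_bmeas (ccont_poisson y1).
by move=> z; have /andP[p0 p1] := Pb z y; rewrite ger0_norm.
Qed.

(** The Poisson average [A] of [psi] is uniformly close to [2 * pi * psi]. Paired with [u] and [w]
    it is an average, with nonnegative weights, of the Poisson integrals that [neg] makes
    nonpositive. *)
Lemma lipschitz_negative (psi : circle R -> R) (c : R) :
  ccont psi -> (forall y, 0 <= psi y) ->
  (forall y z, `|psi y - psi z| <= c * cmod (cval y - cval z)) ->
  \int[@arclength R]_z (psi z * u z) + \int[nu]_z (psi z * w z) <= 0.
Proof.
move=> cpsi psi0 Hpsi.
set X := _ + _.
set S := \int[L]_z `|u z| + \int[nu]_z `|w z|.
have S0 : 0 <= S by rewrite addr_ge0// Rintegral_ge0.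
have c0 : 0 <= `|c| by [].
have Hpsi' y z : `|psi y - psi z| <= `|c| * cmod (cval y - cval z).
  apply: le_trans (Hpsi y z) _; rewrite ler_wpM2r ?cmod_ge0 ?ler_norm//.
have bpsi := ccont_bmeas cpsi; have [mpsi [M psiM]] := bpsi.
have pi0 := pi_gt0 R.
have iuL : L.-integrable setT (EFin \o u) by exact: integrable_farclength.
have key e : 0 < e -> X <= `|c| * (2 * e) * S.
  (* The first entry keeps [r] away from [0], a point excluded in [neg]; the second gives
     [(2 - 2 * r) / e <= e]. *)
  move=> e0; pose r := Num.max (1 / 2) (1 - e ^+ 2 / 2).
  have e20 : 0 < e ^+ 2 / 2 by rewrite divr_gt0// exprn_gt0.
  have r12 : 1 / 2 <= r by rewrite le_max lexx.
  have r1 : r < 1 by rewrite gt_max; apply/andP; split; lra.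
  have r0 : 0 < r by lra.
  have r01 : 0 <= r < 1 by rewrite ltW.
  have re : 1 - e ^+ 2 / 2 <= r by rewrite le_max lexx orbT.
  have eta : e + (2 - 2 * r) / e <= 2 * e.
    have : (2 - 2 * r) / e <= e by rewrite ler_pdivrMr// -expr2; lra.
    lra.
  pose A z := \int[@arclength R]_y (poisson (cval z) (mkC r 0 * cval y) * psi y).
  pose E z := A z - 2 * pi * psi z.
  have EM z : `|E z| <= 2 * pi * (`|c| * (2 * e)).
    apply: le_trans (poisson_approx cpsi (Hpsi' ^~ z) r01 e0) _.
    by rewrite !ler_wpM2l ?mulr_ge0 ?(ltW pi0).
  have mA : measurable_fun setT A.
    have -> : A = fun z => \int[L]_y (poisson (cval z) (mkC r 0 * cval y) * psi y).
      by apply/funext => z; rewrite Rintegral_farclength.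
    apply: (@measurable_Rintegral _ _ _ _ R L L
      (fun x => poisson (cval x.1) (mkC r 0 * cval x.2) * psi x.2) ((1 + r) / (1 - r) * M)).
      apply: measurable_funM; first exact: measurable_poisson2.
      by apply: measurableT_comp => //; exact: measurable_snd.
    have rc (y : circle R) : cmod (mkC r 0 * cval y) = r.
      by rewrite cmodM cmod_mk0 cmod_cval mulr1 gtr0_norm.
    move=> x; rewrite normrM ler_pM// ger0_norm ?poisson_ge0 ?cmod_cval ?rc//.
    by have := poisson_bounds (cmod_cval x.1) (eq_ler (rc x.2)) r1 => /andP[].
  have bE : bmeas E.
    split; last by exists (2 * pi * (`|c| * (2 * e))).
    by apply: measurable_funB => //; apply: measurable_funM.
  have bA : bmeas A.
    split => //; exists (2 * pi * (`|c| * (2 * e)) + 2 * pi * M) => z.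
    have -> : A z = E z + 2 * pi * psi z by rewrite /E subrK.
    apply: le_trans (ler_normD _ _) _; rewrite lerD// normrM.
    by rewrite ger0_norm ?mulr_ge0 ?(ltW pi0)// ler_wpM2l// mulr_ge0// ltW.
  have split_int (m : {finite_measure set (circle R) -> \bar R}) f :
      m.-integrable setT (EFin \o f) -> 2 * pi * \int[m]_z (psi z * f z) <=
      \int[m]_z (A z * f z) + 2 * pi * (`|c| * (2 * e)) * \int[m]_z `|f z|.
    move=> intf; have ipf := bmeas_integrable_mul bpsi intf.
    rewrite -RintegralZl//.
    have -> : \int[m]_z (2 * pi * (psi z * f z)) = \int[m]_z ((1 * A z + (-1) * E z) * f z).
      by apply: eq_Rintegral => z _; rewrite /E; ring.
    rewrite Rintegral_comb_mul//.
    have := Rintegral_mul_bound intf bE EM; rewrite ler_norml => /andP[h _].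
    rewrite mul1r mulN1r lerD2l lerNl (mulrC _ (Rintegral _ _ _)).
    exact: h.
  have h1 := split_int _ _ iuL; have h2 := split_int _ _ iw.
  have AU : \int[L]_z (A z * u z) + \int[nu]_z (A z * w z) <= 0.
    rewrite (poisson_average iuL cpsi r01) (poisson_average iw cpsi r01).
    rewrite -RintegralD//; last 2 first.
    - exact: poisson_average_integrable.
    - exact: poisson_average_integrable.
    rewrite -oppr_ge0 -[X in 0 <= - X]mul1r -mulNr.
    rewrite -RintegralZl//; last first.
      have := integrableD measurableT (poisson_average_integrable iuL cpsi r01)
        (poisson_average_integrable iw cpsi r01).
      by apply: eq_integrable.
    apply: Rintegral_ge0 => y _.
    rewrite -mulrDr mulN1r oppr_ge0 mulr_ge0_le0//.
    rewrite (Rintegral_farclength setT (fun z => poisson (cval z) (mkC r 0 * cval y) * u z)).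
    apply: neg; rewrite cmodM cmod_mk0 cmod_cval mulr1 gtr0_norm//.
  rewrite -(@ler_pM2l _ (2 * pi)) ?mulr_gt0// mulrDr.
  move: h1; rewrite (Rintegral_farclength setT (fun z => psi z * u z)) => h1.
  apply: le_trans (lerD h1 h2) _.
  rewrite addrACA -mulrDr -/S; by rewrite -[leRHS]add0r mulrA; apply: lerD => //; rewrite !mulrA.
apply/ler_addgt0Pl => e e0; rewrite addr0.
have d0 : 0 < (`|c| + 1) * 2 * (S + 1) by rewrite !mulr_gt0// ltr_wpDl.
apply: le_trans (key _ (divr_gt0 e0 d0)) _.
have -> : `|c| * (2 * (e / ((`|c| + 1) * 2 * (S + 1)))) * S =
  e * ((`|c| / (`|c| + 1)) * (S / (S + 1))).
  by field; rewrite !gt_eqF ?ltr_wpDl.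
have q (x : R) : 0 <= x -> 0 <= x / (x + 1) <= 1.
  by move=> x0; rewrite divr_ge0 ?addr_ge0//= ler_pdivrMr ?ltr_wpDl// mul1r lerDl.
have /andP[q1 q2] := q _ c0; have /andP[q3 q4] := q _ S0.
by rewrite ler_piMr ?(ltW e0)// mulr_ile1.
Qed.

End poisson_positivity.

(** * Inner regularity of finite measures on the circle *)

Section circle_distance.
Context {R : realType}.
Implicit Types (A F U : set (circle R)) (x y z : circle R).

(** The distance is the chordal one. For empty [A] the infimum is [0] by convention, whence the
    assumption [A !=set0] in the estimates below. *)
Definition cdist A z : R := inf [set cmod (cval z - cval y) | y in A].

Let has_inf_cdist A z : A !=set0 -> has_inf [set cmod (cval z - cval y) | y in A].
Proof.
move=> [y Ay]; split; first by exists (cmod (cval z - cval y)), y.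
by exists 0 => _ [t _ <-]; exact: cmod_ge0.
Qed.

Lemma cdist_ge0 A z : 0 <= cdist A z.
Proof.
have [[y Ay]|] := pselect (A !=set0).
  apply: lb_le_inf; first by exists (cmod (cval z - cval y)), y.
  by move=> _ [t _ <-]; exact: cmod_ge0.
move=> A0; rewrite /cdist (_ : [set _ | _ in _] = set0) ?inf0//.
by apply/seteqP; split => // r [y Ay _]; apply: A0; exists y.
Qed.

Lemma cdist_le A z y : A y -> cdist A z <= cmod (cval z - cval y).
Proof.
move=> Ay; apply: ge_inf; last by exists y.
by exists 0 => _ [t _ <-]; exact: cmod_ge0.
Qed.

Lemma cdist_le_add A z y : A !=set0 -> cdist A y <= cdist A z + cmod (cval y - cval z).
Proof.
move=> A0; rewrite -lerBlDr; apply: lb_le_inf; first by case: (has_inf_cdist z A0).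
move=> _ [t At <-]; rewrite lerBlDr; apply: le_trans (cdist_le y At) _.
apply: (le_trans _ (cmodD (cval z - cval t) (cval y - cval z))).
by apply: eq_ler; congr cmod; ring.
Qed.

Lemma cdist_lipschitz A z y : A !=set0 ->
  `|cdist A y - cdist A z| <= cmod (cval y - cval z).
Proof.
move=> A0; rewrite ler_norml.
have := cdist_le_add z y A0; have := cdist_le_add y z A0; rewrite (cmodB (cval z)).
by move=> h1 h2; apply/andP; split; lra.
Qed.

Lemma circle_nbhsP z U : nbhs (z : set_type (@unit_circle R)) U <->
  exists2 e : R, 0 < e & forall y, cmod (cval z - cval y) < e -> U y.
Proof.
split.
  move=> [W [[V oV <-] Vz VU]].
  have /nbhs_normP[_ /C_gt0P[e e0 ->] He] : nbhs (cval z) V by exact: open_nbhs_nbhs.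
  by exists e => // y zy; apply: VU; apply: He; rewrite /= lt_normC_mk.
move=> [e e0 He].
have := @continuous_cval R z; move=> /(_ (ball_ Num.norm (cval z) (mkC e 0))) H.
have /H : nbhs (cval z) (ball_ Num.norm (cval z) (mkC e 0)).
  by apply/nbhs_normP; exists (mkC e 0) => //=; rewrite mkC_gt0.
apply: (@filterS _ (nbhs (z : set_type (@unit_circle R))) (nbhs_filter _)).
by move=> y /=; rewrite lt_normC_mk; exact: He.
Qed.

Definition copen U := open (U : set (set_type (@unit_circle R))).
Definition cclosed F := closed (F : set (set_type (@unit_circle R))).

Lemma lipschitz_ccont (f : circle R -> R) (c : R) :
  (forall y z, `|f y - f z| <= c * cmod (cval y - cval z)) -> ccont f.
Proof.
move=> H z.
apply/(@cvgrPdist_lt R R _ (nbhs (z : set_type (@unit_circle R))) (nbhs_filter _)) => e e0.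
apply/circle_nbhsP; exists (e / (`|c| + 1)); first by rewrite divr_gt0// ltr_wpDl.
move=> y; rewrite ltr_pdivlMr ?ltr_wpDl// => h.
apply: le_lt_trans (H z y) _; apply: le_lt_trans h.
rewrite mulrC ler_wpM2l ?cmod_ge0//.
by apply: le_trans (ler_norm c) _; rewrite lerDl.
Qed.

Lemma ccont_cdist A : A !=set0 -> ccont (cdist A).
Proof.
move=> A0; apply: (@lipschitz_ccont _ 1) => y z.
by rewrite mul1r; exact: cdist_lipschitz.
Qed.

Lemma cdist_gt0 F z : cclosed F -> F !=set0 -> ~ F z -> 0 < cdist F z.
Proof.
move=> cF F0 Fz.
have /circle_nbhsP[e e0 He] : nbhs (z : set_type (@unit_circle R)) (~` F).
  by apply: open_nbhs_nbhs; split => //; exact: closed_openC.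
apply: (lt_le_trans e0); apply: lb_le_inf; first by case: (has_inf_cdist z F0).
by move=> _ [t Ft <-]; rewrite leNgt; apply/negP => /He.
Qed.

Lemma cdist0 F z : F z -> cdist F z = 0.
Proof.
move=> Fz; apply/eqP; rewrite eq_le cdist_ge0 andbT.
by have := cdist_le z Fz; rewrite subrr cmod0.
Qed.

Lemma cclosed_measurable F : cclosed F -> measurable F.
Proof.
move=> cF; rewrite -(setCK F); apply: measurableC; apply: circle_open_measurable.
exact: closed_openC.
Qed.

End circle_distance.

Section inner_regularity.
Context {R : realType}.
Context (m : {finite_measure set (circle R) -> \bar R}).
Implicit Types (A F U : set (circle R)).

Definition inner_regular A := forall e : R, 0 < e ->
  exists F, [/\ cclosed F, F `<=` A & (m (A `\` F) < e%:E)%E].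

Lemma inner_regular_open U : copen U -> inner_regular U.
Proof.
move=> oU e e0; have mU : measurable U by exact: circle_open_measurable.
have [[t Ut]|nU] := pselect ((~` U) !=set0); last first.
  exists U; split => //; last by rewrite setDv measure0 lte_fin.
  have -> : U = setT by apply/seteqP; split => // z _; apply: contrapT => h; apply: nU; exists z.
  exact: closedT.
pose F k := [set z | k.+1%:R^-1 <= cdist (~` U) z].
have cF k : cclosed (F k).
  have /continuous_closedP := ccont_cdist (ex_intro _ t Ut).
  by move=> /(_ [set x | k.+1%:R^-1 <= x]); apply; exact: closed_ge.
have mF k : measurable (F k) by exact: cclosed_measurable.
have FU k : F k `<=` U.
  move=> z Fz; apply: contrapT => Uz; move: Fz.
  by rewrite /F /= cdist0// leNgt invr_gt0 ltr0n.
have bF : \bigcap_k (U `\` F k) = set0.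
  apply/seteqP; split => // z H; have [Uz _] := H 0%N I.
  have d0 : 0 < cdist (~` U) z.
    by apply: cdist_gt0; [exact: open_closedC|exists t|move/(_ Uz)].
  have [k _ /ltW hk] : exists2 k, True & k.+1%:R^-1 < cdist (~` U) z.
    have [k hk] := ltr_add_invr d0; rewrite add0r in hk; by exists k.
  by have [_] := H k I; apply.
have mT : (m setT < +oo)%E by rewrite ltey_eq fin_num_measure.
have cv : m \o (fun k => U `\` F k) @ \oo --> m (\bigcap_k (U `\` F k)).
  apply: nonincreasing_cvg_mu.
  - by apply: le_lt_trans mT; rewrite le_measure ?inE//; exact: measurableD.
  - by move=> k; exact: measurableD.
  - by rewrite bF.
  - move=> i j ij; apply/subsetPset; apply: setDS => z; rewrite /F /=.
    by apply: le_trans; rewrite lef_pV2 ?posrE ?ltr0n// ler_nat ltnS.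
rewrite bF measure0 in cv.
have := cv [set x | (x < e%:E)%E]; case.
  by apply: open_nbhs_nbhs; split; [exact: open_ereal_lt_ereal|rewrite /= lte_fin].
move=> k _ /(_ k (leqnn k)) /= hk.
by exists (F k); split.
Qed.

Lemma inner_regular_closed F : cclosed F -> inner_regular F.
Proof. by move=> cF e e0; exists F; split => //; rewrite setDv measure0 lte_fin. Qed.

Lemma inner_regular_bigcap (A : nat -> set (circle R)) :
  (forall i, measurable (A i)) -> (forall i, inner_regular (A i)) ->
  inner_regular (\bigcap_i A i).
Proof.
move=> mA rA e e0.
have e2 i : 0 < e / 2 / (2 ^ i.+1)%:R by rewrite !divr_gt0// ltr0n expn_gt0.
pose F i := projT1 (cid (rA i _ (e2 i))).
have FP i : [/\ cclosed (F i), F i `<=` A i & (m (A i `\` F i) < (e / 2 / (2 ^ i.+1)%:R)%:E)%E].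
  by rewrite /F; case: (cid _).
have mF i : measurable (F i) by apply: cclosed_measurable; case: (FP i).
exists (\bigcap_i F i); split.
- by apply: closed_bigI => i _; case: (FP i).
- by move=> z Fz i _; have [_ FA _] := FP i; apply: FA; exact: Fz.
apply: (@le_lt_trans _ _ (e / 2)%:E); last by rewrite lte_fin; lra.
apply: le_trans (epsilon_trick0 xpredT _); last by rewrite divr_ge0// ltW.
apply: (@le_trans _ _ (\sum_(i <oo) m (A i `\` F i))%E).
  apply: measure_sigma_subadditive.
  - by move=> i; exact: measurableD.
  - by apply: measurableD; apply: bigcapT_measurable.
  - move=> z [Az /existsNP[i /not_implyP[_ Fz]]].
    by exists i => //; split => //; exact: Az.
apply: lee_nneseries => // i _.
by have [_ _ /ltW] := FP i.
Qed.

Lemma inner_regular_bigcup (A : nat -> set (circle R)) :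
  (forall i, measurable (A i)) -> (forall i, inner_regular (A i)) ->
  inner_regular (\bigcup_i A i).
Proof.
move=> mA rA e e0.
have e2 i : 0 < e / 4 / (2 ^ i.+1)%:R by rewrite !divr_gt0// ltr0n expn_gt0.
pose F i := projT1 (cid (rA i _ (e2 i))).
have FP i : [/\ cclosed (F i), F i `<=` A i & (m (A i `\` F i) < (e / 4 / (2 ^ i.+1)%:R)%:E)%E].
  by rewrite /F; case: (cid _).
have mF i : measurable (F i) by apply: cclosed_measurable; case: (FP i).
(* The union of all [F i] need not be closed, but finite unions are; continuity of [m] along
   decreasing sets accounts for the rest. *)
pose G n := \big[setU/set0]_(i < n) F i.
have mG n : measurable (G n) by apply: bigsetU_measurable.
have cG n : cclosed (G n).
  by apply: (@closed_bigsetU (set_type (@unit_circle R))) => i _; case: (FP i).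
have mbA : measurable (\bigcup_i A i) by exact: bigcupT_measurable.
have mbF : measurable (\bigcup_i F i) by exact: bigcupT_measurable.
have mT : (m setT < +oo)%E by rewrite ltey_eq fin_num_measure.
have h1 : (m (\bigcup_i A i `\` \bigcup_i F i) <= (e / 4)%:E)%E.
  apply: le_trans (epsilon_trick0 xpredT _); last by rewrite divr_ge0// ltW.
  apply: (@le_trans _ _ (\sum_(i <oo) m (A i `\` F i))%E).
    apply: measure_sigma_subadditive.
    - by move=> i; exact: measurableD.
    - exact: measurableD.
    - move=> z [[i _ Az] nF]; exists i => //; split => // Fz.
      by apply: nF; exists i.
  apply: lee_nneseries => // i _.
  by have [_ _ /ltW] := FP i.
have cv : m \o (fun k => \bigcup_i A i `\` G k) @ \oo --> m (\bigcap_k (\bigcup_i A i `\` G k)).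
  apply: nonincreasing_cvg_mu.
  - by apply: le_lt_trans mT; rewrite le_measure ?inE//; exact: measurableD.
  - by move=> k; exact: measurableD.
  - by apply: bigcapT_measurable => k; exact: measurableD.
  - move=> i j ij; apply/subsetPset; apply: setDS; rewrite /G.
    by rewrite -!bigcup_mkord => z [k /= ki Fz]; exists k => //=; exact: leq_trans ki ij.
have E : \bigcap_k (\bigcup_i A i `\` G k) = \bigcup_i A i `\` \bigcup_i F i.
  apply/seteqP; split => z.
    move=> H; split; first by have [] := H 0%N I.
    move=> [i _ Fz]; have [_] := H i.+1 I; apply.
    by rewrite /G -bigcup_mkord; exists i => //=.
  by move=> [Az nF] k _; split => //; rewrite /G -bigcup_mkord => -[i _ Fz]; apply: nF; exists i.
rewrite E in cv; have := cv [set x | (x < e%:E)%E]; case.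
  apply: open_nbhs_nbhs; split; first exact: open_ereal_lt_ereal.
  by rewrite /=; apply: le_lt_trans h1 _; rewrite lte_fin; lra.
move=> k _ /(_ k (leqnn k)) /= hk.
exists (G k); split => //.
rewrite /G -bigcup_mkord => z [i _ Fz]; exists i => //.
by have [_ + _] := FP i; apply.
Qed.

Theorem inner_regular_measurable A : measurable A -> inner_regular A.
Proof.
move=> mA.
suff : measurable A /\ (inner_regular A /\ inner_regular (~` A)) by case=> _ [].
(* The property is stated for a set together with its complement, since inner regularity by itself
   does not pass to complements. *)
pose C A := measurable A /\ (inner_regular A /\ inner_regular (~` A)).
suff : C A by [].
move: A mA; apply: smallest_sub; last first.
  move=> U oU; split; first exact: circle_open_measurable.
  split; first exact: inner_regular_open.
  by apply: inner_regular_closed; exact: open_closedC.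
split.
- split; first exact: measurable0.
  split; first by apply: inner_regular_closed; exact: closed0.
  by rewrite setC0; apply: inner_regular_open; exact: openT.
- move=> A [mA [r1 r2]]; rewrite setTD; split; first exact: measurableC.
  by split => //; rewrite setCK.
- move=> F CF; split; first by apply: bigcupT_measurable => i; case: (CF i).
  split; first by apply: inner_regular_bigcup => i; case: (CF i) => // _ [].
  rewrite setC_bigcup; apply: inner_regular_bigcap => i; case: (CF i) => mF [] //.
  by move=> _ _; exact: measurableC.
Qed.

Lemma closed_subset_gt0 A : measurable A -> (0 < m A)%E ->
  exists F, [/\ cclosed F, F `<=` A & (0 < m F)%E].
Proof.
move=> mA mA0; have fA : m A \is a fin_num by exact: fin_num_measure.
have e0 : 0 < fine (m A) by rewrite fine_gt0// mA0 ltey_eq fA.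
have [F [cF FA mF]] := inner_regular_measurable mA e0.
exists F; split => //; rewrite lt_def measure_ge0 andbT; apply/eqP => F0.
have lt1 : (m A - m F < m A)%E.
  have AF : A `&` F = F.
    by apply/seteqP; split => [z []//|z Fz]; split => //; exact: FA.
  rewrite -{1}AF -measureD//; [|exact: cclosed_measurable|by rewrite ltey_eq fA].
  by rewrite -[ltRHS]fineK.
have F0' : m F = 0%E by exact: F0.
by move: lt1; rewrite F0' sube0 ltxx.
Qed.

End inner_regularity.

Section closed_sets.
Context {R : realType}.
Implicit Types (m : {finite_measure set (circle R) -> \bar R}).

(** Lipschitz functions that decrease, as [k] grows, to the indicator of a closed set [F]; they
    carry [lipschitz_negative] over to [F]. *)
Definition bump (F : set (circle R)) (k : nat) (z : circle R) : R :=
  Num.max 0 (1 - k%:R * cdist F z).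

Lemma bump_ge0 F k z : 0 <= bump F k z.
Proof. by rewrite /bump le_max lexx. Qed.

Lemma bump_le1 F k z : bump F k z <= 1.
Proof. by rewrite /bump ge_max ler01 /= gerBl mulr_ge0// cdist_ge0. Qed.

Lemma bump_lipschitz F k y z : F !=set0 ->
  `|bump F k y - bump F k z| <= k%:R * cmod (cval y - cval z).
Proof.
move=> F0; have := cdist_lipschitz z y F0; rewrite /bump.
set a := cdist F y; set b := cdist F z; set c := cmod _ => h.
have hk : `|k%:R * a - k%:R * b| <= k%:R * c.
  by rewrite -mulrBr normrM ger0_norm// ler_wpM2l.
move: hk; rewrite ler_norml => /andP[h1 h2].
have kc : 0 <= k%:R * c by rewrite mulr_ge0// cmod_ge0.
rewrite ler_norml !maxEle.
case: ifPn => p1; case: ifPn => p2; rewrite -?ltNge in p1 p2 *;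
  by apply/andP; split; lra.
Qed.

Lemma bump_cvg F z : cclosed F -> F !=set0 -> bump F ^~ z @ \oo --> (\1_F z : R).
Proof.
move=> cF F0; rewrite indicE; case: (boolP (z \in F)) => [/set_mem Fz|/negP Fz].
  apply: (@cvg_near_cst nat R); near=> k.
  by rewrite /bump cdist0// mulr0 subr0; apply/max_idPr; exact: ler01.
have d0 : 0 < cdist F z by apply: cdist_gt0 => // /mem_set.
apply: (@cvg_near_cst nat R); near=> k.
apply/max_idPl; rewrite lerBlDr add0r -ler_pdivrMr//.
near: k; exact: nbhs_infty_ger.
Unshelve. all: by end_near. Qed.

Lemma ccont_bump F k : F !=set0 -> ccont (bump F k).
Proof.
by move=> F0; apply: (@lipschitz_ccont _ _ k%:R) => y z; exact: bump_lipschitz.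
Qed.

Lemma Rintegral_bump_cvg m F f : cclosed F -> F !=set0 ->
  m.-integrable setT (EFin \o f) ->
  \int[m]_z (bump F k z * f z) @[k --> \oo] --> \int[m]_(z in F) f z.
Proof.
move=> cF F0 intf; have mF := cclosed_measurable cF.
rewrite -Rintegral_indic_mul//.
have b k : bmeas (bump F k) by apply: ccont_bmeas; exact: ccont_bump.
have i1 : m.-integrable setT (EFin \o (fun z => \1_F z * f z)).
  by apply: bmeas_integrable_mul => //; exact: bmeas_indic.
apply: fine_cvg; rewrite /Rintegral fineK; last exact: integrable_fin_num i1.
apply: (@dominated_cvg _ _ _ m setT measurableT
  (fun k z => (bump F k z * f z)%:E) (fun z => (\1_F z * f z)%:E)
  (fun z => `|f z|%:E)) => //.
- by move=> k; have /integrableP[] := bmeas_integrable_mul (b k) intf.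
- move=> z _; apply: cvg_EFin; first by near=> k.
  apply: (@cvgM R); first exact: bump_cvg.
  exact: cvg_cst.
- exact: integrable_norm.
- move=> k z _ /=; rewrite lee_fin normrM ger0_norm ?bump_ge0//.
  by rewrite ler_piMl// bump_le1.
Unshelve. all: by end_near. Qed.

Lemma Rintegral_gt0 d (T : measurableType d) (mu : {measure set T -> \bar R}) F (f : T -> R) :
  measurable F -> mu.-integrable F (EFin \o f) -> (forall z, F z -> 0 < f z) ->
  (0 < mu F)%E -> 0 < \int[mu]_(z in F) f z.
Proof.
move=> mF intf f0 muF; rewrite lt_def Rintegral_ge0 ?andbT; last first.
  by move=> z /f0/ltW.
apply/eqP => I0; have [mf _] := integrableP _ _ _ intf.
have : (\int[mu]_(x in F) `|(f x)%:E| = 0)%E.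
  transitivity (\int[mu]_(x in F) (f x)%:E)%E.
    by apply: eq_integral => x /set_mem/f0/ltW h; rewrite gee0_abs.
  by rewrite -(fineK (integrable_fin_num mF intf)); congr EFin.
move/(ae_eq_integral_abs mu mF mf) => -[N [mN N0 subN]].
have : (mu F <= mu N)%E.
  rewrite le_measure ?inE// => z Fz; apply: subN => /= /(_ Fz) [] /eqP.
  by rewrite gt_eqF// f0.
by rewrite N0 leNgt muF.
Qed.

End closed_sets.

Section poisson_negative.
Context {R : realType}.
Context (nu : {finite_measure set (circle R) -> \bar R}).
Context (nu_sing : mutually_singular nu (@arclength R)).
Context (u w : circle R -> R).
Context (iu : (@arclength R).-integrable setT (EFin \o u)).
Context (iw : nu.-integrable setT (EFin \o w)).
Context (neg : forall l, 0 < cmod l -> cmod l < 1 ->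
  \int[@arclength R]_z (poisson (cval z) l * u z) +
  \int[nu]_z (poisson (cval z) l * w z) <= 0).

Lemma closed_negative F : cclosed F -> F !=set0 ->
  \int[@arclength R]_(z in F) u z + \int[nu]_(z in F) w z <= 0.
Proof.
move=> cF F0; have iuL := integrable_farclength iu.
have c1 := Rintegral_bump_cvg cF F0 iuL; have c2 := Rintegral_bump_cvg cF F0 iw.
have c : (\int[@farclength R]_z (bump F k z * u z) + \int[nu]_z (bump F k z * w z))
    @[k --> \oo] --> \int[@arclength R]_(z in F) u z + \int[nu]_(z in F) w z.
  by rewrite -Rintegral_farclength; apply: (@cvgD R R^o); [exact: c1|exact: c2].
rewrite -(cvg_lim _ c)//; apply: limr_le; first by apply/cvg_ex; eexists; exact: c.
near=> k; rewrite (Rintegral_farclength setT (fun z => bump F k z * u z)).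
apply: (lipschitz_negative iu iw neg (c := k%:R)).
- exact: ccont_bump.
- exact: bump_ge0.
- by move=> y z; exact: bump_lipschitz.
Unshelve. all: by end_near. Qed.

(** Singularity separates the two densities. A set where [u] is positive can be taken inside a
    [nu]-null set, one where [w] is positive inside a set of arc length zero; a closed subset of
    positive measure then contradicts [closed_negative]. *)
Theorem poisson_negative :
  {ae @arclength R, forall z, u z <= 0} /\ {ae nu, forall z, w z <= 0}.
Proof.
have [A [mA nuA LA]] := nu_sing.
have [mu _] := integrableP _ _ _ iu; have [mw _] := integrableP _ _ _ iw.
move/measurable_EFinP in mu; move/measurable_EFinP in mw.
have mpos (f : circle R -> R) : measurable_fun setT f -> measurable [set z | 0 < f z].
  move=> mf; have -> : [set z | 0 < f z] = ~` (setT `&` [set z | f z <= 0]).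
    by apply/seteqP; split => z /=; [move=> h [_]; rewrite leNgt h|
      move=> /not_andP[//|/negP]; rewrite -ltNge].
  by apply: measurableC; apply: (measurable_fun_le (f := f) (g := fun=> 0)).
split.
- pose B := [set z | 0 < u z] `&` A.
  have mB : measurable B by apply: measurableI => //; exact: mpos.
  have B0 : @arclength R B = 0%E.
    apply/eqP; rewrite eq_le measure_ge0 andbT leNgt; apply/negP => B0.
    have [F [cF FB F0]] := @closed_subset_gt0 R (@farclength R) B mB B0.
    have mF := cclosed_measurable cF.
    have Fn0 : F !=set0.
      apply/set0P/eqP => E; by move: F0; rewrite E measure0 ltxx.
    have nuF : nu F = 0%E.
      apply/eqP; rewrite eq_le measure_ge0 andbT -nuA le_measure ?inE// => z /FB[].
      by [].
    have := closed_negative cF Fn0.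
    rewrite (_ : \int[nu]_(z in F) w z = 0) ?addr0; last first.
      by rewrite /Rintegral null_set_integral//; exact: measurable_funTS (proj1 (integrableP _ _ _ iw)).
    rewrite leNgt => /negP; apply; apply: Rintegral_gt0 => //.
    + exact: integrableS iu.
    + by move=> z /FB[].
  exists (B `|` ~` A); split.
  + by apply: measurableU => //; exact: measurableC.
  + apply/eqP; rewrite eq_le measure_ge0 andbT.
    apply: le_trans (measureU2 _ mB (measurableC mA)) _.
    move/eqP: B0 LA; rewrite eq_le => /andP[B0 _] /eqP; rewrite eq_le => /andP[LA _].
    by rewrite -[leRHS]adde0; apply: leeD; [exact: B0|exact: LA].
  + move=> z /= /negP; rewrite -ltNge => uz.
    by have [Az|nAz] := pselect (A z); [left|right].
- pose B := [set z | 0 < w z] `&` ~` A.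
  have mB : measurable B by apply: measurableI; [exact: mpos|exact: measurableC].
  have B0 : nu B = 0%E.
    apply/eqP; rewrite eq_le measure_ge0 andbT leNgt; apply/negP => B0.
    have [F [cF FB F0]] := @closed_subset_gt0 R nu B mB B0.
    have mF := cclosed_measurable cF.
    have Fn0 : F !=set0.
      apply/set0P/eqP => E; by move: F0; rewrite E measure0 ltxx.
    have LF : @arclength R F = 0%E.
      apply/eqP; rewrite eq_le measure_ge0 andbT -LA le_measure ?inE//.
        exact: measurableC.
      by move=> z /FB[].
    have := closed_negative cF Fn0.
    rewrite (_ : \int[@arclength R]_(z in F) u z = 0) ?add0r; last first.
      by rewrite /Rintegral null_set_integral//; exact: measurable_funTS (proj1 (integrableP _ _ _ iu)).
    rewrite leNgt => /negP; apply; apply: Rintegral_gt0 => //.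
    + exact: integrableS iw.
    + by move=> z /FB[].
  exists (B `|` A); split.
  + exact: measurableU.
  + apply/eqP; rewrite eq_le measure_ge0 andbT.
    apply: le_trans (measureU2 _ mB mA) _.
    move/eqP: B0 nuA; rewrite eq_le => /andP[B0 _] /eqP; rewrite eq_le => /andP[nuA _].
    by rewrite -[leRHS]adde0; apply: leeD; [exact: B0|exact: nuA].
  + move=> z /= /negP; rewrite -ltNge => wz.
    by have [Az|nAz] := pselect (A z); [right|left].
Qed.

End poisson_negative.

(** * Convex geometry of tube bases *)

Section row_norm.
Context {K : numFieldType} {n : nat}.

Lemma coord_le_norm (x : 'rV[K]_n) i : `|x 0 i| <= `|x|.
Proof.
have -> : `|x| = mx_norm x by [].
rewrite mx_normE -[leLHS]nngE num_le.
exact: (le_bigmax _ (fun ij : 'I_1 * 'I_n => `|x ij.1 ij.2|%:nng) (0, i)).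
Qed.

Lemma row_norm_le (x : 'rV[K]_n) (e : K) : 0 <= e -> (forall i, `|x 0 i| <= e) -> `|x| <= e.
Proof.
move=> e0 H; have -> : `|x| = mx_norm x by [].
have [->//|/mx_norm_neq0[[i j] ->]] := eqVneq (mx_norm x) 0.
by rewrite /= (ord1 i).
Qed.

End row_norm.

Section inner_product.
Context {R : realType} {n : nat}.
Implicit Types (u v x y p q : 'rV[R]_n) (A : set 'rV[R]_n).

Lemma innerC u v : inner u v = inner v u.
Proof. by apply: eq_bigr => i _; rewrite mulrC. Qed.
Lemma innerDl u v w : inner (u + v) w = inner u w + inner v w.
Proof. by rewrite -big_split; apply: eq_bigr => i _; rewrite mxE mulrDl. Qed.
Lemma innerZl (a : R) u v : inner (a *: u) v = a * inner u v.
Proof. by rewrite /inner mulr_sumr; apply: eq_bigr => i _; rewrite mxE mulrA. Qed.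
Lemma innerNl u v : inner (- u) v = - inner u v.
Proof. by rewrite -scaleN1r innerZl mulN1r. Qed.
Lemma innerBl u v w : inner (u - v) w = inner u w - inner v w.
Proof. by rewrite innerDl innerNl. Qed.
Lemma innerDr u v w : inner u (v + w) = inner u v + inner u w.
Proof. by rewrite innerC innerDl !(innerC u). Qed.
Lemma innerZr (a : R) u v : inner u (a *: v) = a * inner u v.
Proof. by rewrite innerC innerZl innerC. Qed.
Lemma innerBr u v w : inner u (v - w) = inner u v - inner u w.
Proof. by rewrite innerC innerBl !(innerC u). Qed.
Lemma inner0l v : inner 0 v = 0.
Proof. by rewrite -(scale0r 0) innerZl mul0r. Qed.
Lemma inner_subZ u v (a : R) :
  inner (u - a *: v) (u - a *: v) = inner u u - 2 * (a * inner v u) + a * (a * inner v v).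
Proof. by rewrite innerBl !innerBr !innerZl !innerZr (innerC u v); ring. Qed.
Lemma inner_ge0 u : 0 <= inner u u.
Proof. by apply: sumr_ge0 => i _; rewrite -expr2 sqr_ge0. Qed.
Lemma inner_eq0 u : inner u u = 0 -> u = 0.
Proof.
move=> /eqP; rewrite psumr_eq0; last by move=> i _; rewrite -expr2 sqr_ge0.
move=> /allP H; apply/rowP => i; rewrite mxE; apply/eqP.
by have := H i (mem_index_enum i); rewrite -expr2 sqrf_eq0.
Qed.
Lemma inner_gt0 u : u != 0 -> 0 < inner u u.
Proof. by move=> u0; rewrite lt_def inner_ge0 andbT; apply: contra_neq u0 => /inner_eq0. Qed.

Lemma inner_le_norm u v : `|inner u v| <= n%:R * `|u| * `|v|.
Proof.
apply: le_trans (ler_norm_sum _ _ _) _.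
apply: (@le_trans _ _ (\sum_(i < n) `|u| * `|v|)).
  by apply: ler_sum => i _; rewrite normrM ler_pM// coord_le_norm.
by rewrite sumr_const card_ord -mulrA mulr_natl.
Qed.

Lemma norm_le_inner u : `|u| ^+ 2 <= inner u u.
Proof.
have [->|u0] := eqVneq `|u| 0; first by rewrite expr0n inner_ge0.
have [[i j] /= E] := mx_norm_neq0 (u0 : mx_norm u != 0).
rewrite [`|u|](_ : _ = `|u i j|)// (ord1 i) real_normK ?num_real//.
rewrite /inner (bigD1 j)//= -expr2 lerDl; apply: sumr_ge0 => k _.
by rewrite -expr2 sqr_ge0.
Qed.

Lemma closure_normP A x : closure A x <->
  forall e : R, 0 < e -> exists2 a, A a & `|x - a| <= e.
Proof.
split.
  move=> cA e e0; have [] := cA (ball_ Num.norm x e).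
    by apply: (@nbhs_le_nbhs_norm R 'rV[R]_n); exists e.
  by move=> a [Aa /ltW xa]; exists a.
move=> H U /nbhs_normP[e /= e0 He]; have [a Aa xa] := H _ (divr_gt0 e0 (ltr0Sn R 1)).
exists a; split => //; apply: He; rewrite /=; apply: le_lt_trans xa _.
by rewrite ltr_pdivrMr// ltr_pMr// ltr1n.
Qed.

Lemma open_normP A x : open A -> A x -> exists2 e : R, 0 < e &
  forall y, `|x - y| <= e -> A y.
Proof.
move=> oA Ax; have /nbhs_normP[e /= e0 He] : nbhs x A by exact: open_nbhs_nbhs.
exists (e / 2); first by rewrite divr_gt0.
move=> y xy; apply: He; rewrite /=; apply: le_lt_trans xy _.
by rewrite ltr_pdivrMr// ltr_pMr// ltr1n.
Qed.

Lemma inner_continuous v : continuous (fun x => inner x v).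
Proof.
move=> x; apply/(@cvgrPdist_le R R _ (nbhs x) (nbhs_filter x)) => e e0.
have M0 : 0 < n%:R * `|v| + 1 by rewrite ltr_wpDl// mulr_ge0.
apply: (@nbhs_le_nbhs_norm R 'rV[R]_n); exists (e / (n%:R * `|v| + 1)); first by rewrite /= divr_gt0.
move=> y; rewrite /= ltr_pdivlMr// => h.
rewrite -innerBl; apply: le_trans (inner_le_norm _ _) _; apply: le_trans (ltW h).
by rewrite mulrAC mulrC ler_wpM2l// lerDl.
Qed.

Definition convex_real A := forall x y (t : R), A x -> A y -> 0 <= t <= 1 ->
  A ((1 - t) *: x + t *: y).

(** The nearest point [p] exists because a sublevel set of the distance is compact. Minimality along
    the segment from [p] to [x], at a small parameter, gives the sign of the inner product. *)
Lemma projection A q : convex_real A -> A !=set0 -> ~ closure A q ->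
  exists2 p, closure A p & q - p != 0 /\ forall x, A x -> inner (x - p) (q - p) <= 0.
Proof.
move=> cA [a0 Aa0] nq; pose f x := inner (q - x) (q - x).
have cf : continuous f.
  have -> : f = fun x => \sum_(i < n) (q 0 i - x 0 i) * (q 0 i - x 0 i).
    by apply/funext => x; apply: eq_bigr => i _; rewrite !mxE.
  apply: continuous_big => [|i _ x]; first exact: add_continuous.
  have c1 : {for x, continuous (fun x : 'rV[R]_n => q 0 i - x 0 i)}.
    by apply: continuousB; [exact: cst_continuous|exact: coord_continuous].
  by apply: (cvgM c1 c1).
pose B := closure A `&` [set x | f x <= f a0].
have cB : compact B.
  apply: bounded_closed_compact.
    have b x : B x -> `|x| <= `|q| + Num.sqrt (f a0).
      move=> [_ /= fx]; have -> : x = q - (q - x) by rewrite opprB addrC subrK.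
      apply: le_trans (ler_normB _ _) _; rewrite lerD2l.
      rewrite -(@ler_sqr _ `|q - x|) ?nnegrE ?sqrtr_ge0// sqr_sqrtr ?inner_ge0//.
      exact: le_trans (norm_le_inner _) fx.
    exists (`|q| + Num.sqrt (f a0)); split; first exact: num_real.
    by move=> M hM x /b /le_trans; apply; exact: ltW.
  apply: closedI; first exact: closed_closure.
  by have /continuous_closedP/(_ [set y | y <= f a0]) := cf; apply; exact: closed_le.
have B0 : B !=set0.
  by exists a0; split; [exact: subset_closure|rewrite /= lexx].
have [p /set_mem[Ap fp] pmin] : exists2 c, c \in B & forall t, t \in B -> f c <= f t.
  by apply: EVT_min_rV => //; exact: continuous_subspaceT.
have pm x : closure A x -> f p <= f x.
  move=> Ax; have [fx|/ltW fx] := leP (f x) (f a0); last exact: le_trans fp fx.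
  by apply: pmin; exact: mem_set.
exists p => //; split.
  by apply/eqP => /subr0_eq E; apply: nq; rewrite E.
move=> x Ax; set w := q - p; set d := x - p.
have key t : 0 < t <= 1 -> 2 * inner d w <= t * inner d d.
  move=> /andP[t0 t1]; have : closure A ((1 - t) *: p + t *: x).
    apply/closure_normP => e e0; have [a Aa pa] := (closure_normP A p).1 Ap _ e0.
    exists ((1 - t) *: a + t *: x); first by apply: cA => //; rewrite (ltW t0).
    rewrite opprD addrACA subrr addr0 -scalerBr normrZ ger0_norm ?subr_ge0//.
    by rewrite -[leRHS]mul1r ler_pM ?subr_ge0// gerBl ltW.
  move=> /pm; rewrite /f.
  have -> : q - ((1 - t) *: p + t *: x) = w - t *: d.
    rewrite /w /d scalerBl scale1r scalerBr opprD opprD opprK -!addrA; congr (q + _).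
    by congr (- p + _); rewrite opprB addrC.
  rewrite -/w inner_subZ => h; rewrite -(ler_pM2l t0).
  have : 2 * (t * inner d w) <= t * (t * inner d d) by lra.
  lra.
rewrite leNgt; apply/negP => d0.
have dd : 0 < inner d d.
  apply: inner_gt0; apply/eqP => E; move: d0; rewrite E inner0l ltxx //.
pose t := Num.min 1 (inner d w / inner d d).
have t0 : 0 < t by rewrite lt_min ltr01 divr_gt0.
have t1 : t <= 1 by rewrite ge_min lexx.
have := key t; rewrite t0 t1 => /(_ isT).
have : t * inner d d <= inner d w by rewrite -ler_pdivlMr// ge_min lexx orbT.
by move=> h1 h2; lra.
Qed.

Lemma rational_dense x (e : R) : 0 < e ->
  exists q : 'rV[rat]_n, `|x - map_mx ratr q| <= e.
Proof.
move=> e0; have H i : exists r : rat, `|x 0 i - ratr r| <= e.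
  have [|r] := @rat_in_itvoo R (x 0 i - e) (x 0 i + e); first by lra.
  rewrite in_itv /= => /andP[h1 h2]; exists r.
  by rewrite ler_norml; apply/andP; split; lra.
exists (\row_i projT1 (cid (H i))); apply: row_norm_le; first exact: ltW.
by move=> i; rewrite !mxE; case: (cid _).
Qed.

(* The half-spaces are those supporting [A] at the projections of rational points. *)
Lemma closure_halfspaces A : convex_real A -> A !=set0 ->
  exists (v : nat -> 'rV[R]_n) (c : nat -> R),
    (forall k x, A x -> inner x (v k) <= c k) /\
    (forall y, (forall k, inner y (v k) <= c k) -> closure A y).
Proof.
move=> cA A0.
have H (q : 'rV[rat]_n) : exists vc : 'rV[R]_n * R,
    (forall x, A x -> inner x vc.1 <= vc.2) /\
    (~ closure A (map_mx ratr q) -> exists p, closure A p /\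
      vc = (map_mx ratr q - p, inner p (map_mx ratr q - p))).
  have [cq|/(projection cA A0)[p Ap [_ Hp]]] := pselect (closure A (map_mx ratr q)).
    by exists (0, 0); split => // x _ /=; rewrite innerC inner0l.
  exists (map_mx ratr q - p, inner p (map_mx ratr q - p)); split => [x /Hp /=|_].
    by rewrite innerBl subr_le0.
  by exists p.
(* Outside the range of [pickle], and at rational points of the closure, the trivial half-space
   given by [0 <= 0] is used. *)
pose vc k := if unpickle k is Some q then projT1 (cid (H q)) else (0, 0).
exists (fun k => (vc k).1), (fun k => (vc k).2); split.
  move=> k x Ax; rewrite /vc; case: unpickle => [q|]; last by rewrite innerC inner0l.
  by case: (cid _) => /= ? [+ _]; apply.
move=> y Hy; apply: contrapT => ny.
have [d d0 Hd] : exists2 d : R, 0 < d & forall a, closure A a -> d < `|y - a|.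
  have oA : open (~` closure A) by apply: closed_openC; exact: closed_closure.
  have [d d0 Hd] := open_normP oA ny.
  by exists d => // a Aa; rewrite ltNge; apply/negP => /Hd; apply.
set N : R := n%:R + 1; have N0 : 0 < N by rewrite ltr_wpDl.
(* The rational point must be much closer to [y] than [y] is to the closure: the inner product
   exceeds the product of supremum norms by a factor up to [n], which [N ^+ 2] absorbs. *)
have e0 : 0 < d / (4 * N ^+ 2) by rewrite divr_gt0// mulr_gt0// exprn_gt0.
have [q yq] := rational_dense y e0.
have N1 : 1 <= N by rewrite lerDr.
have N2 : 1 <= N ^+ 2 by rewrite expr_ge1// ltW.
have yq' : `|y - map_mx ratr q| <= d / 4.
  apply: le_trans yq _; rewrite invfM mulrA ler_piMr ?divr_ge0 ?(ltW d0)//.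
  by rewrite invf_le1// exprn_gt0.
have nq : ~ closure A (map_mx ratr q) by move=> /Hd; lra.
have := Hy (pickle q); rewrite /vc pickleK; case: (cid _) => -[v c] /= [_ /(_ nq)[p [Ap [-> ->]]]].
set Q := map_mx ratr q in yq yq' *; set w := Q - p.
have : inner w w - inner (Q - y) w = inner (y - p) w.
  by rewrite -innerBl; congr inner; rewrite /w opprB addrC addrA subrK.
rewrite innerBl => E h.
have ww : `|w| ^+ 2 <= inner w w by exact: norm_le_inner.
have iw := inner_le_norm (Q - y) w.
have wd : d / 2 <= `|w|.
  have := Hd _ Ap; have := ler_normD (y - Q) w; rewrite /w subrKA; lra.
have : inner (Q - y) w <= N * (d / (4 * N ^+ 2)) * `|w|.
  apply: le_trans (ler_norm _) _; apply: le_trans iw _.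
  by rewrite ler_wpM2r// ler_pM// ?lerDl// distrC.
have -> : N * (d / (4 * N ^+ 2)) = d / 4 / N by field; rewrite gt_eqF.
have dN : d / 4 / N <= d / 4 by rewrite ler_piMr ?divr_ge0 ?(ltW d0)// invf_le1.
have w0 : 0 <= `|w| by [].
move=> h2; have : d / 4 / N * `|w| <= d / 4 * `|w| by rewrite ler_wpM2r.
nra.
Qed.

(** The error made in replacing [y] by a point [a] of [A] is transferred to [x], with the factor
    [(1 - t) / t], and openness of [A] at [x] absorbs it. *)
Lemma open_convex_comb A x y (t : R) : convex_real A -> open A -> A x -> closure A y ->
  0 < t <= 1 -> A (t *: x + (1 - t) *: y).
Proof.
move=> cA oA Ax cy /andP[t0 t1]; have [e e0 He] := open_normP oA Ax.
have [a Aa ya] := (closure_normP A y).1 cy (t * e) (mulr_gt0 t0 e0).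
pose x' := x + ((1 - t) / t) *: (y - a).
have Ax' : A x'.
  apply: He; rewrite /x' opprD addrA subrr sub0r normrN normrZ ger0_norm; last first.
    by rewrite divr_ge0 ?subr_ge0// ltW.
  apply: (@le_trans _ _ ((1 - t) / t * (t * e))).
    by rewrite ler_wpM2l// divr_ge0 ?subr_ge0// ltW.
  by rewrite mulrA mulfVK ?gt_eqF// ler_piMl ?(ltW e0)// gerBl ltW.
have := cA a x' t Aa Ax'; rewrite ltW// t1 => /(_ isT).
congr A; rewrite /x' scalerDr scalerA mulrC mulfVK ?gt_eqF//.
by rewrite addrCA scalerBr; congr (_ + _); rewrite addrC subrK.
Qed.

End inner_product.

Section tube.
Context {R : realType} {n : nat}.
Implicit Types (x y v : 'rV[R]_n) (z w : 'rV[C R]_n).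

Lemma ReCnE z i : ReCn z 0 i = ReC (z 0 i). Proof. by rewrite mxE. Qed.

Lemma ReCnD z w : ReCn (z + w) = ReCn z + ReCn w.
Proof. by apply/rowP => i; rewrite !mxE ReImE. Qed.

Lemma ReCn_mkCn x y : ReCn (mkCn x y) = x.
Proof. by apply/rowP => i; rewrite !mxE. Qed.

Lemma mkCnK z : mkCn (ReCn z) (\row_i ImC (z 0 i)) = z.
Proof. by apply/rowP => i; rewrite !mxE mkC_ReIm. Qed.

Lemma mkCn_comb x y (t : R) :
  mkC (1 - t) 0 *: mkCn x 0 + mkC t 0 *: mkCn y 0 = mkCn ((1 - t) *: x + t *: y) 0.
Proof. by apply/rowP => i; rewrite !mxE; apply: Ceq; rewrite !ReImE; ring. Qed.

Lemma norm_ReCn z (e : R) : `|z| <= mkC e 0 -> `|ReCn z| <= e.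
Proof.
move=> ze; have e0 : 0 <= e.
  have := le_trans (normr_ge0 z) ze.
  by rewrite lecE /= => /andP[].
apply: row_norm_le => // i; rewrite ReCnE; apply: le_trans (normr_ReC _) _.
by rewrite -le_normC_mk; apply: le_trans ze; exact: coord_le_norm.
Qed.

Lemma convex_setP (D : set 'rV[C R]_n) : convex_set D ->
  forall z w (t : R), D z -> D w -> 0 <= t <= 1 -> D (mkC (1 - t) 0 *: z + mkC t 0 *: w).
Proof.
move=> cD z w t Dz Dw /andP[t0 t1].
have h0 : 0 <= (mkC (1 - t) 0 : C R) by rewrite lecE /= eqxx /= subr_ge0.
have h1 : (mkC (1 - t) 0 : C R) <= 1 by rewrite lecE /= eqxx /= gerBl.
have := cD z w (Itv01 h0 h1) (mem_set Dz) (mem_set Dw) => /set_mem.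
have -> : mkC t 0 = 1 - mkC (1 - t) 0 :> C R by apply: Ceq; rewrite !ReImE; ring.
exact.
Qed.

Context (D : set 'rV[C R]_n).

Lemma W_P v : W_ D v <-> exists M, forall x, base D x -> inner x v <= M.
Proof.
split.
  move=> Wv; exists (fine (ereal_sup [set (inner x v)%:E | x in base D])) => x Dx.
  have h : ((inner x v)%:E <= ereal_sup [set (inner x v)%:E | x in base D])%E.
    by apply: ereal_sup_ubound; exists x.
  rewrite -lee_fin fineK// fin_numE; apply/andP; split.
    by apply/eqP => E; move: h; rewrite E leeNy_eq.
  by apply/eqP => E; move: Wv; rewrite /W_ /= E ltxx.
move=> [M H]; apply: (@le_lt_trans _ _ M%:E); last exact: ltry.
by apply: ge_ereal_sup => _ [x Dx <-]; rewrite lee_fin H.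
Qed.

Context (tD : tube_domain D).

Lemma tube_mem z : D z <-> base D (ReCn z).
Proof.
have [B [_ _ _ ->]] := tD; split=> [Dz|[w [x Ox [y _ <-]] E]]; first by exists z.
exists (ReCn z); last by exists (\row_i ImC (z 0 i)) => //; exact: mkCnK.
by rewrite -E ReCn_mkCn.
Qed.

Lemma tube_base : [/\ base D !=set0, open (base D) & connected (base D)].
Proof.
have [B [B0 oB cB E]] := tD; suff -> : base D = B by [].
apply/seteqP; split => [_ [w Dw <-]|x Bx].
  by move: Dw; rewrite E => -[x Ox [y _ <-]]; rewrite ReCn_mkCn.
by exists (mkCn x 0); rewrite ?ReCn_mkCn// E; exists x => //; exists 0.
Qed.

Lemma tube_mkCn x y : base D x -> D (mkCn x y).
Proof. by move=> Dx; apply/tube_mem; rewrite ReCn_mkCn. Qed.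

Lemma tube_open_norm z : D z -> exists2 e : R, 0 < e &
  forall w, `|w| <= mkC e 0 -> D (z + w).
Proof.
move=> /tube_mem Dz; have [_ oD _] := tube_base; have [e e0 He] := open_normP oD Dz.
exists e => // w we; apply/tube_mem; apply: He; rewrite ReCnD opprD addrA subrr sub0r normrN.
exact: norm_ReCn.
Qed.

Lemma tube_base_convex : convex_set D -> convex_real (base D).
Proof.
move=> cD x y t Dx Dy t01.
have := convex_setP cD (tube_mkCn 0 Dx) (tube_mkCn 0 Dy) t01.
by rewrite mkCn_comb => /tube_mem; rewrite ReCn_mkCn.
Qed.

End tube.

(** * Boundary measures and [pick_form] *)

Section boundary_values.
Context {R : realType} {n : nat} (g rho : circle R -> 'rV[R]_n).
Context (nu : {finite_measure set (circle R) -> \bar R}).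
Notation L := (@arclength R).

Definition boundary_functional i (K : circle R -> R) : R :=
  \int[L]_z (K z * g z 0 i) + \int[nu]_z (K z * rho z 0 i).

Lemma borel_map_comp (f : circle R -> 'rV[R]_n) (h : 'rV[R]_n -> R) :
  borel_map f -> continuous h -> measurable_fun setT (h \o f).
Proof.
move=> bf ch; apply: (measurability _ (RGenOInfty.measurableE R)).
move=> _ [_ [x ->] <-]; rewrite setTI comp_preimage -[_ @^-1` _]setTI.
apply: bf => //; apply: sub_sigma_algebra.
by move/continuousP: ch; apply; exact: interval_open.
Qed.

Context (g_L1 : forall i, L.-integrable setT (fun l => (g l 0 i)%:E)).
Context (rho_borel : borel_map rho).
Context (rho_sphere : forall l, enorm (rho l) = 1).

Lemma rho_le1 l i : `|rho l 0 i| <= 1.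
Proof.
have E : inner (rho l) (rho l) = 1.
  by rewrite -(sqr_sqrtr (inner_ge0 _)) -/(enorm _) rho_sphere expr1n.
apply: le_trans (coord_le_norm _ _) _.
by rewrite -(@ler_sqr _ `|_| 1) ?nnegrE// expr1n -E norm_le_inner.
Qed.

Lemma measurable_rho i : measurable_fun setT (fun l => rho l 0 i).
Proof. by apply: (borel_map_comp (h := fun x => x 0 i)) => //; exact: coord_continuous. Qed.

Lemma rho_integrable i : nu.-integrable setT (EFin \o (fun l => rho l 0 i)).
Proof.
apply: (bounded_integrable (M := 1)); last by move=> x; exact: rho_le1.
- by rewrite ltey_eq fin_num_measure.
- exact: measurable_rho.
Qed.

Lemma Rintegral_inner d (T : measurableType d) (m : {measure set T -> \bar R}) (K : T -> R)
    (H f : T -> 'rV[R]_n) :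
  (forall i, m.-integrable setT (EFin \o (fun z => K z * (H z 0 i * f z 0 i)))) ->
  m.-integrable setT (EFin \o (fun z => K z * inner (H z) (f z))) /\
  \int[m]_z (K z * inner (H z) (f z)) = \sum_(i < n) \int[m]_z (K z * (H z 0 i * f z 0 i)).
Proof.
move=> iKH; rewrite -big_enum /=.
have E : (fun z => K z * inner (H z) (f z)) =
    (fun z => \sum_(i <- enum 'I_n) K z * (H z 0 i * f z 0 i)).
  by apply/funext => z; rewrite /inner mulr_sumr big_enum.
rewrite {}E; elim: (enum 'I_n) => [|i s [IH1 IH2]].
  rewrite big_nil; split.
    rewrite (_ : _ \o _ = cst 0%E); first exact: integrable0.
    by apply/funext => z /=; rewrite big_nil.
  rewrite (_ : (fun z => _) = cst 0) ?Rintegral_cst ?mul0r//.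
  by apply/funext => z /=; rewrite big_nil.
rewrite big_cons -IH2.
have E : (fun z => \sum_(j <- i :: s) K z * (H z 0 j * f z 0 j)) =
    (fun z => K z * (H z 0 i * f z 0 i) + \sum_(j <- s) K z * (H z 0 j * f z 0 j)).
  by apply/funext => z; rewrite big_cons.
rewrite E; split; last by rewrite RintegralD.
exact: (integrableD measurableT (iKH i) IH1).
Qed.

Context (phi : C R -> 'rV[C R]_n) (mu : 'I_n -> {charge set (circle R) -> \bar R}).
Context (phi_mu : boundary_measure phi mu).
Context (mu_decomp : boundary_decomposition mu g rho nu).

Lemma boundary_value l i : cmod l < 1 ->
  phi l 0 i = herglotz_transform (boundary_functional i) (ImC (phi 0 0 i)) l.
Proof.
move=> l1; have /unit_discE ul := l1; rewrite (phi_mu ul) /charge_Cintegral.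
have cE := charge_Rintegral_density (g_L1 i) (rho_integrable i) (@mu_decomp i).
have bR := ccont_bmeas (ccont_Re_herglotz l1).
have bI := ccont_bmeas (ccont_Im_herglotz l1).
rewrite (cE _ bR) (cE _ bI).
by apply: Ceq; rewrite !ReImE /= ?mul0r ?subr0 ?addr0.
Qed.

Lemma Re_boundary_value l i : cmod l < 1 ->
  ReC (phi l 0 i) = (2 * pi)^-1 * boundary_functional i (fun z => poisson (cval z) l).
Proof. by move=> l1; rewrite boundary_value. Qed.

Definition hfield (a : 'I_n -> C R) (b : 'I_n -> R) (z : circle R) : 'rV[R]_n :=
  \row_i hreal (a i) (b i) (cval z).
Definition poisson2 l t (z : circle R) : R := poisson (cval z) l * poisson (cval z) t.

Lemma ccont_poisson2 l t : cmod l < 1 -> cmod t < 1 -> ccont (poisson2 l t).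
Proof. by move=> *; apply: ccontM; exact: ccont_poisson. Qed.

Lemma hfield_integrable d (T : measurableType d) (m : {measure set T -> \bar R}) (K H f : T -> R) :
  bmeas K -> bmeas H -> m.-integrable setT (EFin \o f) ->
  m.-integrable setT (EFin \o (fun z => K z * (H z * f z))).
Proof. by move=> bK bH fi; apply: bmeas_integrable_mul => //; exact: bmeas_integrable_mul. Qed.

Lemma arclength_integrableB i (x : 'rV[R]_n) :
  L.-integrable setT (EFin \o (fun z => (x - g z) 0 i)).
Proof.
have i1 := integrableRZl (x 0 i) (integrable_cst1 (@arclength_lty R)).
have := integrableB measurableT i1 (g_L1 i).
by congr (_.-integrable _ _); apply/funext => z; rewrite /= !mxE mulr1 EFinB.
Qed.

Lemma hfield_ccont a b i : ccont (fun z => hfield a b z 0 i).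
Proof.
rewrite (_ : (fun z => _) = (fun z => hreal (a i) (b i) (cval z))); first exact: ccont_hreal.
by apply/funext => z; rewrite mxE.
Qed.

Lemma hfield_integrable_arclength (K : circle R -> R) a b (x : 'rV[R]_n) : ccont K ->
  L.-integrable setT (EFin \o (fun z => K z * inner (hfield a b z) (x - g z))) /\
  \int[L]_z (K z * inner (hfield a b z) (x - g z)) =
  \sum_(i < n) \int[L]_z (K z * (hfield a b z 0 i * (x - g z) 0 i)).
Proof.
move=> cK; apply: Rintegral_inner => i; apply: hfield_integrable; first exact: ccont_bmeas.
  by apply: ccont_bmeas; exact: hfield_ccont.
exact: arclength_integrableB.
Qed.

Lemma hfield_integrable_nu (K : circle R -> R) a b : ccont K ->
  nu.-integrable setT (EFin \o (fun z => K z * inner (hfield a b z) (rho z))) /\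
  \int[nu]_z (K z * inner (hfield a b z) (rho z)) =
  \sum_(i < n) \int[nu]_z (K z * (hfield a b z 0 i * rho z 0 i)).
Proof.
move=> cK; apply: Rintegral_inner => i; apply: hfield_integrable; first exact: ccont_bmeas.
  by apply: ccont_bmeas; exact: hfield_ccont.
exact: rho_integrable.
Qed.

(** The [Q_z] of the overview. In necessity it is the derivative of the left inverse at [phi l],
    applied to [z - phi l]; in sufficiency it is built from [h], and its zero defines the left
    inverse. *)
Definition qform (a : 'I_n -> C R) (b : 'I_n -> R) (z : 'rV[C R]_n) l : C R :=
  \sum_(i < n) hpoly (a i) (b i) l * (z 0 i - phi l 0 i).

Definition qmass a b (z : 'rV[C R]_n) l t : R :=
  \int[L]_x (poisson2 l t x * inner (hfield a b x) (ReCn z - g x))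
  - \int[nu]_x (poisson2 l t x * inner (hfield a b x) (rho x)).

(** Each [z_i - phi_i] is a Herglotz transform, up to an imaginary constant: the constant [ReC z_i]
    is one because the kernel has real mean [2 * pi] and imaginary mean [0] before normalisation. *)
Lemma pick_form_qform a b z l t : cmod l < 1 -> cmod t < 1 ->
  pick_form l t (qform a b z l) (qform a b z t) =
  cmod (l - t) ^+ 2 * cmod (1 - t^* * l) ^+ 2 * ((2 * pi)^-1 * qmass a b z l t).
Proof.
move=> l1 t1.
pose T i (K : circle R -> R) :=
  \int[L]_x (K x * (ReCn z - g x) 0 i) - \int[nu]_x (K x * rho x 0 i).
have linT i : clinear (T i).
  move=> K1 K2 p q /ccont_bmeas b1 /ccont_bmeas b2; rewrite /T.
  rewrite (Rintegral_comb_mul _ _ (arclength_integrableB i (ReCn z)))//.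
  by rewrite (Rintegral_comb_mul _ _ (rho_integrable i))//; ring.
have TE i K : ccont K ->
    T i K = ReC (z 0 i) * \int[L]_x K x - boundary_functional i K.
  move=> /ccont_bmeas bK; rewrite /T /boundary_functional opprD addrA; congr (_ - _).
  have i1 := bmeas_integrable_mul bK (integrable_cst1 (@arclength_lty R)).
  have i1' : L.-integrable setT (EFin \o K).
    by move: i1; congr (_.-integrable _ _); apply/funext => x /=; rewrite mulr1.
  have i2 := bmeas_integrable_mul bK (g_L1 i).
  rewrite -RintegralZl// -RintegralB//; last exact: integrableRZl.
  by apply: eq_Rintegral => x _; rewrite !mxE; ring.
have pi2 : 2 * pi != 0 :> R by rewrite gt_eqF// mulr_gt0// pi_gt0.
have E i w : cmod w < 1 -> z 0 i - phi w 0 i =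
    herglotz_transform (T i) (ImC (z 0 i) - ImC (phi 0 0 i)) w.
  move=> w1; rewrite boundary_value//; have [eR eI] := Rintegral_herglotz w1.
  apply: Ceq; rewrite /herglotz_transform !ReImE TE ?eR ?eI.
  - by rewrite mulrBr mulrCA mulVf// mulr1.
  - exact: ccont_Re_herglotz.
  - ring.
  - exact: ccont_Im_herglotz.
rewrite /qform pick_form_sum /qmass.
have cP := ccont_poisson2 l1 t1.
rewrite (proj2 (hfield_integrable_arclength a b (ReCn z) cP)).
rewrite (proj2 (hfield_integrable_nu a b cP)) -sumrB mulr_sumr mulr_sumr.
apply: eq_bigr => i _; rewrite !E// pick_form_herglotz_transform//.
rewrite /T; congr (_ * (_ * (_ - _))); apply: eq_Rintegral => x _; rewrite !mxE /poisson2; ring.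
Qed.

End boundary_values.

(** * Necessity *)

Section infinitesimal_schwarz_pick.
Context {R : realType}.
Implicit Types (l t A B u v : C R).

Lemma cmod_sqr_add (x y : C R) (s : R) :
  cmod (x + mkC s 0 * y) ^+ 2 = cmod x ^+ 2 + 2 * s * ReC (x^* * y) + s ^+ 2 * cmod y ^+ 2.
Proof. by rewrite !cmod_sqr !ReImE; ring. Qed.

Lemma pick_form_bound l t : exists2 c : R, 0 <= c & forall A B,
  pick_form l t A B <= c * (cmod A + cmod B).
Proof.
have [c1 [c2 [c3 [c4 H]]]] := pick_form_coords l t 1 1.
exists (`|c1| + `|c2| + (`|c3| + `|c4|)) => [|A B]; first by rewrite !addr_ge0.
rewrite -[A]mul1r -[B]mul1r H !mul1r.
have E (c x y : R) : `|x| <= y -> c * x <= `|c| * y.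
  move=> xy; apply: le_trans (ler_norm _) _; rewrite normrM.
  by rewrite ler_wpM2l.
have h1 := E c1 _ _ (normr_ReC A); have h2 := E c2 _ _ (normr_ImC A).
have h3 := E c3 _ _ (normr_ReC B); have h4 := E c4 _ _ (normr_ImC B).
have g (A' : C R) (c : R) : 0 <= `|c| * cmod A' by rewrite mulr_ge0// cmod_ge0.
have := (g A c3, g A c4, g B c1, g B c2) => -[[[g1 g2] g3] g4].
lra.
Qed.

(** The inequality is squared and expanded in [s]: the constant terms agree, the linear terms differ
    by twice [pick_form], and the quadratic ones are either of favourable sign or bounded in terms
    of [N]. *)
Lemma pick_form_le_quadratic l t u v (s N : R) : cmod l < 1 -> cmod t < 1 ->
  0 < s <= 1 -> cmod u <= N -> cmod v <= N ->
  cmod (l + mkC s 0 * u - (t + mkC s 0 * v)) * cmod (1 - t^* * l) <=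
  cmod (l - t) * cmod (1 - (t + mkC s 0 * v)^* * (l + mkC s 0 * u)) ->
  pick_form l t u v <= s * (2 * (4 * N ^+ 2 + (2 * N + N ^+ 2) ^+ 2)).
Proof.
move=> l1 t1 /andP[s0 s1] uN vN.
set X := l - t; set Y := 1 - t^* * l.
have -> : l + mkC s 0 * u - (t + mkC s 0 * v) = X + mkC s 0 * (u - v) by rewrite /X; ring.
have sc : (mkC s 0 : C R)^* = mkC s 0 by apply: Ceq; rewrite !ReImE ?oppr0.
set V := v^* * l + t^* * u + mkC s 0 * (v^* * u).
have -> : 1 - (t + mkC s 0 * v)^* * (l + mkC s 0 * u) = Y + mkC s 0 * (- V).
  by rewrite !cjE -[mkC s (- 0)]/((mkC s 0 : C R)^*) sc /Y /V; ring.
move=> h; have N0 : 0 <= N := le_trans (cmod_ge0 u) uN.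
have l0 := cmod_ge0 l; have t0 := cmod_ge0 t; have u0 := cmod_ge0 u; have v0 := cmod_ge0 v.
have X2 : cmod X <= 2 by have := cmodB_le l t; rewrite -/X; lra.
have Y2 : cmod Y <= 2.
  have := cmodB_le 1 (t^* * l); rewrite -/Y cmodM cmodJ cmod1.
  have : cmod t * cmod l <= 1 * 1 by rewrite ler_pM// ltW.
  lra.
have vu : cmod (v^* * u) <= N ^+ 2 by rewrite cmodM cmodJ expr2 ler_pM.
have V2 : cmod V <= 2 * N + N ^+ 2.
  have := cmodD (v^* * l + t^* * u) (mkC s 0 * (v^* * u)); rewrite -/V.
  have := cmodD (v^* * l) (t^* * u); rewrite (cmodM (mkC s 0)) cmod_mk0 (gtr0_norm s0).
  have : cmod (v^* * l) <= N * 1 by rewrite cmodM cmodJ ler_pM// ltW.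
  have : cmod (t^* * u) <= 1 * N by rewrite cmodM cmodJ ler_pM// ltW.
  have : s * cmod (v^* * u) <= 1 * N ^+ 2 by rewrite ler_pM// ?cmod_ge0// ltW.
  lra.
have : (cmod (X + mkC s 0 * (u - v)) * cmod Y) ^+ 2 <= (cmod X * cmod (Y + mkC s 0 * (- V))) ^+ 2.
  by rewrite ler_sqr// nnegrE mulr_ge0 ?cmod_ge0.
rewrite !exprMn !cmod_sqr_add => {}h.
have E : ReC (Y^* * - V) = - ReC (Y^* * (v^* * l + t^* * u)) - s * ReC (Y^* * (v^* * u)).
  rewrite /V; move: (v^* * l + _) (v^* * u) => p q; rewrite !ReImE; ring.
have b1 : - ReC (Y^* * (v^* * u)) <= 2 * N ^+ 2.
  apply: le_trans (ler_norm _) _; rewrite normrN; apply: le_trans (normr_ReC _) _.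
  by rewrite cmodM cmodJ ler_pM ?cmod_ge0.
have b2 : cmod (- V) ^+ 2 <= (2 * N + N ^+ 2) ^+ 2.
  by rewrite cmodN ler_sqr// nnegrE ?cmod_ge0// addr_ge0 ?mulr_ge0 ?exprn_ge0.
have b3 : cmod X ^+ 2 <= 4.
  by rewrite -[4]/(2 * 2)%:R natrM -expr2 ler_sqr// nnegrE ?cmod_ge0.
have X0 : 0 <= cmod X ^+ 2 by rewrite exprn_ge0 ?cmod_ge0.
rewrite E in h; rewrite /pick_form -/X -/Y.
have b4 : 0 <= cmod (u - v) ^+ 2 * cmod Y ^+ 2 by rewrite mulr_ge0// exprn_ge0 ?cmod_ge0.
rewrite -(ler_pM2l s0); rewrite -(ler_pM2l (ltr0Sn R 1)).
have N20 := sqr_ge0 N; have V20 := sqr_ge0 (2 * N + N ^+ 2).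
move: h b1 b2 b3 X0 b4 N20 V20.
move: (cmod X ^+ 2) (cmod Y ^+ 2) (ReC (X^* * (u - v))) (cmod (u - v) ^+ 2)
  (ReC (Y^* * (v^* * l + t^* * u))) (ReC (Y^* * (v^* * u))) (cmod (- V) ^+ 2)
  (N ^+ 2) ((2 * N + N ^+ 2) ^+ 2) => x y p r q w m n m' h b1 b2 b3 X0 b4 n0 m0.
have s20 : 0 <= s ^+ 2 by rewrite exprn_ge0// ltW.
have c1 : x * (- 2 * w + m) <= 4 * (4 * n + m').
  apply: (@le_trans _ _ (x * (4 * n + m'))); first by rewrite ler_wpM2l//; lra.
  by rewrite ler_wpM2r//; lra.
have c2 : s ^+ 2 * (x * (- 2 * w + m)) <= s ^+ 2 * (4 * (4 * n + m')) by rewrite ler_wpM2l.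
have c3 : 0 <= s ^+ 2 * (r * y) by rewrite mulr_ge0.
lra.
Qed.

(** The velocities are only approximate, as difference quotients are; [pick_form_bound] absorbs the
    error and [pick_form_le_quadratic] the second order. *)
Lemma pick_form_le0 l t A B : cmod l < 1 -> cmod t < 1 ->
  (forall e : R, 0 < e -> exists s u v, [/\ 0 < s <= e, cmod (u - A) <= e, cmod (v - B) <= e &
    cmod (l + mkC s 0 * u - (t + mkC s 0 * v)) * cmod (1 - t^* * l) <=
    cmod (l - t) * cmod (1 - (t + mkC s 0 * v)^* * (l + mkC s 0 * u))]) ->
  pick_form l t A B <= 0.
Proof.
move=> l1 t1 H; rewrite leNgt; apply/negP => p0.
have [c c0 Hc] := pick_form_bound l t.
pose N := 1 + cmod A + cmod B; have A0 := cmod_ge0 A; have B0 := cmod_ge0 B.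
pose M := 2 * (4 * N ^+ 2 + (2 * N + N ^+ 2) ^+ 2).
have N0 : 0 <= N by rewrite /N; lra.
have M0 : 0 <= M by have := (sqr_ge0 N); have := (sqr_ge0 (2 * N + N ^+ 2)); rewrite /M; lra.
pose K := M + 2 * c + 1; have K0 : 0 < K by rewrite /K; lra.
pose e := Num.min 1 (pick_form l t A B / (2 * K)).
have e0 : 0 < e by rewrite lt_min ltr01 divr_gt0// mulr_gt0.
have e1 : e <= 1 by rewrite ge_min lexx.
have eK : e * (2 * K) <= pick_form l t A B.
  by rewrite -ler_pdivlMr ?mulr_gt0// ge_min lexx orbT.
have [s [u [v [/andP[s0 se] uA vB h]]]] := H e e0.
have uN : cmod u <= N.
  by have := cmodD (u - A) A; rewrite subrK /N; lra.
have vN : cmod v <= N.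
  by have := cmodD (v - B) B; rewrite subrK /N; lra.
have s01 : 0 < s <= 1 by rewrite s0 (le_trans se).
have := pick_form_le_quadratic l1 t1 s01 uN vN h; rewrite -/M => h1.
have := Hc (A - u) (B - v); rewrite pick_formD pick_formN (cmodB A) (cmodB B) => h2.
have : c * (cmod (u - A) + cmod (v - B)) <= c * (e + e) by rewrite ler_wpM2l// lerD.
have : s * M <= e * M by rewrite ler_wpM2r.
have : 0 < e * K by rewrite mulr_gt0.
rewrite /K in eK *; lra.
Qed.

(* [1/2] and [i/2] serve to compare the imaginary coefficients at any two points. *)
Lemma pick_form_imag_eq0 (h : C R -> C R) :
  (forall l t, cmod l < 1 -> cmod t < 1 -> pick_form l t (mkC 0 1 * h l) (mkC 0 1 * h t) = 0) ->
  exists b, forall l, cmod l < 1 -> h l = hpoly (h 0)^* b l.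
Proof.
move=> H; have H0 : cmod (0 : C R) < 1 by rewrite cmod0.
pose i : C R := mkC 0 1.
have i2 : i * i = -1 by apply: Ceq; rewrite !ReImE; ring.
have ic : i^* = - i by apply: Ceq; rewrite !ReImE; ring.
(* The pair [l], [0]. After subtraction of a complete field with the same value at [0], only
   [i * q * l] remains, and the form then reads off the imaginary part of [q]. *)
have S1 l : cmod l < 1 -> l != 0 -> exists c, h l = hpoly (h 0)^* c l.
  move=> l1 l0; pose q := (h l - h 0 - (h 0)^* * l ^+ 2) / l.
  suff qi : ImC q = 0.
    exists (ReC q); rewrite /hpoly cjK; have -> : mkC (ReC q) 0 = q.
      by rewrite -[RHS]mkC_ReIm qi.
    by rewrite /q mulfVK//; ring.
  have E : h l = q * l + h 0 + (h 0)^* * l ^+ 2 by rewrite /q mulfVK//; ring.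
  have := H l 0 l1 H0; rewrite -/i; apply: contra_eq => q0.
  have -> : i * h l = i * (q * l) + (i * h 0 - (i * h 0)^* * l ^+ 2 + mkC 0 0 * l).
    by rewrite cjM ic E [mkC 0 0](_ : _ = 0)//; ring.
  have Z : i * h 0 = 0 + (i * h 0 - (i * h 0)^* * 0 ^+ 2 + mkC 0 0 * 0).
    by rewrite expr0n /= !mulr0 subr0 addr0 add0r.
  rewrite {3}Z pick_formD pick_form_complete addr0 pick_form0 cmod0 cj0 mul0r subr0.
  rewrite subr0 mulr1 expr0n /= subr0 mul1r.
  have -> : i * (q * l) * l^* = i * q * (l * l^*) by ring.
  clearbody q; rewrite -mkC_cmod !ReImE !mul0r !mul1r mulr0 !subr0 sub0r mulf_neq0//.
    by rewrite oppr_eq0.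
  by rewrite expf_neq0// cmod_eq0.
pose c l := if pselect (cmod l < 1 /\ l != 0) is left p then projT1 (cid (S1 l p.1 p.2)) else 0.
have cP l : cmod l < 1 -> l != 0 -> h l = hpoly (h 0)^* (c l) l.
  move=> l1 l0; rewrite /c; case: pselect => [p|[]//].
  exact: projT2 (cid (S1 l p.1 p.2)).
(* After subtraction of the complete field with coefficient [c t], the form at [l], [t] is the
   difference of the two coefficients times the imaginary part of [l * t^*] and positive factors. *)
have S2 l t : cmod l < 1 -> cmod t < 1 -> ImC (l * t^*) != 0 -> c l = c t.
  move=> l1 t1 lt0.
  have l0 : l != 0 by apply: contra_neq lt0 => ->; rewrite mul0r.
  have t0 : t != 0 by apply: contra_neq lt0 => ->; rewrite cj0 mulr0.
  have := H l t l1 t1; rewrite -/i (cP l)// (cP t)//; apply: contra_eq => clt.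
  have E w b : i * hpoly (h 0)^* b w = mkC 0 (b - c t) * w +
      (i * h 0 - (i * h 0)^* * w ^+ 2 + mkC 0 (c t) * w).
    have -> : mkC 0 (b - c t) = i * mkC b 0 - mkC 0 (c t) by apply: Ceq; rewrite !ReImE; ring.
    by rewrite /hpoly cjM ic !cjK; ring.
  rewrite !E subrr pick_formD pick_form_complete addr0 [mkC 0 0](_ : _ = 0)// mul0r.
  rewrite pick_form0; set d := c l - c t.
  have -> : mkC 0 d * l * ((l - t) * (1 - t^* * l))^* =
      mkC 0 d * (l * l^* - l * t^* - (l * l^*) * (l * t^*)^* + (l * l^*) * (t * t^*)).
    by rewrite !cjE; ring.
  rewrite -!mkC_cmod; move: lt0; move: (l * t^*) => w w0.
  rewrite (_ : ReC _ = d * (1 - cmod l ^+ 2) * ImC w); last by rewrite !ReImE; ring.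
  have sq x : cmod x < 1 -> 1 - cmod x ^+ 2 != 0 :> R.
    by move=> x1; rewrite subr_eq0 eq_sym lt_eqF// expr_lt1// cmod_ge0.
  by rewrite !mulf_neq0// ?sq// subr_eq0.
have h2 : mkC (1 / 2) 0 * (mkC 0 (1 / 2))^* = mkC 0 (- (1 / 4)) :> C R.
  by apply: Ceq; rewrite !ReImE; field.
have m1 : cmod (mkC (1 / 2) 0 : C R) < 1 by rewrite cmod_mk0 ger0_norm//; lra.
have m2 : cmod (mkC 0 (1 / 2) : C R) < 1.
  by rewrite -(@ltr_sqr R) ?nnegrE ?cmod_ge0// cmod_sqr !ReImE; lra.
have c12 : c (mkC (1 / 2) 0) = c (mkC 0 (1 / 2)).
  by apply: S2 => //; rewrite h2 ReImE oppr_eq0; lra.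
exists (c (mkC (1 / 2) 0)) => l l1; have [->|l0] := eqVneq l 0.
  by rewrite /hpoly cjK expr0n /= !mulr0 !addr0.
rewrite (cP l)//; congr hpoly.
have [Il|Il] := eqVneq (ImC l) 0.
  rewrite c12; apply: S2 => //; rewrite !ReImE Il mul0r addr0 mulrN oppr_eq0 mulf_neq0//.
  by apply: contra_neq l0 => Rl; apply: Ceq.
apply: S2 => //; rewrite !ReImE oppr0 mulr0 add0r.
by rewrite mulf_neq0// mul1r invr_neq0.
Qed.

End infinitesimal_schwarz_pick.

Section left_inverse.
Context {R : realType} {n : nat} (D : set 'rV[C R]_n) (phi : C R -> 'rV[C R]_n).
Context (f : 'rV[C R]_n -> C R).
Implicit Types (l t : C R) (z w : 'rV[C R]_n).

Context (tD : tube_domain D).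
Context (cD : convex_set D).
Context (phi_holo : holomorphic_on (@unit_disc R) phi).
Context (phi_D : phi @` @unit_disc R `<=` D).
Context (f_holo : holomorphic_on D f).
Context (f_disc : f @` D `<=` @unit_disc R).
Context (fphi : forall l, unit_disc l -> f (phi l) = l).

Definition dfield (j : 'I_n) l : C R := 'd f (phi l) (delta_mx 0 j : 'rV[C R]_n).

Lemma diff_dfield l w : 'd f (phi l) w = \sum_(j < n) dfield j l * w 0 j.
Proof.
rewrite {1}(row_sum_delta w) linear_sum; apply: eq_bigr => j _.
by rewrite linearZ mulrC.
Qed.

Lemma phi_mem l : cmod l < 1 -> D (phi l).
Proof. by move=> /unit_discE l1; apply: phi_D; exists l. Qed.

Definition segment z (s : R) l := mkC (1 - s) 0 *: phi l + mkC s 0 *: z.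

Lemma segmentE z s l : segment z s l = phi l + mkC s 0 *: (z - phi l).
Proof. by apply/rowP => i; rewrite !mxE; apply: Ceq; rewrite !ReImE; ring. Qed.

Lemma segment_mem z s l : D z -> 0 <= s <= 1 -> cmod l < 1 -> D (segment z s l).
Proof. by move=> Dz s01 l1; apply: convex_setP => //; exact: phi_mem. Qed.

Lemma segment_schwarz_pick z s l t : D z -> 0 <= s <= 1 -> cmod l < 1 -> cmod t < 1 ->
  cmod (f (segment z s l) - f (segment z s t)) * cmod (1 - t^* * l) <=
  cmod (l - t) * cmod (1 - (f (segment z s t))^* * f (segment z s l)).
Proof.
move=> Dz s01; apply: (schwarz_pick (F := fun l => f (segment z s l))) => w w1.
  apply: (@differentiable_comp _ _ _ _ (segment z s) f).
    apply: differentiableD => //; apply: differentiableZ.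
    by apply: phi_holo; exact/unit_discE.
  by apply: f_holo; exact: segment_mem.
by apply/unit_discE; apply: f_disc; exists (segment z s w) => //; exact: segment_mem.
Qed.

Lemma segment_near z l (e : R) : cmod l < 1 -> 0 < e ->
  exists2 d : R, 0 < d & forall s : R, 0 < s <= d ->
    cmod ((f (segment z s l) - l) / mkC s 0 - 'd f (phi l) (z - phi l)) <= e.
Proof.
move=> l1 e0; have /unit_discE ul := l1.
set w := z - phi l; pose m : R := ReC `|w| + 1.
have mE : `|w| = mkC (ReC `|w|) 0.
  have : 0 <= `|w| by [].
  by rewrite lecE => /andP[/eqP h _]; apply: Ceq; rewrite ReImE.
have m0 : 0 <= ReC `|w| by have : 0 <= `|w| by []; rewrite lecE => /andP[].
have mp : 0 < m by rewrite /m; lra.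
have [d d0 Hd] := differentiable_near (f_holo (phi_mem l1)) (divr_gt0 e0 mp).
exists (d / m); first by rewrite divr_gt0.
move=> s /andP[s0 sd]; have sC : mkC s 0 != 0 :> C R.
  by rewrite -cmod_gt0 cmod_mk0 gtr0_norm.
have sw : `|mkC s 0 *: w| = mkC (s * ReC `|w|) 0.
  by rewrite normrZ mE normCE cmod_mk0 gtr0_norm// -mkCM.
have := Hd (mkC s 0 *: w); rewrite sw => Hd'.
have : `|f (phi l + mkC s 0 *: w) - f (phi l) - 'd f (phi l) (mkC s 0 *: w)| <=
    mkC (e / m) 0 * mkC (s * ReC `|w|) 0.
  apply: Hd'; rewrite lecE /= eqxx /=; apply: (@le_trans _ _ (s * m)).
    by rewrite ler_wpM2l ?ltW// /m; lra.
  by rewrite -ler_pdivlMr.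
rewrite -mkCM le_normC_mk (fphi ul) -segmentE linearZ => h.
have -> : (f (segment z s l) - l) / mkC s 0 - 'd f (phi l) w =
    (f (segment z s l) - l - mkC s 0 *: 'd f (phi l) w) / mkC s 0.
  have G (p q c : C R) : c != 0 -> p / c - q = (p - c * q) / c by move=> c0; field.
  exact: G.
rewrite cmodM cmodV cmod_mk0 gtr0_norm// ler_pdivrMr//; apply: le_trans h _.
have -> : e / m * (s * ReC `|w|) = e * s * (ReC `|w| / m) by ring.
rewrite ler_piMr ?mulr_ge0 ?(ltW s0) ?(ltW e0)//.
by rewrite ler_pdivrMr// mul1r /m; lra.
Qed.

Lemma pick_form_left_inverse z l t : D z -> cmod l < 1 -> cmod t < 1 ->
  pick_form l t ('d f (phi l) (z - phi l)) ('d f (phi t) (z - phi t)) <= 0.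
Proof.
move=> Dz l1 t1; apply: pick_form_le0 => // e e0.
have [d d0 Hd] := segment_near z l1 e0; have [d' d'0 Hd'] := segment_near z t1 e0.
pose s := Num.min (Num.min 1 e) (Num.min d d').
have s0 : 0 < s by rewrite !lt_min ltr01 e0 d0.
have s1 : s <= 1 by rewrite !ge_min lexx.
have se : s <= e by rewrite !ge_min lexx orbT.
have sd : s <= d by rewrite !ge_min lexx !orbT.
have sd' : s <= d' by rewrite !ge_min lexx !orbT.
have sC : mkC s 0 != 0 :> C R by rewrite -cmod_gt0 cmod_mk0 gtr0_norm.
(* With difference quotients as velocities, the displaced points are exactly the values of [f] on
   the segments. *)
exists s, ((f (segment z s l) - l) / mkC s 0), ((f (segment z s t) - t) / mkC s 0).
split; first by rewrite s0.
- by apply: Hd; rewrite s0.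
- by apply: Hd'; rewrite s0.
have E (x w : C R) : x + mkC s 0 * ((w - x) / mkC s 0) = w by rewrite mulrC mulfVK// addrC subrK.
by rewrite !E; apply: segment_schwarz_pick => //; rewrite ltW.
Qed.

(** The tube contains [z + i s e_j] for every real [s], so the form is nonpositive along an entire
    line. It is affine in [s], hence its slope, which is the left-hand side, vanishes. *)
Lemma pick_form_dfield j l t : cmod l < 1 -> cmod t < 1 ->
  pick_form l t (mkC 0 1 * dfield j l) (mkC 0 1 * dfield j t) = 0.
Proof.
move=> l1 t1; have Dz := phi_mem l1; set z := phi l in Dz.
pose e : 'rV[C R]_n := delta_mx 0 j.
have H (s : R) : D (z + mkC 0 s *: e).
  apply/(tube_mem tD); rewrite (_ : ReCn _ = ReCn z); first exact/(tube_mem tD).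
  apply/rowP => i; rewrite !mxE !ReImE.
  by case: (_ && _); rewrite /= ?ReC0 ?ImC0 ?ReC1 ?ImC1; ring.
set p := pick_form _ _ _ _.
pose G (z' : 'rV[C R]_n) (w : C R) := 'd f (phi w) (z' - phi w).
have P s : pick_form l t (G (z + mkC 0 s *: e) l) (G (z + mkC 0 s *: e) t) <= 0.
  exact: pick_form_left_inverse (H s) l1 t1.
have E s (w : C R) : G (z + mkC 0 s *: e) w = G z w + mkC s 0 * (mkC 0 1 * dfield j w).
  rewrite /G addrAC linearD linearZ /= mulrA; congr (_ + _ * _).
  by apply: Ceq; rewrite !ReImE; ring.
clearbody G.
have Hp s : pick_form l t (G z l) (G z t) + s * p <= 0.
  by have := P s; rewrite !E pick_formD pick_formZ.
set q := pick_form _ _ _ _ in Hp.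
apply/eqP; apply: contraT => p0; have := Hp ((1 - q) / p).
by rewrite divfK//; lra.
Qed.

Lemma dfield_hpoly j : exists b, forall l, cmod l < 1 -> dfield j l = hpoly (dfield j 0)^* b l.
Proof. by apply: pick_form_imag_eq0 => l t; exact: pick_form_dfield. Qed.

(** Otherwise the chain rule would give the identity [f \o phi] the derivative [0] at [0]. *)
Lemma dfield_neq0 : exists j, dfield j 0 != 0.
Proof.
have u0 : unit_disc (0 : C R) by apply/unit_discE; rewrite cmod0.
have D0 : D (phi 0) by apply: phi_mem; rewrite cmod0.
apply: contrapT => H.
have E w : 'd f (phi 0) w = 0.
  rewrite diff_dfield big1// => j _.
  have [->|h] := eqVneq (dfield j 0) 0; first by rewrite mul0r.
  by case: H; exists j.
have d1 : differentiable (f \o phi) 0 := differentiable_comp (phi_holo u0) (f_holo D0).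
have e2 : (0 : R) < 1 / 2 by lra.
have [d d0 Hd] := cdifferentiable_near d1 e2.
pose s := Num.min d (1 / 2); have s0 : 0 < s by rewrite lt_min d0.
have sd : s <= d by rewrite ge_min lexx.
have s2 : s <= 1 / 2 by rewrite ge_min lexx orbT.
have cs : cmod (mkC s 0 : C R) = s by rewrite cmod_mk0 gtr0_norm.
have us : unit_disc (mkC s 0 : C R) by apply/unit_discE; rewrite cs; lra.
have := Hd (mkC s 0); rewrite cs sd => /(_ isT).
have -> : cderiv (f \o phi) 0 = 0.
  by rewrite /cderiv (congr1 (fun h => h 1) (diff_comp (phi_holo u0) (f_holo D0))) /= E.
by rewrite /= add0r mul0r subr0 !fphi// subr0 cs; lra.
Qed.

End left_inverse.

Section zeros_on_circle.
Context {R : realType}.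
Implicit Types (a w : C R) (b s t : R).

Lemma cis_inj s t : 0 <= s < 2 * pi -> 0 <= t < 2 * pi -> cis s = cis t -> s = t.
Proof.
move=> s2 t2 E; wlog st : s t s2 t2 E / s < t.
  by move=> H; have [/H->//|/H->//|//] := ltgtP s t.
have := congr1 (@cval R) E; rewrite /cval /= => -[Ec Es].
have cd : cos (t - s) = 1 by rewrite cosB Ec Es -!expr2 cos2Dsin2.
have d0 : 0 < (t - s) / 2 < pi.
  move: s2 t2 => /andP[s0 _] /andP[_ tp]; apply/andP; split; first by rewrite divr_gt0// subr_gt0.
  by rewrite ltr_pdivrMr//; lra.
have := sin_gt0_pi d0; have := cos_mulr2n ((t - s) / 2); have := cos2Dsin2 ((t - s) / 2).
have -> : ((t - s) / 2) *+ 2 = t - s by rewrite -mulr_natr mulfVK.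
rewrite cd mulr2n => h1 h2 h3.
have : sin ((t - s) / 2) ^+ 2 = 0 by lra.
by move=> /eqP; rewrite sqrf_eq0 gt_eqF.
Qed.

Lemma arclength_point w : @arclength R [set z | cval z = w] = 0%E.
Proof.
have [[z0 zw]|none] := pselect (exists z, cval z = w); last first.
  rewrite (_ : [set z | _] = set0) ?measure0//.
  by apply/seteqP; split => // z /= zw; case: none; exists z.
have [t0 t0p E] := cis_surj z0; rewrite arclengthE.
rewrite (_ : _ `&` _ = [set t0]) ?lebesgue_measure_set1//.
apply/seteqP; split => [t [/= tw ta]|_ ->].
  apply: cis_inj => //; rewrite E; apply: val_inj; exact: (etrans tw (esym zw)).
by split; [rewrite /= E|rewrite /angles /= in_itv /=].
Qed.

Lemma ae_neq_point w : {ae @arclength R, forall z, cval z != w}.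
Proof.
exists [set z | cval z = w]; split; last first.
- by move=> z /= /negP; rewrite negbK => /eqP.
- exact: arclength_point.
have -> : [set z : circle R | cval z = w] =
    (fun z => ReC (cval z)) @^-1` [set ReC w] `&` (fun z => ImC (cval z)) @^-1` [set ImC w].
  by apply/seteqP; split => [z /= ->//|z /= [? ?]]; exact: Ceq.
apply: measurableI; rewrite -[X in measurable X]setTI.
  exact: measurable_ReC_cval.
exact: measurable_ImC_cval.
Qed.

Lemma hpoly_zeros a b : a != 0 \/ b != 0 -> exists w1 w2, forall z, cmod z = 1 ->
  hpoly a b z = 0 -> z = w1 \/ z = w2.
Proof.
move=> ab; have [a0|a0] := eqVneq a 0.
  exists 0, 0 => z z1; rewrite a0 /hpoly cj0 add0r mul0r addr0 => /eqP.
  rewrite mulf_eq0 => /orP[/eqP b0|/eqP ->]; last by left.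
  by have b00 : b = 0 := @mkC0_inj R b 0 b0; case: ab; rewrite ?a0 ?b00 eqxx.
have [[z1 z1p]|none] := pselect (exists z1, hpoly a b z1 = 0); last first.
  by exists 0, 0 => z _ zp; case: none; exists z.
exists z1, (- mkC b 0 / a - z1) => z _ zp; have [->|zz1] := eqVneq z z1; first by left.
right; have : (z - z1) * (mkC b 0 + a * (z + z1)) = 0.
  by transitivity (hpoly a b z - hpoly a b z1); [rewrite /hpoly; ring|rewrite zp z1p subr0].
move=> /eqP; rewrite mulf_eq0 subr_eq0 (negbTE zz1) /= => /eqP E.
have -> : mkC b 0 = - (a * (z + z1)) by apply/eqP; rewrite -addr_eq0 E.
by field.
Qed.

Lemma hreal_neq0_ae a b : a != 0 \/ b != 0 ->
  {ae @arclength R, forall z, hreal a b (cval z) != 0}.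
Proof.
move=> /hpoly_zeros[w1 [w2 H]]; apply: filterS2 (ae_neq_point w1) (ae_neq_point w2).
move=> z n1 n2; apply/eqP => E; have := hpoly_twist a b (cmod_cval z).
rewrite E => /eqP; rewrite mulf_eq0 conjC_eq0 -cmod_eq0 cmod_cval oner_eq0 /= => /eqP.
by move=> /(H _ (cmod_cval z))[h|h]; [move: n1|move: n2]; rewrite h eqxx.
Qed.

End zeros_on_circle.

Section real_convexity.
Context {R : realType} {n : nat} (D : set 'rV[C R]_n).
Implicit Types (x y v H p : 'rV[R]_n).

Lemma closure_halfspace (A : set 'rV[R]_n) v (c : R) y :
  (forall x, A x -> inner x v <= c) -> closure A y -> inner y v <= c.
Proof.
move=> HA cy; have cB : closed [set x | inner x v <= c].
  by have /continuous_closedP/(_ [set y | y <= c]) := @inner_continuous R n v; apply; exact: closed_le.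
by have := closure_subset HA cy; rewrite -(proj1 (closure_id _) cB).
Qed.

(** The half-line from [x0] in the direction [y] satisfies all the inequalities, so it stays in the
    closure of the base, and no [w] bounded above there can increase along it. The parameter [tau]
    makes the bound [M] be exceeded by [1]. *)
Lemma S_halfspaces (v : nat -> 'rV[R]_n) (c : nat -> R) y : base D !=set0 ->
  (forall k x, base D x -> inner x (v k) <= c k) ->
  (forall x, (forall k, inner x (v k) <= c k) -> closure (base D) x) ->
  (forall k, inner y (v k) <= 0) -> S_ D y.
Proof.
move=> [x0 Dx0] Hv Hc Hy w /W_P[M HM].
rewrite leNgt; apply/negP => yw; pose tau := (M - inner x0 w + 1) / inner y w.
have t0 : 0 <= tau by rewrite divr_ge0 ?(ltW yw)//; have := HM _ Dx0; lra.
have : inner (x0 + tau *: y) w <= M.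
  apply: closure_halfspace HM _; apply: Hc => k; rewrite innerDl innerZl.
  have := Hv k _ Dx0; have := mulr_ge0_le0 t0 (Hy k); lra.
rewrite innerDl innerZl divfK ?gt_eqF//; lra.
Qed.

(** Moving from [x] slightly in the direction [H] raises the inner product with [H], and a rational
    point of the open base lies near the new position. Weak inequalities at rational points
    therefore become strict ones at all points. *)
Lemma P_rational H p : open (base D) -> H != 0 -> closure (base D) p ->
  (forall q : 'rV[rat]_n, base D (map_mx ratr q) -> inner H (map_mx ratr q - p) <= 0) ->
  P_ D H p.
Proof.
move=> oD H0 cp Hq; split => // x Dx.
have [e e0 He] := open_normP oD Dx.
have nH : 0 < `|H| by rewrite normr_gt0.
have HH := inner_gt0 H0; pose d := e / (2 * `|H|).
have d0 : 0 < d by rewrite divr_gt0// mulr_gt0.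
pose N : R := n%:R * `|H| + 1; have N0 : 0 < N by rewrite ltr_wpDl// mulr_ge0.
pose e' := Num.min (e / 2) (d * inner H H / (2 * N)).
have h1 : 0 < e / 2 by rewrite divr_gt0.
have h2 : 0 < d * inner H H / (2 * N) by rewrite divr_gt0// mulr_gt0.
have e'0 : 0 < e' by rewrite lt_min h1.
have [q xq] := rational_dense (x + d *: H) e'0; set Q := map_mx ratr q in xq.
have DQ : base D Q.
  apply: He; have -> : x - Q = (x + d *: H - Q) - d *: H by rewrite (addrAC _ (- Q)) addrK.
  apply: le_trans (ler_normB _ _) _; rewrite normrZ gtr0_norm//.
  have -> : d * `|H| = e / 2 by rewrite /d; field; rewrite gt_eqF.
  have : e' <= e / 2 by rewrite ge_min lexx.
  lra.
have := Hq q DQ; rewrite -/Q => h.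
have : e' * N <= d * inner H H / 2.
  rewrite (_ : d * _ / 2 = d * inner H H / (2 * N) * N); last by field; rewrite gt_eqF.
  by rewrite ler_wpM2r ?(ltW N0)// ge_min lexx orbT.
have : inner H (x + d *: H - Q) <= e' * N.
  apply: le_trans (ler_norm _) _; apply: le_trans (inner_le_norm _ _) _.
  rewrite mulrC ler_pM// ?mulr_ge0// /N; lra.
have dH : 0 < d * inner H H by rewrite mulr_gt0.
rewrite (innerC (x - p)) (innerBr H x p) (innerBr H (x + _) Q) (innerDr H x) innerZr.
rewrite innerBr in h; lra.
Qed.

End real_convexity.

Section hvec.
Context {R : realType} {n : nat}.
Implicit Types (a : 'I_n -> C R) (b : 'I_n -> R).

Definition hvec a b l : 'rV[C R]_n := \row_i hpoly (a i) (b i) l.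

Lemma twist_hvec a b l : twist (hvec a b) l = hfield a b l.
Proof. by apply/rowP => i; rewrite !mxE hpoly_twist ?cmod_cval. Qed.

Lemma differentiable_hvec a b l : differentiable (hvec a b) l.
Proof.
have -> : hvec a b = (fun=> \row_i (a i)^*) \+ (fun l => l *: \row_i mkC (b i) 0) \+
    (fun l => l ^+ 2 *: \row_i a i).
  by apply/funext => w; apply/rowP => i; rewrite !mxE /hpoly; ring.
apply: differentiableD; first apply: differentiableD => //.
  exact: differentiableZl.
Qed.

Lemma Hclass_hvec a b : Hclass (hvec a b).
Proof.
split; first by move=> l _; exact: differentiable_hvec.
by move=> l i; rewrite !mxE hpoly_twist ?cmod_cval.
Qed.

Lemma hfield_neq0_ae a b j : a j != 0 \/ b j != 0 ->
  {ae @arclength R, forall z, hfield a b z != 0}.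
Proof.
move=> /hreal_neq0_ae; apply: filterS => z; apply: contra_neq => /rowP/(_ j).
by rewrite !mxE.
Qed.

End hvec.

Section necessity.
Context {R : realType} {n : nat} (D : set 'rV[C R]_n) (phi : C R -> 'rV[C R]_n).
Context (mu : 'I_n -> {charge set (circle R) -> \bar R}) (g rho : circle R -> 'rV[R]_n).
Context (nu : {finite_measure set (circle R) -> \bar R}).
Notation L := (@arclength R).
Context (tD : tube_domain D).
Context (cD : convex_set D).
Context (phi_mu : boundary_measure phi mu).
Context (g_L1 : forall i, (@arclength R).-integrable setT (fun l => (g l 0 i)%:E)).
Context (rho_borel : borel_map rho).
Context (rho_sphere : forall l, enorm (rho l) = 1).
Context (nu_singular : mutually_singular nu (@arclength R)).
Context (mu_decomp : boundary_decomposition mu g rho nu).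

Lemma poisson0 (z : circle R) : poisson (cval z) 0 = 1.
Proof. by rewrite poissonE ?cmod_cval// cmod0 subr0 cmod_cval; field. Qed.

(** At the second point [0] the Poisson kernel is [1], so only one kernel is left and
    [poisson_negative] applies. *)
Lemma qmass_negative (a : 'I_n -> C R) (b : 'I_n -> R) (z : 'rV[C R]_n) :
  (forall l, 0 < cmod l -> cmod l < 1 -> qmass g rho nu a b z l 0 <= 0) ->
  {ae L, forall x, inner (hfield a b x) (ReCn z - g x) <= 0} /\
  {ae nu, forall x, 0 <= inner (hfield a b x) (rho x)}.
Proof.
move=> H.
have i1 := proj1 (hfield_integrable_arclength g_L1 a b (ReCn z) (@ccont_cst R 1)).
have i2 := proj1 (hfield_integrable_nu nu rho_borel rho_sphere a b (@ccont_cst R (-1))).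
have neg l : 0 < cmod l -> cmod l < 1 ->
  \int[L]_x (poisson (cval x) l * (1 * inner (hfield a b x) (ReCn z - g x))) +
  \int[nu]_x (poisson (cval x) l * (-1 * inner (hfield a b x) (rho x))) <= 0.
  move=> l0 l1; have bP := ccont_bmeas (ccont_poisson l1).
  have i3 := bmeas_integrable_mul bP i2.
  have E : \int[nu]_x (poisson2 l 0 x * inner (hfield a b x) (rho x)) =
      -1 * \int[nu]_x (poisson (cval x) l * (-1 * inner (hfield a b x) (rho x))).
    by rewrite -RintegralZl//; apply: eq_Rintegral => x _; rewrite /poisson2 poisson0; ring.
  have := H l l0 l1; rewrite /qmass E mulN1r opprK; congr (_ + _ <= _).
  by apply: eq_Rintegral => x _; rewrite /poisson2 poisson0 mulr1 mul1r.
have [E1 E2] := poisson_negative nu_singular i1 i2 neg.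
split; first by apply: filterS E1 => x; rewrite mul1r.
by apply: filterS E2 => x; rewrite mulN1r oppr_le0.
Qed.

Lemma Re_boundary_inner v l : cmod l < 1 -> inner v (ReCn (phi l)) = (2 * pi)^-1 *
  (\int[L]_x (poisson (cval x) l * inner v (g x)) +
   \int[nu]_x (poisson (cval x) l * inner v (rho x))).
Proof.
move=> l1; have bP := ccont_bmeas (ccont_poisson l1).
have i1 i : L.-integrable setT (EFin \o (fun z => poisson (cval z) l * (v 0 i * g z 0 i))).
  by apply: bmeas_integrable_mul => //; exact: (integrableRZl _ (g_L1 i)).
have i2 i : nu.-integrable setT (EFin \o (fun z => poisson (cval z) l * (v 0 i * rho z 0 i))).
  by apply: bmeas_integrable_mul => //; apply: integrableRZl; exact: rho_integrable.
rewrite (proj2 (Rintegral_inner (H := fun=> v) i1)) (proj2 (Rintegral_inner (H := fun=> v) i2)).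
rewrite -big_split mulr_sumr; apply: eq_bigr => i _ /=.
rewrite ReCnE (Re_boundary_value g_L1 rho_borel rho_sphere phi_mu mu_decomp)//.
rewrite mulrCA; congr (_ * _); rewrite /boundary_functional mulrDr.
have j1 := bmeas_integrable_mul bP (g_L1 i).
have j2 := bmeas_integrable_mul bP (rho_integrable nu rho_borel rho_sphere i).
rewrite -RintegralZl// -RintegralZl//.
by congr (_ + _); apply: eq_Rintegral => x _; rewrite mulrCA.
Qed.

(** The function [c - inner v (ReCn (phi l))] is the Poisson integral, up to normalisation, of
    [c - inner v (g x)] and [- inner v (rho x)]; its sign passes to the two densities by
    [poisson_negative]. *)
Lemma boundary_halfspace v (c : R) :
  (forall l, cmod l < 1 -> inner (ReCn (phi l)) v <= c) ->
  {ae L, forall x, inner (g x) v <= c} /\ {ae nu, forall x, inner (rho x) v <= 0}.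
Proof.
move=> H.
have i0 := integrable_cst1 (@arclength_lty R).
have i1 : L.-integrable setT (EFin \o (fun x => inner v (g x) - c * 1)).
  have [|+ _] := @Rintegral_inner R n _ _ L (fun=> 1) (fun=> v) g.
    move=> i; apply: bmeas_integrable_mul; first exact: ccont_bmeas (@ccont_cst R 1).
    exact: (integrableRZl _ (g_L1 i)).
  move=> /integrableB/(_ (integrableRZl c i0)) => /(_ measurableT).
  by congr (_.-integrable _ _); apply/funext => x /=; rewrite mul1r.
have i2 : nu.-integrable setT (EFin \o (fun x => inner v (rho x))).
  have [|+ _] := @Rintegral_inner R n _ _ nu (fun=> 1) (fun=> v) rho.
    move=> i; apply: bmeas_integrable_mul; first exact: ccont_bmeas (@ccont_cst R 1).
    by apply: integrableRZl; exact: rho_integrable.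
  by congr (_.-integrable _ _); apply/funext => x /=; rewrite mul1r.
have neg l : 0 < cmod l -> cmod l < 1 ->
  \int[L]_x (poisson (cval x) l * (inner v (g x) - c * 1)) +
  \int[nu]_x (poisson (cval x) l * inner v (rho x)) <= 0.
  move=> _ l1; have bP := ccont_bmeas (ccont_poisson l1).
  have := H l l1; rewrite innerC Re_boundary_inner//.
  have pi2 : 0 < 2 * pi :> R by rewrite mulr_gt0// pi_gt0.
  rewrite mulrC ler_pdivrMr//; have [<- _] := Rintegral_herglotz l1.
  have iP : L.-integrable setT (EFin \o (fun x => poisson (cval x) l)).
    have := bmeas_integrable_mul bP i0.
    by congr (_.-integrable _ _); apply/funext => x /=; rewrite mulr1.
  have ig : L.-integrable setT (EFin \o (fun x => poisson (cval x) l * inner v (g x))).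
    have [|//] := @Rintegral_inner R n _ _ L (fun x => poisson (cval x) l) (fun=> v) g.
    by move=> i; apply: bmeas_integrable_mul => //; exact: (integrableRZl _ (g_L1 i)).
  have -> : \int[L]_x (poisson (cval x) l * (inner v (g x) - c * 1)) =
      \int[L]_x (poisson (cval x) l * inner v (g x)) - c * \int[L]_x poisson (cval x) l.
    rewrite -RintegralZl// -RintegralB//; last exact: integrableRZl.
    by apply: eq_Rintegral => x _; rewrite mulr1; ring.
  by rewrite /poisson => h; lra.
have [E1 E2] := poisson_negative nu_singular i1 i2 neg.
split; first by apply: filterS E1 => x; rewrite mulr1 subr_le0 innerC.
by apply: filterS E2 => x; rewrite innerC.
Qed.

(** The closure of the base is cut out by countably many half-spaces, so the exceptional sets of
    [boundary_halfspace] add up to a null set. *)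
Lemma boundary_in_closure : (forall l, cmod l < 1 -> base D (ReCn (phi l))) ->
  {ae L, forall x, closure (base D) (g x)} /\ {ae nu, forall x, S_ D (rho x)}.
Proof.
move=> H; have [B0 oB _] := tube_base tD.
have [v [c [Hv Hc]]] := closure_halfspaces (tube_base_convex tD cD) B0.
have E k := boundary_halfspace (fun l l1 => Hv k _ (H l l1)).
split.
  have : {ae L, forall x, forall k, inner (g x) (v k) <= c k}.
    by apply/ae_foralln => k; exact: (E k).1.
  by apply: filterS => x; exact: Hc.
have : {ae nu, forall x, forall k, inner (rho x) (v k) <= 0}.
  by apply/ae_foralln => k; exact: (E k).2.
by apply: filterS => x; exact: S_halfspaces Hv Hc.
Qed.

Lemma geodesic_necessary : complex_geodesic D phi ->
  exists h, [/\ Hclass h, exists z, h z != 0 & geodesic_conditions D phi g rho nu h].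
Proof.
move=> [phi_holo phi_D [f [f_holo f_disc fphi]]].
(* Conjugated because the constant term of [hpoly a b] is [a^*]. *)
pose a j := (dfield phi f j 0)^*.
pose b j := projT1 (cid (dfield_hpoly tD cD phi_holo phi_D f_holo f_disc fphi j)).
have ab j l : cmod l < 1 -> dfield phi f j l = hpoly (a j) (b j) l.
  by move=> l1; rewrite /b; case: (cid _) => c /= ->.
have [j aj] := dfield_neq0 phi_holo phi_D f_holo fphi.
have nb : base D !=set0 /\ open (base D) by have [] := tube_base tD.
have [B0 oB] := nb.
have phiD l : cmod l < 1 -> base D (ReCn (phi l)).
  by move=> l1; exact: (proj1 (tube_mem tD (phi l)) (phi_mem phi_D l1)).
have Q x : base D x -> {ae L, forall y, inner (hfield a b y) (x - g y) <= 0} /\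
    {ae nu, forall y, 0 <= inner (hfield a b y) (rho y)}.
  move=> Dx; have := qmass_negative (a := a) (b := b) (z := mkCn x 0); rewrite ReCn_mkCn; apply.
  move=> l l0 l1; have z1 : cmod (0 : C R) < 1 by rewrite cmod0.
  have := pick_form_left_inverse cD phi_holo phi_D f_holo f_disc fphi (tube_mkCn tD 0 Dx) l1 z1.
  have qE w : cmod w < 1 ->
      'd f (phi w) (mkCn x 0 - phi w) = qform phi a b (mkCn x 0) w.
    by move=> w1; rewrite diff_dfield; apply: eq_bigr => i _; rewrite ab// !mxE.
  move/(le_trans (eq_ler (esym (f_equal2 (pick_form l 0) (qE l l1) (qE 0 z1))))).
  rewrite (pick_form_qform g_L1 rho_borel rho_sphere phi_mu mu_decomp)//.
  rewrite pmulr_rle0; last by rewrite mulr_gt0// exprn_gt0// cmod_gt0 ?subr0 -?cmod_gt0// cj0 mul0r subr0 cmod1.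
  by rewrite pmulr_rle0// invr_gt0 mulr_gt0// pi_gt0.
exists (hvec a b); split; first exact: Hclass_hvec.
  exists 0; apply/eqP => /rowP/(_ j); rewrite !mxE -ab ?cmod0// => E.
  by move: aj; rewrite E eqxx.
have tE z : twist (hvec a b) z = hfield a b z := twist_hvec a b z.
have [gcl rS] := boundary_in_closure phiD.
split => //.
(* Testing at rational points only keeps the union of the exceptional sets countable. *)
- have Qr : {ae L, forall y, forall k, if unpickle k is Some q then
     base D (map_mx ratr q) -> inner (hfield a b y) (map_mx ratr (q : 'rV[rat]_n) - g y) <= 0 else True}.
    apply/ae_foralln => k; case: unpickle => [q|]; last by apply: aeW.
    have [Dq|nD] := pselect (base D (map_mx ratr q)); last by apply: aeW.
    by apply: filterS (Q _ Dq).1.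
  have H0 := @hfield_neq0_ae R n a b j.
  have {}H0 : {ae L, forall z, hfield a b z != 0} by apply: H0; left; rewrite conjC_eq0.
  apply: filterS3 H0 gcl Qr => y H0 gcl Qr; rewrite tE; apply: P_rational => // q.
  by have := Qr (pickle q); rewrite pickleK.
- have [x Dx] := B0; apply: filterS (Q _ Dx).2 => y; by rewrite tE.
- by apply: phiD; rewrite cmod0.
Qed.

End necessity.

(** * Orthogonality conditions *)

Section twist_continuity.
Context {R : realType}.
Notation L := (@arclength R).

Lemma ae_dense (P : circle R -> Prop) (l : circle R) U : {ae L, forall x, P x} ->
  nbhs (l : set_type (@unit_circle R)) U -> exists2 y, U y & P y.
Proof.
move=> [N [mN N0 PN]] nU; have [t0 /andP[t00 t02] tl] := cis_surj l.
subst l; have /nbhs_normP[d /= d0 Hd] := @cis_continuous R t0 U nU.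
apply: contrapT => nP.
(* The arc is taken to the right of [t0] and ends before [2 * pi], so that it stays inside
   [angles]. *)
pose m := Num.min (t0 + d / 2) ((t0 + 2 * pi) / 2).
have tm : t0 < m by rewrite lt_min ltrDl divr_gt0//= ltr_pdivlMr//; lra.
have md : m <= t0 + d / 2 by rewrite ge_min lexx.
have mp : m < 2 * pi.
  by apply: (@le_lt_trans _ _ ((t0 + 2 * pi) / 2)); [rewrite ge_min lexx orbT|rewrite ltr_pdivrMr//; lra].
have sub : `[t0, m]%classic `<=` @cis R @^-1` N `&` @angles R.
  move=> t /=; rewrite in_itv /= => /andP[h1 h2]; split; last first.
    by rewrite /angles /= in_itv /=; apply/andP; split; lra.
  apply: PN => /= Pt; apply: nP; exists (cis t) => //; apply: Hd => /=.
  by rewrite distrC ger0_norm ?subr_ge0//; lra.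
have mc : measurable (@cis R @^-1` N `&` @angles R).
  apply: measurableI; last exact: measurable_angles.
  by rewrite -[X in measurable X]setTI; exact: measurable_cis.
have : (@lebesgue_measure R `[t0, m]%classic <= L N)%E.
  rewrite arclengthE.
  exact: (le_measure (@lebesgue_measure R) (mem_set (measurable_itv `[t0, m])) (mem_set mc) sub).
by rewrite N0 lebesgue_measure_itv /= lte_fin tm -EFinD lee_fin leNgt subr_gt0 tm.
Qed.

Context {n : nat}.

Lemma differentiable_entry (h : C R -> 'rV[C R]_n) z i : differentiable h z ->
  differentiable (fun w => h w 0 i) z.
Proof.
move=> dh; apply: (@differentiable_comp _ _ _ _ h (fun M : 'rV[C R]_n => M 0 i)) => //.
exact: differentiable_coord.
Qed.

Lemma nbhs_row_le (x : 'rV[R]_n) U : nbhs x U -> exists2 e : R, 0 < e &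
  forall y, `|x - y| <= e -> U y.
Proof.
move=> /nbhs_normP[e /= e0 He]; exists (e / 2); first by rewrite divr_gt0.
by move=> y xy; apply: He; rewrite /=; apply: le_lt_trans xy _; rewrite ltr_pdivrMr//; lra.
Qed.

Lemma twistE (h : C R -> 'rV[C R]_n) l i : twist h l 0 i = ReC ((cval l)^-1 * h (cval l) 0 i).
Proof. by rewrite !mxE -circle_conj ?cmod_cval. Qed.

Lemma ccont_twist (h : C R -> 'rV[C R]_n) i : Hclass h -> ccont (fun l => twist h l 0 i).
Proof.
move=> [dh _]; rewrite (_ : (fun l => _) = (fun l => ReC ((cval l)^-1 * h (cval l) 0 i))).
  apply: (ccont_ReC (F := fun z => z^-1 * h z 0 i)) => z z1.
  apply: differentiableM; last by apply: differentiable_entry; exact: dh.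
  by apply: differentiableV => //; rewrite -cmod_gt0 z1.
by apply/funext => l; rewrite twistE.
Qed.

Lemma twist_near (h : C R -> 'rV[C R]_n) (l : circle R) (e : R) : Hclass h -> 0 < e ->
  nbhs (l : set_type (@unit_circle R)) [set y | `|twist h l - twist h y| <= e].
Proof.
move=> Hh e0.
have : \forall y \near (l : set_type (@unit_circle R)),
    forall i, `|twist h l 0 i - twist h y 0 i| <= e.
  apply: (@filter_forall _ _ _ _ (nbhs_filter (l : set_type (@unit_circle R)))) => i.
  have := @ccont_twist h i Hh l.
  by move=> /(@cvgrPdist_le R R _ (nbhs (l : set_type (@unit_circle R))) _)/(_ e e0).
apply: filterS => y H; apply: row_norm_le; first exact: ltW.
by move=> i; have := H i; rewrite !mxE.
Qed.

End twist_continuity.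

Section orthogonality.
Context {R : realType} {n : nat} (D : set 'rV[C R]_n) (phi h : C R -> 'rV[C R]_n).
Context (g rho : circle R -> 'rV[R]_n).
Context (nu : {finite_measure set (circle R) -> \bar R}).
Notation L := (@arclength R).
Context (rho_sphere : forall l, enorm (rho l) = 1).
Context (Hh : Hclass h).
Context (cond : geodesic_conditions D phi g rho nu h).

(** Where condition (i) holds, the functional [twist h y] is bounded on the base by its value at
    [g y], hence lies in [W_ D]. Such [y] are dense in the circle and [twist h] is continuous. *)
Lemma twist_closure_W l : closure (W_ D) (twist h l).
Proof.
have [Pg _ _ _] := cond; apply/closure_normP => e e0.
have [y Ly [cy Py]] := ae_dense Pg (twist_near l Hh e0).
exists (twist h y) => //; apply/W_P; exists (inner (g y) (twist h y)) => x Dx.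
by have := Py x Dx; rewrite innerBl subr_lt0 => /ltW.
Qed.

(** A vector of [S_ D] has nonpositive inner product with [W_ D], hence with its closure, which
    contains [twist h l]; condition (ii) gives the opposite sign. *)
Lemma rho_orthogonal : {ae nu, forall l, (S_ D `&` perp [set twist h l]) (rho l)}.
Proof.
have [_ Hrho Srho _] := cond; apply: filterS2 Hrho Srho => l Hl Sl; split => // _ ->.
apply/eqP; rewrite eq_le (innerC (rho l)) Hl andbT.
have HW x : W_ D x -> inner x (rho l) <= 0.
  by move=> Wx; rewrite innerC; exact: Sl.
exact: closure_halfspace HW (@twist_closure_W l).
Qed.

(** From an interior point of [W_ D] one may move a little in the direction [rho l]. By
    orthogonality the inner product with [rho l] becomes positive, contrary to [rho l] lying in
    [S_ D]. *)
Lemma rho_W_interior : nu [set l | (W_ D)° (twist h l)] = 0%E.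
Proof.
have mW : measurable [set l | (W_ D)° (twist h l)].
  apply: circle_open_measurable; rewrite openE => l /=; rewrite /interior => nW.
  have [e e0 He] := nbhs_row_le (nbhs_interior nW).
  by apply: filterS (twist_near l Hh e0) => y /He.
apply: (@measure_negligible _ _ _ nu) => //.
have := rho_orthogonal; apply: negligibleS => l /= iW [Sl /(_ _ erefl) Pl].
have [e e0 He] : exists2 e : R, 0 < e & forall y, `|twist h l - y| <= e -> W_ D y.
  exact: nbhs_row_le iW.
pose r : R := e / (`|rho l| + 1).
have r1 : 0 < `|rho l| + 1 by rewrite ltr_wpDl.
have r0 : 0 < r by rewrite divr_gt0.
have /Sl : W_ D (twist h l + r *: rho l).
  apply: He; rewrite opprD addrA subrr sub0r normrN normrZ gtr0_norm// /r.
  by rewrite mulrAC ler_pdivrMr// ler_wpM2l ?(ltW e0)//; lra.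
rewrite innerDr Pl innerZr add0r.
have -> : inner (rho l) (rho l) = 1.
  by rewrite -(sqr_sqrtr (inner_ge0 _)) -/(enorm _) rho_sphere expr1n.
by rewrite mulr1 leNgt r0.
Qed.

End orthogonality.

(** * Sufficiency *)

Section twist_representation.
Context {R : realType}.
Notation L := (@arclength R).
Implicit Types (k F : C R -> C R) (z : circle R).

(** The constant may depend on [z], which suffices for [poisson_approx]: differentiability serves
    near [z], boundedness away from it. *)
Lemma lipschitz_at F z : (forall w, cmod w = 1 -> differentiable F w) ->
  exists c : R, forall y, `|ReC (F (cval y)) - ReC (F (cval z))| <= c * cmod (cval y - cval z).
Proof.
move=> dF; have [d d0 Hd] := cdifferentiable_near (dF _ (cmod_cval z)) (@ltr01 R).
have [M HM] := circle_bounded (ccont_ReC dF).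
have M0 : 0 <= M := le_trans (normr_ge0 _) (HM z).
exists ((cmod (cderiv F (cval z)) + 1) + 2 * M / d) => y.
have D0 := cmod_ge0 (cderiv F (cval z)); have c0 := cmod_ge0 (cval y - cval z).
have Md : 0 <= 2 * M / d by rewrite divr_ge0 ?mulr_ge0// ltW.
have [yd|/ltW yd] := leP (cmod (cval y - cval z)) d; last first.
  apply: (@le_trans _ _ (2 * M)).
    apply: le_trans (ler_normB _ _) _.
    by have := HM y; have := HM z; rewrite /=; lra.
  apply: (@le_trans _ _ (2 * M / d * cmod (cval y - cval z))).
    by rewrite mulrAC ler_pdivlMr// ler_wpM2l// mulr_ge0.
  by rewrite ler_wpM2r// lerDr; lra.
have := Hd _ yd; rewrite [cval z + _]addrC subrK mul1r => h.
rewrite -[X in X - _]/(ReC _) -ReCN -ReCD; apply: le_trans (normr_ReC _) _.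
have := cmodD (F (cval y) - F (cval z) - cderiv F (cval z) * (cval y - cval z))
  (cderiv F (cval z) * (cval y - cval z)).
rewrite subrK cmodM => h2; apply: le_trans h2 _.
rewrite !mulrDl mul1r; have := mulr_ge0 Md c0; lra.
Qed.

(** The Herglotz kernel at [z] and [r * y] is [1 + 2 * r * w * y / (1 - r * w * y)], with [w] the
    conjugate of [z]. In the second term the factor [y] cancels the pole of [k y / y], and the mean
    value property evaluates it; reality on the circle allows the product to be formed inside the
    real part. *)
Lemma poisson_integral_entire k z (r : R) : (forall w, differentiable k w) ->
  (forall y : circle R, ImC ((cval y)^* * k (cval y)) = 0) -> 0 <= r < 1 ->
  \int[L]_y (poisson (cval z) (mkC r 0 * cval y) * ReC ((cval y)^* * k (cval y))) =
  \int[L]_y ReC ((cval y)^* * k (cval y)) + 2 * pi * ReC (mkC (2 * r) 0 * (cval z)^* * k 0).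
Proof.
move=> dk kr /andP[r0 r1]; set w := (cval z)^*.
have cw : cmod w = 1 by rewrite cmodJ cmod_cval.
pose N y : C R := mkC (2 * r) 0 * w * k y / (1 - mkC r 0 * w * y).
have den y : cmod y <= 1 -> 1 - mkC r 0 * w * y != 0.
  move=> y1; rewrite subr_eq0; apply/eqP => E; have := @cmod1 R; rewrite E !cmodM cw mulr1.
  rewrite cmod_mk0 ger0_norm//; have : r * cmod y <= r * 1 by rewrite ler_wpM2l.
  lra.
have dN y : cmod y <= 1 -> differentiable N y.
  move=> y1; apply: differentiableM; first exact: differentiableM.
  apply: differentiableV; last exact: den.
  by apply: differentiableB => //; exact: differentiableM.
have := mean_value dN; rewrite {2}/N mulr0 subr0 divr1 => <-.
have pk : ccont (fun y => ReC ((cval y)^* * k (cval y))).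
  rewrite (_ : (fun y => _) = (fun y => ReC ((cval y)^-1 * k (cval y)))).
    apply: (ccont_ReC (F := fun y => y^-1 * k y)) => y y1; apply: differentiableM; last exact: dk.
    by apply: differentiableV => //; rewrite -cmod_gt0 y1.
  by apply/funext => y; rewrite circle_conj ?cmod_cval.
have ck : ccont (fun y => ReC (N (cval y))).
  by apply: (ccont_ReC (F := N)) => y y1; apply: dN; rewrite y1.
have ic K : ccont K -> L.-integrable setT (EFin \o K).
  move=> /ccont_bmeas bK; have := bmeas_integrable_mul bK (integrable_cst1 (@arclength_lty R)).
  by congr (_.-integrable _ _); apply/funext => y /=; rewrite mulr1.
rewrite -RintegralD//; [|exact: ic..].
apply: eq_Rintegral => y _; rewrite /poisson.
set p := (cval y)^* * k (cval y).
have pE : mkC (ReC p) 0 = p by rewrite -[RHS]mkC_ReIm kr.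
have yk : k (cval y) = cval y * p.
  by rewrite /p mulrA -mkC_cmod cmod_cval expr1n mul1r.
have -> : ReC (herglotz (cval z) (mkC r 0 * cval y)) * ReC p =
    ReC (herglotz (cval z) (mkC r 0 * cval y) * mkC (ReC p) 0) by rewrite !ReImE; ring.
rewrite pE -ReCD; congr ReC; rewrite /N yk /herglotz.
have z0 : cval z != 0 by rewrite -cmod_gt0 cmod_cval.
have := den (cval y); rewrite cmod_cval lexx => /(_ isT).
have d1 : cval z - mkC r 0 * cval y != 0.
  apply: circleB_neq0; first exact: cmod_cval.
  by rewrite cmodM cmod_mk0 cmod_cval mulr1 ger0_norm.
rewrite /w circle_conj ?cmod_cval// (_ : mkC (2 * r) 0 = mkC r 0 + mkC r 0); last first.
  by apply: Ceq; rewrite !ReImE; ring.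
move=> _; field.
by rewrite z0 d1.
Qed.

(** As [r] tends to [1] the Poisson integral tends to [2 * pi] times the value at [z], while
    [poisson_integral_entire] shows it to be a constant plus a multiple of the real part of
    [(cval z)^* * k 0]; so the trigonometric degree is at most one. *)
Lemma twist_coord_repr k : (forall w, differentiable k w) ->
  (forall y : circle R, ImC ((cval y)^* * k (cval y)) = 0) ->
  exists b, forall z, ReC ((cval z)^* * k (cval z)) = hreal (k 0)^* b (cval z).
Proof.
move=> dk kr; pose psi (y : circle R) := ReC ((cval y)^* * k (cval y)).
have psiE : psi = (fun y => ReC ((cval y)^-1 * k (cval y))).
  by apply/funext => y; rewrite /psi circle_conj ?cmod_cval.
have dF w : cmod w = 1 -> differentiable (fun y : C R => y^-1 * k y) w.
  move=> w1; apply: differentiableM; last exact: dk.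
  by apply: differentiableV => //; rewrite -cmod_gt0 w1.
have cpsi : ccont psi by rewrite psiE; exact: ccont_ReC dF.
pose b := (2 * pi)^-1 * \int[L]_y psi y; exists b => z.
have [c Hc] := lipschitz_at z dF.
have pi2 : 0 < 2 * pi :> R by rewrite mulr_gt0// pi_gt0.
have c0 : 0 <= `|c| by [].
pose q := 2 * ReC ((cval z)^* * k 0).
have key e : 0 < e -> e <= 1 -> `|psi z - (b + q)| <= (2 * `|c| + `|q|) * e.
  (* This radius makes both error terms of [poisson_approx], taken with [d = e], equal to [e]. *)
  move=> e0 e1; pose r : R := 1 - e ^+ 2 / 2.
  have e2 : e ^+ 2 <= e by rewrite expr2 ler_piMl// ltW.
  have e20 : 0 < e ^+ 2 by rewrite exprn_gt0.
  have r01 : 0 <= r < 1 by rewrite /r; apply/andP; split; lra.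
  have Lip y : `|psi y - psi z| <= `|c| * cmod (cval y - cval z).
    rewrite psiE; apply: le_trans (Hc y) _.
    by rewrite ler_wpM2r ?cmod_ge0// ler_norm.
  have := poisson_approx cpsi Lip r01 e0.
  rewrite (_ : (2 - 2 * r) / e = e); last by rewrite /r; field; rewrite gt_eqF.
  rewrite (poisson_integral_entire _ dk kr r01) -/psi.
  have -> : ReC (mkC (2 * r) 0 * (cval z)^* * k 0) = r * q.
    by rewrite /q -mulrA; move: ((cval z)^* * k 0) => x; rewrite !ReImE; ring.
  have -> : \int[L]_y psi y = 2 * pi * b by rewrite /b mulrA mulfV ?mul1r// gt_eqF.
  rewrite -!mulrDr -mulrBr normrM (gtr0_norm pi2) ler_pM2l// => h.
  have -> : psi z - (b + q) = - (b + r * q - psi z) - (1 - r) * q by ring.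
  apply: le_trans (ler_normB _ _) _; rewrite normrN normrM.
  have -> : `|1 - r| = e ^+ 2 / 2 by rewrite /r opprB addrC subrK ger0_norm// divr_ge0// ltW.
  have : e ^+ 2 / 2 * `|q| <= e * `|q| by rewrite ler_wpM2r//; lra.
  lra.
have hE : hreal (k 0)^* b (cval z) = b + q.
  by rewrite /hreal /q; congr (_ + 2 * _); move: (cval z) (k 0) => u v; rewrite !ReImE; ring.
rewrite hE; apply/eqP; rewrite -subr_eq0 -normr_eq0; apply: contraT => d0.
have {d0} d0 : 0 < `|psi z - (b + q)| by rewrite lt_def d0 normr_ge0.
set d := `|_| in key d0; pose K := 2 * `|c| + `|q| + 1.
have K0 : 0 < K by rewrite /K; have : 0 <= `|q| by []; lra.
pose e := Num.min 1 (d / (2 * K)).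
have e0 : 0 < e by rewrite lt_min ltr01 divr_gt0// mulr_gt0.
have e1 : e <= 1 by rewrite ge_min lexx.
have eK : e * (2 * K) <= d by rewrite -ler_pdivlMr ?mulr_gt0// ge_min lexx orbT.
have := key e e0 e1; rewrite /K in eK; lra.
Qed.

Theorem twist_repr n (h : C R -> 'rV[C R]_n) : Hclass h ->
  exists a b, forall l, twist h l = hfield a b l.
Proof.
move=> [dh hr]; have H i : exists b, forall z : circle R,
    ReC ((cval z)^* * h (cval z) 0 i) = hreal (h 0 0 i)^* b (cval z).
  have dk w : differentiable (fun u : C R => h u 0 i) w by apply: differentiable_entry; exact: dh.
  have kr y : ImC ((cval y)^* * h (cval y) 0 i) = 0 by have := hr y i; rewrite mxE.
  exact: (twist_coord_repr dk kr).
exists (fun i => (h 0 0 i)^*), (fun i => projT1 (cid (H i))) => l.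
by apply/rowP => i; rewrite !mxE; case: (cid _) => b /= ->.
Qed.

End twist_representation.

Section ae_integrals.
Context d (T : measurableType d) (R : realType) (m : {measure set T -> \bar R}).
Implicit Types f K : T -> R.

Lemma Rintegral_ae_norm f : m.-integrable setT (EFin \o f) -> {ae m, forall x, 0 <= f x} ->
  \int[m]_x f x = \int[m]_x `|f x|.
Proof.
move=> fi f0; rewrite /Rintegral; congr fine.
have [mf _] := integrableP _ _ _ fi.
apply: ae_eq_integral => //; first by have /integrableP[] := integrable_norm fi.
by apply: filterS f0 => x x0 _; rewrite /= ger0_norm.
Qed.

Lemma Rintegral_ae_ge0 f : m.-integrable setT (EFin \o f) -> {ae m, forall x, 0 <= f x} ->
  0 <= \int[m]_x f x.
Proof. by move=> fi f0; rewrite Rintegral_ae_norm//; exact: Rintegral_ge0. Qed.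

Lemma Rintegral_ae_gt0 f : m.-integrable setT (EFin \o f) -> {ae m, forall x, 0 < f x} ->
  (0 < m setT)%E -> 0 < \int[m]_x f x.
Proof.
move=> fi f0 mT; have f0' : {ae m, forall x, 0 <= f x} by apply: filterS f0 => x /ltW.
rewrite lt_def Rintegral_ae_ge0// andbT; apply/eqP => I0.
have [mf _] := integrableP _ _ _ fi.
have : (\int[m]_(x in setT) `|(f x)%:E| = 0)%E.
  have in1 := integrable_fin_num measurableT (integrable_norm fi).
  have := Rintegral_ae_norm fi f0'; rewrite I0 /Rintegral => E.
  by rewrite -(fineK in1); congr EFin; rewrite -E.
move/(ae_eq_integral_abs m measurableT mf) => h.
have : {ae m, forall x : T, False}.
  apply: filterS2 h f0 => x /(_ I) /= [->]; by rewrite ltxx.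
move=> [N [mN N0 sub]]; move: mT; rewrite (_ : setT = N) ?N0 ?ltxx//.
by apply/seteqP; split => // x _; apply: sub.
Qed.

Lemma Rintegral_weight_le f K1 K2 : bmeas K1 -> bmeas K2 -> (forall x, K1 x <= K2 x) ->
  m.-integrable setT (EFin \o f) -> {ae m, forall x, 0 <= f x} ->
  \int[m]_x (K1 x * f x) <= \int[m]_x (K2 x * f x).
Proof.
move=> b1 b2 K12 fi f0; rewrite -subr_ge0 -RintegralB//; [|exact: bmeas_integrable_mul..].
apply: Rintegral_ae_ge0.
  exact: (integrableB measurableT (bmeas_integrable_mul b2 fi) (bmeas_integrable_mul b1 fi)).
by apply: filterS f0 => x x0; rewrite -mulrBl mulr_ge0// subr_ge0.
Qed.

End ae_integrals.

Section sufficient_conditions.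
Context {R : realType} {n : nat} (D : set 'rV[C R]_n) (phi : C R -> 'rV[C R]_n).
Context (mu : 'I_n -> {charge set (circle R) -> \bar R}) (g rho : circle R -> 'rV[R]_n).
Context (nu : {finite_measure set (circle R) -> \bar R}).
Context (a : 'I_n -> C R) (b : 'I_n -> R).
Notation L := (@arclength R).
Context (tD : tube_domain D).
Context (cD : convex_set D).
Context (phi_mu : boundary_measure phi mu).
Context (g_L1 : forall i, (@arclength R).-integrable setT (fun l => (g l 0 i)%:E)).
Context (rho_borel : borel_map rho).
Context (rho_sphere : forall l, enorm (rho l) = 1).
Context (mu_decomp : boundary_decomposition mu g rho nu).
Context (g_P : {ae @arclength R, forall l, P_ D (hfield a b l) (g l)}).
Context (rho_ge0 : {ae nu, forall l, 0 <= inner (hfield a b l) (rho l)}).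
Context (rho_S : {ae nu, forall l, S_ D (rho l)}).
Context (phi0 : base D (ReCn (phi 0))).

(** The least value on the circle of the Poisson kernel at a point of modulus [r]. *)
Definition harnack (r : R) : R := (1 - r) / (1 + r).

Lemma harnack_gt0 r : 0 <= r -> r < 1 -> 0 < harnack r.
Proof. by move=> r0 r1; rewrite divr_gt0//; lra. Qed.

Lemma Rintegral_affine v (c : R) (K : circle R -> R) : bmeas K ->
  L.-integrable setT (EFin \o (fun x => c * 1 - inner v (g x))) /\
  \int[L]_x (K x * (c * 1 - inner v (g x))) = c * \int[L]_x K x - \int[L]_x (K x * inner v (g x)).
Proof.
move=> bK; have i0 := integrable_cst1 (@arclength_lty R).
have iv K' : bmeas K' -> L.-integrable setT (EFin \o (fun x => K' x * inner v (g x))).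
  move=> bK'; have [|//] := @Rintegral_inner R n _ _ L K' (fun=> v) g.
  by move=> i; apply: bmeas_integrable_mul => //; exact: (integrableRZl _ (g_L1 i)).
split.
  have := iv _ (ccont_bmeas (@ccont_cst R 1)).
  move=> /(integrableB measurableT (integrableRZl c i0)).
  by congr (_.-integrable _ _); apply/funext => x /=; rewrite mul1r.
have iK : L.-integrable setT (EFin \o K).
  have := bmeas_integrable_mul bK i0.
  by congr (_.-integrable _ _); apply/funext => x /=; rewrite mulr1.
rewrite -RintegralZl// -RintegralB//; [|exact: integrableRZl|exact: iv].
by apply: eq_Rintegral => x _; rewrite mulr1; ring.
Qed.

Lemma rho_inner_integrable v : nu.-integrable setT (EFin \o (fun x => - inner v (rho x))).
Proof.
have [|+ _] := @Rintegral_inner R n _ _ nu (fun=> -1) (fun=> v) rho.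
  move=> i; apply: bmeas_integrable_mul; first exact: ccont_bmeas (@ccont_cst R (-1)).
  by apply: integrableRZl; exact: rho_integrable.
by congr (_.-integrable _ _); apply/funext => x /=; rewrite mulN1r.
Qed.

(** Harnack's inequality for a harmonic function with nonnegative boundary measure: [g] lies in the
    closure of the base, [rho] in [S_ D]. The quantitative form is what will place [phi] in the open
    set [D] and not only in its closure. *)
Lemma Re_boundary_harnack v (c : R) l : cmod l < 1 ->
  (forall x, base D x -> inner x v <= c) ->
  harnack (cmod l) * (c - inner v (ReCn (phi 0))) <= c - inner v (ReCn (phi l)).
Proof.
move=> l1 Hv; have pi2 : 0 < 2 * pi :> R by rewrite mulr_gt0// pi_gt0.
have E w : cmod w < 1 -> 2 * pi * (c - inner v (ReCn (phi w))) =
    \int[L]_x (poisson (cval x) w * (c * 1 - inner v (g x))) +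
    \int[nu]_x (poisson (cval x) w * (- inner v (rho x))).
  move=> w1; have bP := ccont_bmeas (ccont_poisson w1).
  rewrite (Re_boundary_inner phi_mu g_L1 rho_borel rho_sphere mu_decomp)//.
  rewrite (proj2 (Rintegral_affine v c bP)) (proj1 (Rintegral_herglotz w1)).
  have -> : \int[nu]_x (poisson (cval x) w * (- inner v (rho x))) =
      - \int[nu]_x (poisson (cval x) w * inner v (rho x)).
    have i1 := bmeas_integrable_mul bP (rho_inner_integrable v).
    rewrite -[LHS]mul1r -[1]opprK mulNr -RintegralZl//; congr (- _).
    by apply: eq_Rintegral => x _; ring.
  by rewrite mulrBr [X in _ - X]mulrA mulfV ?gt_eqF// mul1r; ring.
have z1 : cmod (0 : C R) < 1 by rewrite cmod0.
rewrite -(ler_pM2l pi2) mulrCA (E 0 z1) (E l l1) mulrDr.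
have [i1 _] := Rintegral_affine v c (ccont_bmeas (@ccont_cst R 1)).
have i2 := rho_inner_integrable v.
have b0 := ccont_bmeas (ccont_poisson z1); have bl := ccont_bmeas (ccont_poisson l1).
have bk := ccont_bmeas (@ccont_cst R (harnack (cmod l))).
have kP x : harnack (cmod l) <= poisson (cval x) l.
  by have [] := andP (poisson_bounds (cmod_cval x) (lexx (cmod l)) l1).
apply: lerD.
  rewrite -RintegralZl//; last exact: bmeas_integrable_mul.
  under eq_Rintegral do rewrite poisson0 mul1r.
  apply: Rintegral_weight_le => //; apply: filterS g_P => x [cg _].
  by rewrite mulr1 subr_ge0 innerC; exact: closure_halfspace Hv cg.
rewrite -RintegralZl//; last exact: bmeas_integrable_mul.
under eq_Rintegral do rewrite poisson0 mul1r.
apply: Rintegral_weight_le => //; apply: filterS rho_S => x Sx.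
by rewrite oppr_ge0 innerC; apply: Sx; apply/W_P; exists c.
Qed.

(** Applied to all half-spaces with the same constant [k], Harnack's inequality says that
    [ReCn (phi l)] is [k] times the interior point [ReCn (phi 0)] plus [1 - k] times a point [y] of
    the closure. *)
Lemma phi_base l : cmod l < 1 -> base D (ReCn (phi l)).
Proof.
move=> l1; have [->//|l0] := eqVneq l 0.
have [B0 oB _] := tube_base tD; have cB := tube_base_convex tD cD.
have [v [c [Hv Hc]]] := closure_halfspaces cB B0.
have lp : 0 < cmod l by rewrite cmod_gt0.
set k := harnack (cmod l); have k0 : 0 < k by apply: harnack_gt0 => //; exact: ltW.
have k1 : k < 1 by rewrite /k /harnack ltr_pdivrMr//; lra.
pose y := (1 - k)^-1 *: (ReCn (phi l) - k *: ReCn (phi 0)).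
have cy : closure (base D) y.
  apply: Hc => j; rewrite /y innerZl innerBl innerZl mulrC ler_pdivrMr ?subr_gt0//.
  have := Re_boundary_harnack l1 (Hv j); rewrite -/k !(innerC (v j)); lra.
have k01 : 0 < k <= 1 by rewrite k0 ltW.
have := open_convex_comb cB oB phi0 cy k01; rewrite /y scalerA mulfV ?scale1r.
  by rewrite addrC subrK.
by rewrite subr_eq0 eq_sym lt_eqF.
Qed.

(** The number [m] is the mean of [inner (hfield a b y) (g y - ReCn z)], positive by the strictness
    in (i). The singular part has a favourable sign by (ii), and each Poisson kernel is bounded
    below by its Harnack constant. *)
Lemma qform_negative z : D z -> exists2 m : R, 0 < m & forall l t, cmod l < 1 -> cmod t < 1 ->
  pick_form l t (qform phi a b z l) (qform phi a b z t) <=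
  - (cmod (l - t) ^+ 2 * cmod (1 - t^* * l) ^+ 2 * (m * (harnack (cmod l) * harnack (cmod t)))).
Proof.
move=> /(tube_mem tD) Dz; set x := ReCn z in Dz.
have [+ _] := hfield_integrable_arclength g_L1 a b x (@ccont_cst R (-1)).
set u := fun y => -1 * _ => iu.
have u0 : {ae L, forall y, 0 < u y}.
  by apply: filterS g_P => y [_ /(_ _ Dz)]; rewrite /u mulN1r oppr_gt0 innerC.
have u0' : {ae L, forall y, 0 <= u y} by apply: filterS u0 => y /ltW.
have [+ _] := hfield_integrable_nu nu rho_borel rho_sphere a b (@ccont_cst R 1).
set w := fun y => 1 * _ => iw.
have w0 : {ae nu, forall y, 0 <= w y} by apply: filterS rho_ge0 => y; rewrite /w mul1r.
have pi2 : 0 < 2 * pi :> R by rewrite mulr_gt0// pi_gt0.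
have LT : (0 < L setT)%E by rewrite arclength_setT lte_fin.
have Iu := Rintegral_ae_gt0 iu u0 LT.
exists ((2 * pi)^-1 * \int[L]_y u y) => [|l t l1 t1]; first by rewrite mulr_gt0// invr_gt0.
rewrite (pick_form_qform g_L1 rho_borel rho_sphere phi_mu mu_decomp)// -[X in _ <= X]mulrN.
apply: ler_wpM2l; first by rewrite mulr_ge0// exprn_ge0// cmod_ge0.
rewrite -mulrA -mulrN ler_pM2l ?invr_gt0// lerNr.
set k := harnack _ * harnack _.
have cP := ccont_poisson2 l1 t1; have bP := ccont_bmeas cP.
have bk := ccont_bmeas (@ccont_cst R k); have b0 := ccont_bmeas (@ccont_cst R 0).
have kP y : k <= poisson2 l t y.
  have [h1 _] := andP (poisson_bounds (cmod_cval y) (lexx (cmod l)) l1).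
  have [h2 _] := andP (poisson_bounds (cmod_cval y) (lexx (cmod t)) t1).
  by apply: ler_pM => //; apply: ltW; apply: harnack_gt0 => //; exact: cmod_ge0.
have k0 : 0 <= k by rewrite mulr_ge0// ltW// harnack_gt0 ?cmod_ge0.
have h1 : k * \int[L]_y u y <= \int[L]_y (poisson2 l t y * u y).
  by rewrite -RintegralZl//; exact: Rintegral_weight_le.
have h2 : 0 <= \int[nu]_y (poisson2 l t y * w y).
  have := Rintegral_weight_le b0 bP (fun y => le_trans k0 (kP y)) iw w0.
  by under eq_Rintegral do rewrite mul0r; rewrite Rintegral_cst// mul0r.
have -> : - qmass g rho nu a b z l t =
    \int[L]_y (poisson2 l t y * u y) + \int[nu]_y (poisson2 l t y * w y).
  rewrite /qmass opprB addrC; congr (_ + _).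
    have i1 := bmeas_integrable_mul bP iu.
    rewrite -[RHS]opprK; congr (- _); rewrite -mulN1r -RintegralZl//.
    by apply: eq_Rintegral => y _; rewrite /u -/x; ring.
  by apply: eq_Rintegral => y _; rewrite /w mul1r.
by rewrite mulrC; apply: le_trans h1 _; rewrite lerDl.
Qed.

End sufficient_conditions.

(** Every [u s - K * s] lies below every [u t + K * t]; the supremum of the former is the limit of
    [u] at [0]. *)
Lemma lipschitz_limit (R : realType) (u : R -> R) (K : R) :
  (forall s t : R, 0 < s -> 0 < t -> `|u s - u t| <= K * `|s - t|) ->
  exists x, forall s : R, 0 < s -> `|u s - x| <= K * s.
Proof.
move=> H; pose A := [set u s - K * s | s in [set s : R | 0 < s]].
have le (s t : R) : 0 < s -> 0 < t -> u s - K * s <= u t + K * t.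
  move=> s0 t0; have K0 : 0 <= K.
    have := H (t + 1) t; rewrite addrAC subrr add0r normr1 mulr1; move=> h.
    by apply: le_trans (h _ _) => //; rewrite ltr_wpDl// ltW.
  have := H s t s0 t0; have st : `|s - t| <= s + t.
    by apply: le_trans (ler_normB _ _) _; rewrite !gtr0_norm.
  have := ler_wpM2l K0 st; have := ler_norm (u s - u t); lra.
have sA : has_sup A.
  split; first by exists (u 1 - K * 1); exists 1 => //=; exact: ltr01.
  by exists (u 1 + K * 1) => _ [s s0 <-]; exact: le.
exists (sup A) => s s0.
have h1 : u s - K * s <= sup A by apply: sup_upper_bound => //; exists s.
have h2 : sup A <= u s + K * s.
  by apply: ge_sup; [exact: sA.1|move=> _ [t t0 <-]; exact: le].
by rewrite ler_norml; apply/andP; split; lra.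
Qed.

Section row_forms.
Context {R : realType} {n : nat}.
Implicit Types (w : 'rV[C R]_n) (a : 'I_n -> C R) (b : 'I_n -> R) (l t : C R).

Definition vmod w : R := ReC `|w|.

Lemma vmodE w : `|w| = mkC (vmod w) 0.
Proof.
by have : 0 <= `|w| by []; rewrite lecE => /andP[/eqP h _]; apply: Ceq; rewrite ReImE.
Qed.

Lemma vmod_ge0 w : 0 <= vmod w.
Proof. by have : 0 <= `|w| by []; rewrite vmodE lecE => /andP[]. Qed.

Lemma le_vmod w (e : R) : (`|w| <= mkC e 0) = (vmod w <= e).
Proof. by rewrite vmodE lecE /= eqxx. Qed.

Lemma vmodZ l w : vmod (l *: w) = cmod l * vmod w.
Proof. by rewrite {1}/vmod normrZ vmodE normCE -mkCM. Qed.

Lemma cmod_coord w i : cmod (w 0 i) <= vmod w.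
Proof. by rewrite -le_normC_mk -vmodE; exact: coord_le_norm. Qed.

Definition row_form (c : 'I_n -> C R) w : C R := \sum_(i < n) c i * w 0 i.

Lemma row_form_linear c : linear (row_form c : 'rV[C R]_n -> (C R)^o).
Proof.
move=> k u v; rewrite /row_form scaler_sumr -big_split; apply: eq_bigr => i _ /=.
by rewrite !mxE -[k *: _]/(k * _); ring.
Qed.

HB.instance Definition _ c := GRing.isLinear.Build (C R) 'rV[C R]_n (C R)^o *:%R
  (row_form c) (row_form_linear c).

Lemma row_form_le (c : 'I_n -> C R) (M : 'I_n -> R) w : (forall i, cmod (c i) <= M i) ->
  cmod (row_form c w) <= (\sum_(i < n) M i) * vmod w.
Proof.
move=> cM; rewrite /row_form mulr_suml.
have H (I : Type) (s : seq I) (F : I -> C R) (G : I -> R) : (forall i, cmod (F i) <= G i) ->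
    cmod (\sum_(i <- s) F i) <= \sum_(i <- s) G i.
  move=> FG; elim: s => [|i s IH]; first by rewrite !big_nil cmod0.
  by rewrite !big_cons; apply: le_trans (cmodD _ _) _; exact: lerD.
apply: H => i; rewrite cmodM; apply: ler_pM; rewrite ?cmod_ge0//; exact: cmod_coord.
Qed.

Lemma row_form_continuous c : continuous (row_form c).
Proof.
move=> w; have dw : differentiable (row_form c) w; last exact: differentiable_continuous.
  have -> : row_form c = \sum_(i < n) (fun w : 'rV[C R]_n => c i * w 0 i).
    by apply/funext => v; rewrite fct_sumE.
  apply: differentiable_sum => i; apply: differentiableM => //.
  exact: differentiable_coord.
Qed.

Definition hform a b l := row_form (fun i => hpoly (a i) (b i) l).

Lemma cmod_hpoly (p : C R) (q : R) l : cmod l <= 1 -> cmod (hpoly p q l) <= 2 * cmod p + `|q|.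
Proof.
move=> l1; have p0 := cmod_ge0 p; have l0 := cmod_ge0 l.
rewrite /hpoly; have := cmodD (p^* + mkC q 0 * l) (p * l ^+ 2).
have := cmodD p^* (mkC q 0 * l); rewrite !cmodM cmodJ cmod_mk0.
have : `|q| * cmod l <= `|q| by rewrite ler_piMr.
have : cmod p * (cmod l * cmod l) <= cmod p by rewrite ler_piMr// mulr_ile1.
lra.
Qed.

Lemma hpoly_lipschitz (p : C R) (q : R) l t : cmod l <= 1 -> cmod t <= 1 ->
  cmod (hpoly p q l - hpoly p q t) <= (2 * cmod p + `|q|) * cmod (l - t).
Proof.
move=> l1 t1.
have -> : hpoly p q l - hpoly p q t = (mkC q 0 + p * (l + t)) * (l - t) by rewrite /hpoly; ring.
rewrite cmodM ler_wpM2r ?cmod_ge0//; apply: le_trans (cmodD _ _) _.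
rewrite cmod_mk0 cmodM addrC lerD2r mulrC ler_wpM2r ?cmod_ge0//.
by apply: le_trans (cmodD _ _) _; lra.
Qed.

Lemma hform_bounds a b : exists2 c : R, 0 <= c & forall l t w, cmod l <= 1 -> cmod t <= 1 ->
  cmod (hform a b l w) <= c * vmod w /\
  cmod (hform a b l w - hform a b t w) <= c * cmod (l - t) * vmod w.
Proof.
exists (\sum_(i < n) (2 * cmod (a i) + `|b i|)).
  by apply: sumr_ge0 => i _; rewrite addr_ge0// mulr_ge0// cmod_ge0.
move=> l t w l1 t1; split; first by apply: row_form_le => i; exact: cmod_hpoly.
rewrite /hform /row_form -sumrB.
under eq_bigr do rewrite -mulrBl.
rewrite mulr_suml; apply: (row_form_le (c := fun i => hpoly (a i) (b i) l - hpoly (a i) (b i) t)).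
by move=> i; exact: hpoly_lipschitz.
Qed.

Lemma differentiable_hpoly (p : C R) (q : R) l : differentiable (hpoly p q) l.
Proof.
apply: differentiableD; last by apply: differentiableM => //; exact: differentiable_pow.
by apply: differentiableD => //; exact: differentiableM.
Qed.

(** The radial expansion [l] has a positive form at distinct points, and for fixed [t] the form
    stays away from [0] as [l] approaches the circle. *)
Lemma pick_form_id l t :
  pick_form l t l t = cmod (l - t) ^+ 2 * (1 - cmod (t^* * l) ^+ 2).
Proof.
apply: mkC0_inj; rewrite /= pick_formE mkCM mkC_cmod.
have -> : mkC (1 - cmod (t^* * l) ^+ 2) 0 = 1 - (t^* * l) * (t^* * l)^*.
  by rewrite -mkC_cmod; apply: Ceq; rewrite !ReImE ?oppr0 ?addr0.
by rewrite !cjE /pickC; field.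
Qed.

End row_forms.

(** * The zero of the perturbed field and the left inverse *)

Section zero_function.
Context {R : realType} {n : nat} (D : set 'rV[C R]_n) (phi : C R -> 'rV[C R]_n).
Context (a : 'I_n -> C R) (b : 'I_n -> R).
Implicit Types (z w : 'rV[C R]_n) (l t : C R) (e : R).
Notation Q := (qform phi a b).
Context (tD : tube_domain D).
Context (cD : convex_set D).
Context (phi_holo : holomorphic_on (@unit_disc R) phi).
Context (phiD : forall l, cmod l < 1 -> D (phi l)).
Context (HQ : forall z, D z -> exists2 m : R, 0 < m &
  forall l t, cmod l < 1 -> cmod t < 1 -> pick_form l t (Q z l) (Q z t) <=
  - (cmod (l - t) ^+ 2 * cmod (1 - t^* * l) ^+ 2 * (m * (harnack (cmod l) * harnack (cmod t))))).

Definition qpert e z l : C R := Q z l - mkC e 0 * l.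

Lemma qpertD e z w l : qpert e (z + w) l = qpert e z l + hform a b l w.
Proof.
rewrite /qpert addrAC; congr (_ - _); rewrite /qform /hform /row_form -big_split.
by apply: eq_bigr => i _; rewrite !mxE /=; ring.
Qed.

Lemma qpert_phi0 e : qpert e (phi 0) 0 = 0.
Proof. by rewrite /qpert mulr0 subr0 /qform big1// => i _; rewrite subrr mulr0. Qed.

Lemma qpert0_phi l : qpert 0 (phi l) l = 0.
Proof. by rewrite /qpert mul0r subr0 /qform big1// => i _; rewrite subrr mulr0. Qed.

Lemma differentiable_qpert e z l : cmod l < 1 -> differentiable (qpert e z) l.
Proof.
move=> l1; apply: differentiableB; last exact: differentiableM.
have -> : Q z = \sum_(i < n) (fun l => hpoly (a i) (b i) l * (z 0 i - phi l 0 i)).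
  by apply/funext => t; rewrite fct_sumE.
apply: differentiable_sum => i; apply: differentiableM; first exact: differentiable_hpoly.
apply: differentiableB => //; apply: differentiable_entry.
by apply: phi_holo; exact/unit_discE.
Qed.

(** At a zero [t] the form depends on the value at [l] alone, by [pick_form0]. Bounding its real
    part by a modulus turns the upper bound for the form into a lower bound for [qpert] in terms of
    the distance to the zero. *)
Lemma qpert_lower z : D z -> exists2 m : R, 0 < m & forall e l t,
  0 <= e -> cmod l < 1 -> cmod t < 1 -> qpert e z t = 0 ->
  cmod (l - t) * (cmod (1 - t^* * l) ^+ 2 * (m * (harnack (cmod l) * harnack (cmod t))) +
    e * (1 - cmod (t^* * l) ^+ 2)) <= cmod (qpert e z l) * cmod (1 - t^* * l).
Proof.
move=> Dz; have [m m0 Hm] := HQ Dz; exists m => // e l t e0 l1 t1 F0.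
have [->|lt] := eqVneq l t; first by rewrite subrr cmod0 mul0r F0 cmod0 mul0r.
have lt0 : 0 < cmod (l - t) by rewrite cmod_gt0 subr_eq0.
have := Hm l t l1 t1.
have E x : Q z x = qpert e z x + mkC e 0 * x by rewrite /qpert subrK.
rewrite !E pick_formD pick_formZ pick_form_id F0 pick_form0.
set A := qpert e z l; set k := m * _; set y := 1 - t^* * l; set x := l - t in lt0 *.
have h1 : - (cmod A * (cmod x * cmod y)) <= (1 - cmod t ^+ 2) * ReC (A * (x * y)^*).
  have t2 : 0 <= cmod t ^+ 2 <= 1 by rewrite exprn_ge0 ?cmod_ge0//= expr_le1 ?cmod_ge0// ltW.
  have := normr_ReC (A * (x * y)^*); rewrite cmodM cmodJ cmodM ler_norml => /andP[h _].
  have p0 : 0 <= cmod A * (cmod x * cmod y) by rewrite !mulr_ge0 ?cmod_ge0.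
  by move: t2 => /andP[? ?]; nra.
move=> h; rewrite -(ler_pM2l lt0); move: h h1; set p := (_ - _) * ReC _; set q := cmod (t^* * l) ^+ 2.
by move: (cmod A) (cmod x) (cmod y) k p q => A' X Y k' p q; lra.
Qed.

Lemma qpert_inj e z l t : 0 <= e -> D z -> cmod l < 1 -> cmod t < 1 ->
  qpert e z l = 0 -> qpert e z t = 0 -> l = t.
Proof.
move=> e0 Dz l1 t1 Fl Ft; have [m m0 /(_ e l t e0 l1 t1 Ft)] := qpert_lower Dz.
rewrite Fl cmod0 mul0r => h; apply/eqP; rewrite -subr_eq0 -cmod_eq0; apply: contraT => lt.
have lt0 : 0 < cmod (l - t) by rewrite lt_def lt cmod_ge0.
move: h; rewrite pmulr_rle0// leNgt => /negP; case; apply: ltr_wpDr.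
  rewrite mulr_ge0// subr_ge0 expr_le1 ?cmod_ge0// cmodM cmodJ.
  by rewrite mulr_ile1 ?cmod_ge0// ltW.
have kp : 0 < harnack (cmod l) * harnack (cmod t).
  by apply: mulr_gt0; apply: harnack_gt0 => //; exact: cmod_ge0.
have yp : 0 < cmod (1 - t^* * l) by rewrite cmod_gt0 blaschke_den_neq0// ltW.
by apply: mulr_gt0; [exact: exprn_gt0|exact: mulr_gt0].
Qed.

(** The constant does not depend on [e], so the estimate survives the limit [e = 0]; it comes from
    the Harnack term, which is bounded below on the disc of radius [r]. *)
Lemma qpert_lower_disc z (r : R) : D z -> r < 1 -> exists2 c : R, 0 < c &
  forall e l t, 0 <= e -> cmod l <= r -> cmod t <= r -> qpert e z t = 0 ->
  c * cmod (l - t) <= cmod (qpert e z l).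
Proof.
move=> Dz r1; have [m m0 H] := qpert_lower Dz.
have [r0|r0] := ltP r 0.
  by exists 1 => // e l t _ lr; have := le_trans (cmod_ge0 l) lr; rewrite leNgt r0.
exists ((1 - r) * (m * (harnack r * harnack r))).
  have h0 := harnack_gt0 r0 r1.
  by rewrite (mulr_gt0 _ (mulr_gt0 m0 (mulr_gt0 h0 h0)))// subr_gt0.
move=> e l t e0 lr tr Ft; have l1 := le_lt_trans lr r1; have t1 := le_lt_trans tr r1.
have := H e l t e0 l1 t1 Ft; set y := 1 - t^* * l.
have yp : 0 < cmod y by rewrite cmod_gt0 blaschke_den_neq0// ltW.
have yr : 1 - r <= cmod y.
  have := blaschke_den_ge t l; have : cmod t * cmod l <= r * 1.
    by rewrite ler_pM ?cmod_ge0// ltW.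
  rewrite -/y; lra.
have k0 : 0 <= e * (1 - cmod (t^* * l) ^+ 2).
  rewrite mulr_ge0// subr_ge0 expr_le1 ?cmod_ge0// cmodM cmodJ.
  by rewrite mulr_ile1 ?cmod_ge0// ltW.
have hk x : 0 <= x -> x <= r -> harnack r <= harnack x.
  move=> x0 xr; rewrite /harnack ler_pdivrMr; last by lra.
  by rewrite mulrAC ler_pdivlMr; last lra; nra.
have h0 := harnack_gt0 r0 r1.
have kk : harnack r * harnack r <= harnack (cmod l) * harnack (cmod t).
  by rewrite ler_pM ?(ltW h0)// hk ?cmod_ge0.
rewrite mulrDr => h; rewrite -(ler_pM2r yp); apply: le_trans h.
apply: (@le_trans _ _ (cmod (l - t) * (cmod y ^+ 2 * (m * (harnack (cmod l) * harnack (cmod t))))));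
  last by rewrite lerDl mulr_ge0 ?cmod_ge0.
have -> : (1 - r) * (m * (harnack r * harnack r)) * cmod (l - t) * cmod y =
   cmod (l - t) * ((1 - r) * cmod y * (m * (harnack r * harnack r))) by ring.
rewrite ler_wpM2l ?cmod_ge0// ler_pM//.
- by rewrite mulr_ge0 ?cmod_ge0// subr_ge0 ltW.
- by rewrite ltW// (mulr_gt0 m0 (mulr_gt0 h0 h0)).
- by rewrite expr2 ler_wpM2r ?cmod_ge0.
- by rewrite ler_wpM2l// ltW.
Qed.

(** An implicit function argument without continuity of [f] as an assumption: [qpert_lower_disc]
    shows that the zero is simple and that [f] is Lipschitz at [z]. The derivative is then
    [- k^-1 * hform a b l w]. The bound [r] keeps all the zeros in a disc on which one constant
    serves. *)
Lemma qpert_zero_differentiable e f z (r d : R) : 0 <= e -> r < 1 -> 0 < d ->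
  (forall w, vmod w <= d ->
    [/\ D (z + w), qpert e (z + w) (f (z + w)) = 0 & cmod (f (z + w)) <= r]) ->
  differentiable f z.
Proof.
move=> e0 r1 d0 H.
have v0 : vmod (0 : 'rV[C R]_n) = 0 by rewrite /vmod normr0.
have := H 0; rewrite v0 addr0 => /(_ (ltW d0)) [Dz F0 lr]; set l := f z in F0 lr.
have r0 : 0 <= r := le_trans (cmod_ge0 l) lr.
have r'1 : (1 + r) / 2 < 1 by lra.
have rr : r <= (1 + r) / 2 by lra.
have [c c0 Hc] := qpert_lower_disc Dz r'1.
have [M M0 HM] := hform_bounds a b.
have l1 : cmod l < 1 := le_lt_trans lr r1.
have dG := differentiable_qpert e z l1; set G := qpert e z in dG F0.
set k := cderiv G l.
(* A multiple zero would violate the linear lower bound at [l + s] for small [s]. *)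
have k0 : k != 0.
  apply/eqP => kE; have c2 : 0 < c / 2 by rewrite divr_gt0.
  have [h h0 Hh] := cdifferentiable_near dG c2.
  pose s := Num.min h ((1 - r) / 2).
  have s0 : 0 < s by rewrite lt_min h0 /=; lra.
  have sh : s <= h by rewrite ge_min lexx.
  have sr : s <= (1 - r) / 2 by rewrite ge_min lexx orbT.
  have cs : cmod (mkC s 0 : C R) = s by rewrite cmod_mk0 gtr0_norm.
  have := Hh (mkC s 0); rewrite cs -/k kE mul0r subr0 F0 subr0 => /(_ sh).
  have lr' := le_trans lr rr.
  have lsr : cmod (l + mkC s 0) <= (1 + r) / 2 by have := cmodD l (mkC s 0); rewrite cs; lra.
  have lE : l + mkC s 0 - l = mkC s 0 by rewrite addrC addKr.
  have := Hc e (l + mkC s 0) l e0 lsr lr' F0; rewrite lE cs -/G.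
  have : 0 < c * s by rewrite mulr_gt0.
  lra.
pose L := row_form (fun i => - k^-1 * hpoly (a i) (b i) l).
have LE w : L w = - k^-1 * hform a b l w.
  by rewrite /L /hform /row_form mulr_sumr; apply: eq_bigr => i _; rewrite mulrA.
pose B := M / c; have B0 : 0 <= B by rewrite divr_ge0// ltW.
have near w : vmod w <= d -> cmod (f (z + w) - l) <= B * vmod w.
  move=> wd; have [_ Fw wr] := H w wd; set l' := f (z + w) in Fw wr *.
  have lr' := le_trans lr rr.
  have lr'' := le_trans wr rr.
  have := Hc e l' l e0 lr'' lr' F0.
  move: Fw; rewrite qpertD => /eqP; rewrite addr_eq0 => /eqP ->; rewrite cmodN.
  have l'1 := le_trans wr (ltW r1).
  have [h _] := HM l' l' w l'1 l'1.
  by move=> h2; rewrite /B mulrAC ler_pdivlMr// mulrC; exact: le_trans h.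
apply: (proj1 (@differentiable_intro R 'rV[C R]_n (C R) f z L (@row_form_continuous R n _) _)).
move=> h h0; have K0 : 0 < cmod k^-1 by rewrite cmod_gt0 invr_eq0.
set K := cmod k^-1 in K0.
have B1 : 0 < B + 1 by lra.
have h1 : 0 < h / (2 * K * (B + 1)) by rewrite divr_gt0// !mulr_gt0.
have [q q0 Hq] := cdifferentiable_near dG h1.
have KMB : 0 <= K * M * B by rewrite mulr_ge0// mulr_ge0// ltW.
pose d' := Num.min d (Num.min (q / (B + 1)) (h / (2 * (K * M * B + 1)))).
have d'0 : 0 < d'.
  rewrite !lt_min d0 /=; apply/andP; split; first by rewrite divr_gt0.
  by rewrite divr_gt0// mulr_gt0// ltr_wpDl.
exists d' => // w; rewrite le_vmod -/l => wd'.
have wd : vmod w <= d by apply: le_trans wd' _; rewrite ge_min lexx.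
have wq : vmod w * (B + 1) <= q.
  by rewrite -ler_pdivlMr//; apply: le_trans wd' _; rewrite !ge_min lexx !orbT.
have wh : vmod w * (2 * (K * M * B + 1)) <= h.
  rewrite -ler_pdivlMr; last by rewrite mulr_gt0// ltr_wpDl.
  by apply: le_trans wd' _; rewrite !ge_min lexx !orbT.
have vw := vmod_ge0 w; have hw := near w wd; have [_ Fw wr] := H w wd.
set l' := f (z + w) in hw Fw wr *; set x := l' - l in hw.
have xl : l + x = l' by rewrite /x addrC subrK.
have xq : cmod x <= q.
  apply: le_trans hw _; apply: le_trans wq; by rewrite mulrC ler_wpM2l// lerDl.
have := Hq x xq; rewrite F0 subr0 -/k xl.
move: Fw; rewrite qpertD -/G => /eqP; rewrite addr_eq0 => /eqP -> err.
have E : x - L w = - k^-1 * ((- hform a b l' w - k * x) + (hform a b l' w - hform a b l w)).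
  by rewrite LE; field.
have l'1 := le_trans wr (ltW r1).
have [_ hl] := HM l' l w l'1 (ltW l1).
have e1 : h / (2 * K * (B + 1)) * cmod x <= h / (2 * K) * vmod w.
  apply: (@le_trans _ _ (h / (2 * K * (B + 1)) * ((B + 1) * vmod w))).
    rewrite ler_wpM2l ?(ltW h1)//; apply: le_trans hw _.
    by rewrite mulrDl mul1r lerDl.
  by apply: eq_ler; field; rewrite !gt_eqF.
have e2 : M * cmod (l' - l) * vmod w <= M * B * vmod w * vmod w.
  by rewrite ler_wpM2r// -mulrA ler_wpM2l.
have e3 : K * (M * B * vmod w * vmod w) <= h / 2 * vmod w.
  have -> : K * (M * B * vmod w * vmod w) = vmod w * (K * M * B) * vmod w by ring.
  by rewrite ler_wpM2r//; clear -wh vw; lra.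
have e4 : K * (h / (2 * K) * vmod w) = h / 2 * vmod w by field; rewrite gt_eqF.
rewrite vmodE -mkCM le_normC_mk -/l' -/l -/x E cmodM cmodN -/K.
apply: (@le_trans _ _ (K * (h / (2 * K) * vmod w + M * B * vmod w * vmod w))).
  rewrite ler_wpM2l ?(ltW K0)//; apply: le_trans (cmodD _ _) _; apply: lerD.
    exact: le_trans e1.
  exact: le_trans e2.
by rewrite mulrDr e4; clear -e3; lra.
Qed.

(* Without a zero, [l / qpert e z l] would be holomorphic, vanish at [0] and have
   negative real part on a circle close to the unit circle. *)
Lemma qpert_zero_exists e z : 0 < e -> D z -> exists l, cmod l < 1 /\ qpert e z l = 0.
Proof.
move=> e0 Dz; apply: contrapT => none.
have nz l : cmod l < 1 -> qpert e z l != 0.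
  by move=> l1; apply/eqP => F0; apply: none; exists l.
have z1 : cmod (0 : C R) < 1 by rewrite cmod0.
set B := qpert e z 0; have B0 := cmod_ge0 B.
(* On the circle of radius [r = 1 - s] the form at [l], [0] bounds the real part of
   [l^* * qpert e z l] by [(1 - r ^+ 2) * ReC (l^* * B) - e * r ^+ 2]; this [s] makes the second
   term prevail. *)
pose s := Num.min (1 / 2) (e / (8 * (cmod B + 1))).
have B1 : 0 < 8 * (cmod B + 1) by rewrite mulr_gt0// ltr_wpDl.
have s0 : 0 < s by rewrite lt_min divr_gt0//= divr_gt0.
have s2 : s <= 1 / 2 by rewrite ge_min lexx.
have sB : s * (8 * (cmod B + 1)) <= e by rewrite -ler_pdivlMr// ge_min lexx orbT.
pose r := 1 - s; have r0 : 0 < r by rewrite /r; lra.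
have r1 : r < 1 by rewrite /r; lra.
have neg l : cmod l = r -> ReC (l / qpert e z l) < 0.
  move=> lr; have l1 : cmod l < 1 by rewrite lr.
  set A := qpert e z l; have An : A != 0 := nz l l1.
  have [m m0 Hm] := HQ Dz; have := Hm l 0 l1 z1.
  have E x : Q z x = qpert e z x + mkC e 0 * x by rewrite /qpert subrK.
  rewrite !E pick_formD pick_formZ pick_form_id -/A -/B /pick_form cj0 mul0r !subr0.
  rewrite cmod1 expr1n cj1 !mul0r cmod0 expr0n /= !mulr1 subr0 mulr1 mul1r addr0 => h.
  have k0 : 0 <= cmod l ^+ 2 * (m * (harnack (cmod l) * harnack 0)).
    rewrite mulr_ge0 ?exprn_ge0 ?cmod_ge0// ltW// (mulr_gt0 m0)//.
    by apply: mulr_gt0; apply: harnack_gt0 => //; exact: cmod_ge0.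
  have lB : ReC (l^* * B) <= r * cmod B by have := ReC_le (l^* * B); rewrite cmodM cmodJ lr.
  have BE : ReC (B^* * l) = ReC (l^* * B) by rewrite !ReImE; ring.
  have lA : ReC (l^* * (A - B)) = ReC (l^* * A) - ReC (l^* * B) by rewrite mulrBr ReCD ReCN.
  rewrite BE lA lr in h.
  have neg : ReC (l^* * A) < 0.
    have q1 : ReC (l^* * A) <= (1 - r ^+ 2) * ReC (l^* * B) - e * r ^+ 2 by rewrite lr in k0; clear -h k0; lra.
    have q2 : 1 - r ^+ 2 <= 2 * s by rewrite /r; nra.
    have q3 : 0 <= 1 - r ^+ 2 by rewrite subr_ge0 expr_le1 ?ltW.
    have q4 : (1 - r ^+ 2) * ReC (l^* * B) <= (1 - r ^+ 2) * (r * cmod B) by rewrite ler_wpM2l.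
    have q5 : (1 - r ^+ 2) * (r * cmod B) <= 2 * s * (r * cmod B).
      by rewrite ler_wpM2r// mulr_ge0// ltW.
    have q6 : r * (2 * (s * cmod B)) <= r * (e / 4) by rewrite ler_wpM2l ?(ltW r0)//; clear -sB s0; lra.
    have q7 : r * (e / 4) < r * (e * r) by rewrite ltr_pM2l// /r; nra.
    by clear -q1 q2 q4 q5 q6 q7; lra.
  have -> : l / A = mkC (cmod A ^+ 2)^-1 0 * (l * A^*).
    have AC : mkC (cmod A ^+ 2)^-1 0 = (A * A^*)^-1 :> C R.
      have A2 : mkC (cmod A ^+ 2) 0 != 0 :> C R.
        by rewrite -cmod_gt0 cmod_mk0 normr_gt0 expf_neq0// cmod_eq0.
      apply: (mulIf A2); rewrite -mkCM mulVf ?expf_neq0 ?cmod_eq0//.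
      by rewrite mkC_cmod mulVf// -mkC_cmod.
    by rewrite AC; field; rewrite conjC_eq0 An.
  have -> : ReC (mkC (cmod A ^+ 2)^-1 0 * (l * A^*)) = (cmod A ^+ 2)^-1 * ReC (l^* * A).
    by rewrite !ReImE; ring.
  by rewrite pmulr_rlt0// invr_gt0 exprn_gt0// cmod_gt0.
pose G y : C R := mkC r 0 * y / qpert e z (mkC r 0 * y).
have ry y : cmod (mkC r 0 * y) = r * cmod y by rewrite cmodM cmod_mk0 gtr0_norm.
have ry1 y : cmod y <= 1 -> cmod (mkC r 0 * y) < 1.
  move=> y1; rewrite ry; apply: le_lt_trans r1.
  by rewrite ler_piMr// ltW.
have dG y : cmod y <= 1 -> differentiable G y.
  move=> y1; pose mr := fun y : C R => mkC r 0 * y.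
  have dm : differentiable mr y by exact: differentiableM.
  have dq : differentiable (qpert e z \o mr) y.
    exact: (differentiable_comp dm (differentiable_qpert e z (ry1 y y1))).
  exact: (differentiableM dm (differentiableV dq (nz _ (ry1 y y1)))).
have := mean_value dG; rewrite {2}/G mulr0 mul0r ReC0 mulr0 => I0.
have cG : ccont (fun x => - ReC (G (cval x))).
  rewrite (_ : (fun x => _) = (fun x => -1 * ReC (G (cval x)))).
    by apply: ccontZ; apply: (ccont_ReC (F := G)) => y y1; apply: dG; rewrite y1.
  by apply/funext => x; rewrite mulN1r.
have iG : (@arclength R).-integrable setT (EFin \o (fun x => - ReC (G (cval x)))).
  have := bmeas_integrable_mul (ccont_bmeas cG) (integrable_cst1 (@arclength_lty R)).
  by congr (_.-integrable _ _); apply/funext => x /=; rewrite mulr1.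
have pG x : setT x -> 0 < - ReC (G (cval x)).
  by move=> _; rewrite oppr_gt0; apply: neg; rewrite ry cmod_cval mulr1.
have := Rintegral_gt0 measurableT iG pG.
rewrite arclength_setT lte_fin mulr_gt0 ?pi_gt0// => /(_ isT).
have -> : \int[@arclength R]_x (- ReC (G (cval x))) = -1 * \int[@arclength R]_x (- - ReC (G (cval x))).
  rewrite -RintegralZl//; first by apply: eq_Rintegral => x _; rewrite mulN1r opprK.
  have := integrableRZl (-1) iG.
  by congr (_.-integrable _ _); apply/funext => x /=; rewrite mulN1r.
by under eq_Rintegral do rewrite opprK; rewrite I0 mulr0 ltxx.
Qed.

(** The choice is unambiguous for [z] in [D] and [0 <= e], by [qpert_inj]. *)
Definition qzero e z : C R :=
  if pselect (exists l, cmod l < 1 /\ qpert e z l = 0) is left p then projT1 (cid p) else 0.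

Lemma qzeroP e z : (exists l, cmod l < 1 /\ qpert e z l = 0) ->
  cmod (qzero e z) < 1 /\ qpert e z (qzero e z) = 0.
Proof. by move=> H; rewrite /qzero; case: pselect => // p; case: (cid p). Qed.

Lemma qzero_eq e z l : 0 <= e -> D z -> cmod l < 1 -> qpert e z l = 0 -> qzero e z = l.
Proof.
move=> e0 Dz l1 F0; have [|h1 h2] := @qzeroP e z; first by exists l.
exact: qpert_inj e0 Dz h1 l1 h2 F0.
Qed.

Lemma tube_near z : D z -> exists2 d : R, 0 < d & forall w, vmod w <= d -> D (z + w).
Proof.
move=> Dz; have [d d0 Hd] := tube_open_norm tD Dz; exists d => // w wd.
by apply: Hd; rewrite le_vmod.
Qed.

Lemma qzero_differentiable e z : 0 < e -> D z -> differentiable (qzero e) z.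
Proof.
move=> e0 Dz; have [d d0 Hd] := tube_near Dz.
have ee := ltW e0; have [t1 Ft] := qzeroP (qpert_zero_exists e0 Dz).
set t := qzero e z in t1 Ft; have [m m0 Hm] := qpert_lower Dz.
have [M M0 HM] := hform_bounds a b.
(* Within this radius the term with [e] in [qpert_lower] lets the zero move by at most
   [(1 - cmod t) / 2], so it stays in the disc of radius [(1 + cmod t) / 2]. *)
pose d' := Num.min d (e * (1 - cmod t) ^+ 2 / (4 * (M + 1))).
have M1 : 0 < 4 * (M + 1) by rewrite mulr_gt0// ltr_wpDl.
have t0 := cmod_ge0 t.
have t2 : 0 < (1 - cmod t) ^+ 2 by rewrite exprn_gt0// subr_gt0.
have d'0 : 0 < d' by rewrite lt_min d0 /= divr_gt0// mulr_gt0.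
have r1 : (1 + cmod t) / 2 < 1 by lra.
apply: (qpert_zero_differentiable ee r1 d'0) => w wd'.
have wd : vmod w <= d by apply: le_trans wd' _; rewrite ge_min lexx.
have wM : vmod w * (4 * (M + 1)) <= e * (1 - cmod t) ^+ 2.
  by rewrite -ler_pdivlMr//; apply: le_trans wd' _; rewrite ge_min lexx orbT.
have Dw := Hd w wd; have [l1 Fl] := qzeroP (qpert_zero_exists e0 Dw).
split => //; set l := qzero e (z + w) in l1 Fl *.
have := Hm e l t ee l1 t1 Ft; move: Fl; rewrite qpertD => /eqP; rewrite addr_eq0 => /eqP ->.
rewrite cmodN; have [hM _] := HM l l w (ltW l1) (ltW l1); have l0 := cmod_ge0 l.
have y2 : cmod (1 - t^* * l) <= 2.
  have := cmodB_le 1 (t^* * l); rewrite cmod1 cmodM cmodJ.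
  have : cmod t * cmod l <= 1 by rewrite mulr_ile1// ltW.
  lra.
have tl : cmod (t^* * l) ^+ 2 <= cmod t.
  rewrite cmodM cmodJ exprMn; apply: (@le_trans _ _ (cmod t ^+ 2 * 1)).
    by rewrite ler_wpM2l ?exprn_ge0// expr_le1// ltW.
  by rewrite mulr1 expr2 ler_piMl// ltW.
have kp : 0 <= cmod (1 - t^* * l) ^+ 2 * (m * (harnack (cmod l) * harnack (cmod t))).
  rewrite mulr_ge0 ?exprn_ge0 ?cmod_ge0// ltW// (mulr_gt0 m0)//.
  by apply: mulr_gt0; apply: harnack_gt0.
have lt0 := cmod_ge0 (l - t) => h.
have h2 : cmod (l - t) * (e * (1 - cmod t)) <= M * vmod w * 2.
  apply: (@le_trans _ _ (cmod (hform a b l w) * cmod (1 - t^* * l))).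
    apply: le_trans h; rewrite ler_wpM2l//; apply: (@le_trans _ _ (e * (1 - cmod (t^* * l) ^+ 2))).
      by rewrite ler_wpM2l// lerD2l lerN2.
    by rewrite lerDr.
  by rewrite ler_pM ?cmod_ge0.
have h3 : e * (1 - cmod t) * cmod (l - t) <= e * (1 - cmod t) * ((1 - cmod t) / 2).
  by have := vmod_ge0 w; rewrite expr2 in wM; clear -wM h2; lra.
move: h3; rewrite ler_pM2l; last by rewrite mulr_gt0// subr_gt0.
by have := cmodD (l - t) t; rewrite subrK; clear; lra.
Qed.

(** By Schwarz-Pick the two zeros [u] and [v] have pseudohyperbolic distance at most [1 / 2], so
    [(1 + |u|) (1 - |v|^2)] is at least [3 / 4 (1 - |u|)]. Each of the estimates [1 + |u| <= 2] and
    [1 + |v| <= 2] halves the constant. The result is independent of [e]. *)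
Lemma qzero_step e z w (r : R) : 0 < e -> (forall l, cmod l < 1 -> D (z + l *: w)) ->
  cmod (qzero e z) <= r ->
  cmod (qzero e (z + mkC (1 / 2) 0 *: w)) <= 1 - 3 / 16 * (1 - r).
Proof.
move=> e0 Dw pr; pose F l := qzero e (z + l *: w).
have dF l : cmod l < 1 -> differentiable F l.
  move=> l1; apply: (@differentiable_comp _ _ _ _ (fun l : C R => z + l *: w) (qzero e)).
    by apply: differentiableD => //; exact: differentiableZl.
  by apply: qzero_differentiable => //; exact: Dw.
have F1 l : cmod l < 1 -> cmod (F l) < 1.
  by move=> l1; have [] := qzeroP (qpert_zero_exists e0 (Dw l l1)).
have c1 : cmod (mkC (1 / 2) 0 : C R) = 1 / 2 by rewrite cmod_mk0 gtr0_norm.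
have z1 : cmod (0 : C R) < 1 by rewrite cmod0.
have h1 : cmod (mkC (1 / 2) 0 : C R) < 1 by rewrite c1; lra.
have := schwarz_pick dF F1 h1 z1; rewrite cj0 mul0r !subr0 cmod1 mulr1 c1.
have F0E : F 0 = qzero e z by rewrite /F scale0r addr0.
rewrite -/(F (mkC (1 / 2) 0)); rewrite -F0E in pr.
have p1 := F1 0 z1; have q1 := F1 _ h1.
set u := F 0 in pr p1 *; set v := F (mkC (1 / 2) 0) in q1 * => h.
clearbody u v; have bi := blaschke_identity u v; have den := blaschke_den_ge u v.
have p0 := cmod_ge0 u; have q0 := cmod_ge0 v.
rewrite [cmod (u - v)]cmodB in bi.
have h2 : cmod (v - u) ^+ 2 <= (1 / 2 * cmod (1 - u^* * v)) ^+ 2.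
  by rewrite ler_sqr// nnegrE ?mulr_ge0 ?cmod_ge0//; lra.
have den2 : 1 - cmod u <= cmod (1 - u^* * v).
  by apply: le_trans den; rewrite lerD2l lerN2 ler_piMr// ltW.
have den3 : (1 - cmod u) ^+ 2 <= cmod (1 - u^* * v) ^+ 2.
  by rewrite ler_sqr// nnegrE ?cmod_ge0//; lra.
rewrite exprMn in h2; move: h2 bi den3.
move: (cmod (v - u) ^+ 2) (cmod (1 - u^* * v) ^+ 2) => X Y h2 bi den3.
have h3 : 3 / 4 * (1 - cmod u) * (1 - cmod u) <= (1 + cmod u) * (1 - cmod v ^+ 2) * (1 - cmod u).
  by nra.
have up : 0 < 1 - cmod u by rewrite subr_gt0.
rewrite ler_pM2r// in h3.
have q2 : 0 <= 1 - cmod v ^+ 2 by rewrite subr_ge0 expr_le1// ltW.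
have h4 : 3 / 8 * (1 - cmod u) <= 1 - cmod v ^+ 2 by nra.
nra.
Qed.

(** For every [e] the zero belonging to [phi 0] is [0]. From there to [z] both the number of steps
    and the loss at each step are independent of [e]. *)
Lemma qzero_uniform z : D z -> exists d r : R, [/\ 0 < d, r < 1 & forall w, vmod w <= d ->
  D (z + w) /\ forall e, 0 < e -> cmod (qzero e (z + w)) <= r].
Proof.
have seg1 (x y : 'rV[C R]_n) : x + mkC 1 0 *: (y - x) = y.
  by apply/rowP => i; rewrite !mxE; apply: Ceq; rewrite !ReImE; ring.
move=> Dz; have z1 : cmod (0 : C R) < 1 by rewrite cmod0.
have D0 := phiD z1; set z0 := phi 0 in D0.
have [d1 d10 Hd1] := tube_near D0; have [d2 d20 Hd2] := tube_near Dz.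
pose d := Num.min d1 d2; have d0 : 0 < d by rewrite lt_min d10.
have Hd (s : R) w : 0 <= s <= 1 -> vmod w <= d -> D (z0 + mkC s 0 *: (z - z0) + w).
  move=> s01 wd.
  have w1 : vmod w <= d1 by apply: le_trans wd _; rewrite ge_min lexx.
  have w2 : vmod w <= d2 by apply: le_trans wd _; rewrite ge_min lexx orbT.
  have := convex_setP cD (Hd1 w w1) (Hd2 w w2) s01; congr D.
  by apply/rowP => i; rewrite !mxE; apply: Ceq; rewrite !ReImE; ring.
pose V := vmod (z - z0); have V0 : 0 <= V := vmod_ge0 _.
(* A step has length [V / N], but [qzero_step] advances only half of the vector along which it needs
   a disc in [D]; so [2 * V / N] must be at most [d]. *)
pose N := (Num.bound (2 * V / d)).+1; have N0 : 0 < N%:R :> R by rewrite ltr0n.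
have NV : 2 * V / d <= N%:R.
  have : 0 <= 2 * V / d by rewrite divr_ge0 ?mulr_ge0// ltW.
  move=> /archi_boundP/ltW/le_trans; apply.
  by rewrite ler_nat.
pose pt k := z0 + mkC (k%:R / N%:R) 0 *: (z - z0).
have chain k : (k <= N)%N -> exists2 r : R, r < 1 & forall e, 0 < e -> cmod (qzero e (pt k)) <= r.
  elim: k => [_|k IH kN].
    exists 0 => // e e0; rewrite /pt mul0r [mkC 0 0](_ : _ = 0)// scale0r addr0.
    by rewrite (qzero_eq (ltW e0) D0 z1) ?qpert_phi0 ?cmod0.
  have [r r1 Hr] := IH (ltnW kN); exists (1 - 3 / 16 * (1 - r)); first lra.
  move=> e e0.
  have -> : pt k.+1 = pt k + mkC (1 / 2) 0 *: (mkC (2 / N%:R) 0 *: (z - z0)).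
    rewrite /pt -addrA; congr (_ + _); rewrite scalerA -scalerDl; congr (_ *: _).
    rewrite -mkCM -mkCD; congr mkC; rewrite -natr1; field.
    by rewrite gt_eqF.
  apply: qzero_step => // [l l1|]; last exact: Hr.
  apply: Hd.
    rewrite divr_ge0//= ler_pdivrMr// mul1r ler_nat; exact: ltnW.
  rewrite vmodZ vmodZ cmod_mk0 gtr0_norm ?divr_gt0// -/V.
  apply: (@le_trans _ _ (1 * (2 / N%:R * V))).
    by rewrite ler_wpM2r ?(ltW l1)// mulr_ge0// divr_ge0// ltW.
  by rewrite mul1r mulrAC ler_pdivrMr// -ler_pdivrMl// (mulrC d^-1).
have [r r1 Hr] := chain N (leqnn N).
have ptN : pt N = z.
  by rewrite /pt mulfV ?gt_eqF//; exact: seg1.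
rewrite ptN in Hr.
exists (d / 2), (1 - 3 / 16 * (1 - r)); split; [by rewrite divr_gt0|lra|].
(* A last step, along twice [w], spreads the bound from [z] to a neighbourhood. *)
move=> w wd; have w2 : vmod (mkC 2 0 *: w) <= d.
  by rewrite vmodZ cmod_mk0 gtr0_norm// mulrC -ler_pdivlMr.
have zE : z0 + mkC 1 0 *: (z - z0) = z.
  exact: seg1.
have Dzl l : cmod l < 1 -> D (z + l *: (mkC 2 0 *: w)).
  move=> l1; have := Hd 1 (l *: (mkC 2 0 *: w)); rewrite zE; apply; first by rewrite ler01 lexx.
  by rewrite vmodZ; apply: le_trans w2; rewrite ler_piMl ?vmod_ge0// ltW.
have wE : w = mkC (1 / 2) 0 *: (mkC 2 0 *: w).
  rewrite scalerA -mkCM (_ : 1 / 2 * 2 = 1); last by field.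
  by rewrite [mkC 1 0](_ : _ = 1)// scale1r.
split.
  have h1 : cmod (mkC (1 / 2) 0 : C R) < 1 by rewrite cmod_mk0 gtr0_norm//; lra.
  by have := Dzl _ h1; rewrite -wE.
by move=> e e0; rewrite {1}wE; apply: qzero_step => //; exact: Hr.
Qed.

(** The zero for [s], inserted in the function for [t], leaves [s - t] times itself. By
    [qpert_lower_disc] the zeros are therefore Lipschitz in the perturbation parameter and converge
    as it tends to [0]. *)
Lemma qzero_limit z (r : R) : D z -> r < 1 -> (forall e, 0 < e -> cmod (qzero e z) <= r) ->
  exists l, cmod l <= r /\ qpert 0 z l = 0.
Proof.
move=> Dz r1 H; have [c c0 Hc] := qpert_lower_disc Dz r1.
have F e : 0 < e -> qpert e z (qzero e z) = 0.
  by move=> e0; have [] := qzeroP (qpert_zero_exists e0 Dz).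
have FE e l : qpert e z l = qpert 0 z l - mkC e 0 * l.
  by rewrite /qpert [mkC 0 0](_ : _ = 0)// mul0r subr0.
have Q0 e : 0 < e -> qpert 0 z (qzero e z) = mkC e 0 * qzero e z.
  by move=> /F; rewrite FE => /eqP; rewrite subr_eq0 => /eqP.
pose K := c^-1; have K0 : 0 < K by rewrite invr_gt0.
have lip (s t : R) : 0 < s -> 0 < t -> cmod (qzero s z - qzero t z) <= K * `|s - t|.
  move=> s0 t0; have := Hc t _ _ (ltW t0) (H s s0) (H t t0) (F t t0).
  rewrite FE Q0// -mulrBl => h; rewrite /K mulrC ler_pdivlMr// mulrC; apply: le_trans h _.
  have -> : mkC s 0 - mkC t 0 = mkC (s - t) 0 :> C R by apply: Ceq; rewrite !ReImE; ring.
  by rewrite cmodM cmod_mk0 ler_piMr// (le_trans (H s s0))// ltW.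
have [|x Hx] := @lipschitz_limit R (fun s => ReC (qzero s z)) K.
  move=> s t s0 t0; apply: le_trans (lip s t s0 t0).
  by have := normr_ReC (qzero s z - qzero t z); rewrite ReCD ReCN.
have [|y Hy] := @lipschitz_limit R (fun s => ImC (qzero s z)) K.
  move=> s t s0 t0; apply: le_trans (lip s t s0 t0).
  by have := normr_ImC (qzero s z - qzero t z); rewrite ImCD ImCN.
pose l : C R := mkC x y.
have Hl s : 0 < s -> cmod (qzero s z - l) <= 2 * K * s.
  move=> s0; apply: le_trans (cmod_le_ReIm _) _; rewrite !ReImE.
  by have := Hx s s0; have := Hy s s0; lra.
have lr : cmod l <= r.
  apply/ler_addgt0Pr => e e0; have s0 : 0 < e / (2 * K) by rewrite divr_gt0// mulr_gt0.
  have := Hl _ s0; have := H _ s0; rewrite cmodB.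
  have := cmodD (l - qzero (e / (2 * K)) z) (qzero (e / (2 * K)) z); rewrite subrK.
  by rewrite (mulrC (2 * K)) divfK ?gt_eqF ?mulr_gt0//; lra.
exists l; split => //; apply/eqP; rewrite -cmod_eq0; apply: contraT => G0.
have {}G0 : 0 < cmod (qpert 0 z l) by rewrite lt_def G0 cmod_ge0.
set g := cmod _ in G0; have g4 : 0 < g / 4 by rewrite divr_gt0.
have dG := differentiable_qpert 0 z (le_lt_trans lr r1).
have [d d0 Hd] := differentiable_cts dG g4.
pose s := Num.min (g / 4) (d / (2 * K)).
have K2 : 0 < 2 * K by rewrite mulr_gt0.
have s0 : 0 < s by rewrite lt_min g4 /= divr_gt0.
have sg : s <= g / 4 by rewrite ge_min lexx.
have sd : s * (2 * K) <= d by rewrite -ler_pdivlMr// ge_min lexx orbT.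
have ql : cmod (qzero s z - l) <= d by apply: le_trans (Hl s s0) _; rewrite mulrC.
have := Hd _ ql; rewrite Q0// => h.
have := cmodB_le (mkC s 0 * qzero s z) (mkC s 0 * qzero s z - qpert 0 z l).
rewrite opprB addrCA subrr addr0 -/g cmodM cmod_mk0 gtr0_norm//.
have : s * cmod (qzero s z) <= s * 1 by rewrite ler_wpM2l ?(ltW s0)// (le_trans (H s s0))// ltW.
lra.
Qed.

Theorem left_inverse_exists : exists f : 'rV[C R]_n -> C R,
  [/\ holomorphic_on D f, f @` D `<=` @unit_disc R & forall l, unit_disc l -> f (phi l) = l].
Proof.
have Z z : D z -> exists d r : R, [/\ 0 < d, r < 1 & forall w, vmod w <= d ->
    [/\ D (z + w), qpert 0 (z + w) (qzero 0 (z + w)) = 0 & cmod (qzero 0 (z + w)) <= r]].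
  move=> Dz; have [d [r [d0 r1 H]]] := qzero_uniform Dz; exists d, r; split => // w wd.
  have [Dw Hw] := H w wd; have [l [lr F0]] := qzero_limit Dw r1 Hw.
  by split => //; rewrite (qzero_eq (lexx 0) Dw (le_lt_trans lr r1) F0).
exists (qzero 0); split.
- move=> z Dz; have [d [r [d0 r1 H]]] := Z z Dz.
  exact: qpert_zero_differentiable (lexx 0) r1 d0 H.
- move=> _ [z Dz <-]; apply/unit_discE; have [d [r [d0 r1 H]]] := Z z Dz.
  have v0 : vmod (0 : 'rV[C R]_n) <= d by rewrite /vmod normr0 ltW.
  by have [_ _] := H 0 v0; rewrite addr0 => /le_lt_trans; apply.
- move=> l /unit_discE l1; apply: qzero_eq => //; first exact: phiD.
  exact: qpert0_phi.
Qed.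

End zero_function.

Theorem theorem3p1 (R : realType) (n : nat) (D : set 'rV[C R]_n)
    (phi : C R -> 'rV[C R]_n)
    (mu : 'I_n -> {charge set (circle R) -> \bar R})
    (g rho : circle R -> 'rV[R]_n)
    (nu : {finite_measure set (circle R) -> \bar R})
    (D_convex_tube : convex_tube_domain D)
    (D_no_line : ~ contains_complex_line D)
    (phi_holo : holomorphic_on (@unit_disc R) phi)
    (phi_mu : boundary_measure phi mu)
    (g_borel : borel_map g)
    (g_L1 : forall i, (@arclength R).-integrable setT (fun l => (g l 0 i)%:E))
    (rho_borel : borel_map rho)
    (rho_sphere : forall l, enorm (rho l) = 1)
    (nu_singular : mutually_singular nu (@arclength R))
    (mu_decomp : boundary_decomposition mu g rho nu) :
  (phi @` @unit_disc R `<=` D /\ complex_geodesic D phi <->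
   exists h, [/\ Hclass h, exists z, h z != 0 & geodesic_conditions D phi g rho nu h])
  /\
  (phi @` @unit_disc R `<=` D -> complex_geodesic D phi ->
   forall h, Hclass h -> (exists z, h z != 0) -> geodesic_conditions D phi g rho nu h ->
   [/\ {ae nu, forall l, (S_ D `&` perp [set twist h l]) (rho l)},
       nu [set l | (W_ D)° (twist h l)] = 0%E &
       forall l, closure (W_ D) (twist h l)]).
Proof.
have [tD cD] := D_convex_tube; split; last first.
  move=> _ _ h Hh _ cond; split; first exact: rho_orthogonal Hh cond.
    exact: rho_W_interior rho_sphere Hh cond.
  by move=> l; exact: twist_closure_W Hh cond l.
split=> [[_ geo]|[h [Hh _ [gP rho0 rhoS phi0]]]].
  exact: geodesic_necessary tD cD phi_mu g_L1 rho_borel rho_sphere nu_singular mu_decomp geo.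
(* The conditions involve [h] only through its values on the circle, where it agrees with a vector
   of quadratic polynomials. *)
have [a [b hE]] := twist_repr Hh.
have gP' : {ae @arclength R, forall l, P_ D (hfield a b l) (g l)}.
  by apply: filterS gP => l; rewrite hE.
have rho0' : {ae nu, forall l, 0 <= inner (hfield a b l) (rho l)}.
  by apply: filterS rho0 => l; rewrite hE.
have phi_in := phi_base tD cD phi_mu g_L1 rho_borel rho_sphere mu_decomp gP' rhoS phi0.
have phiD l : cmod l < 1 -> D (phi l) by move=> /phi_in /(tube_mem tD).
have phi_sub : phi @` @unit_disc R `<=` D by move=> _ [l /unit_discE l1 <-]; exact: phiD.
have HQ := qform_negative tD phi_mu g_L1 rho_borel rho_sphere mu_decomp gP' rho0'.
split => //; split => //.
exact: left_inverse_exists tD cD phi_holo phiD HQ.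
Qed.
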